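(* Let $\mathrm{H}\in C^1(\mathbb{R}^{n\times n}_s)$ be a non-negative function, let $\Omega\subseteq\mathbb{R}^n$ be an open set and let $u\in C^3(\Omega)$. Consider the supremal functional $\mathrm{E}_\infty(u,\mathcal{O})=\|\mathrm{H}(\mathrm{D}^2u)\|_{L^\infty(\mathcal{O})}$ and the fully nonlinear equation $\mathrm{A}^2_\infty u=0$. Then: (A) If $u\in\mathrm{AM}^2(\mathrm{E}_\infty,\Omega)\cap C^3(\Omega)$, namely if $u$ is a $C^3$ second order Absolute Minimiser, then $\mathrm{A}^2_\infty u=0$ on $\Omega$. (B) Suppose that $\Omega$ is connected and that $\mathrm{H}$ has the form $\mathrm{H}(X)=\mathbf{H}(A:X)$ for a fixed (strictly) positive matrix $A\in\mathbb{R}^{n\times n}_s$ and some level-convex function $\mathbf{H}\in C^1(\mathbb{R})$ such that $\{\mathbf{H}=t\}$ consists of at most $2$ points. Then the following statements are equivalent: (1) $u\in\mathrm{AM}^2(\mathrm{E}_\infty,\Omega)$. (2) There exists $C\in\mathbb{R}$ such that $A:\mathrm{D}^2u\equiv C$ in $\Omega$. (3) There exists $c\ge0$ such that $\mathbf{H}(A:\mathrm{D}^2u)\equiv c$ in $\Omega$. (4) $\mathrm{A}^2_\infty u=0$ in $\Omega$.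
   Context: $\mathbb{R}^{n\times n}_s$ is the space of real symmetric $n\times n$ matrices, $X:Y=\sum_{i,j}X_{ij}Y_{ij}$, and $\mathrm{H}_X$ is the gradient of $\mathrm{H}$ with respect to its matrix argument. Strictly positive means positive definite. $\mathbf{H}$ is level-convex if for any $t\ge0$ the sublevel set $\{\mathbf{H}\le t\}$ is convex. The operator is $$\mathrm{A}^2_\infty u:=\sum_{i,j,k,l,p,q=1}^n\mathrm{H}_{X_{ij}}(\mathrm{D}^2u)\,\mathrm{H}_{X_{kl}}(\mathrm{D}^2u)\,\mathrm{H}_{X_{pq}}(\mathrm{D}^2u)\,\mathrm{D}^3_{ikl}u\,\mathrm{D}^3_{jpq}u.$$ The functional $\mathrm{E}_\infty(u,\mathcal{O})$ is considered for $u\in W^{2,\infty}(\Omega)$ and measurable $\mathcal{O}\subseteq\Omega$. $\mathrm{AM}^2(\mathrm{E}_\infty,\Omega)$ is the set of second order Absolute Minimisers, that is, of all functions $u\in W^{2,\infty}(\Omega)$ such that $$\mathrm{E}_\infty(u,\Omega')\le\mathrm{E}_\infty(u+\phi,\Omega')\quad\text{for all }\Omega'\Subset\Omega\text{ and all }\phi\in W^{2,\infty}_0(\Omega').$$ Here $\Omega'$ is open with closure compactly contained in $\Omega$, and $W^{2,\infty}_0(\Omega')$ is the space of $W^{2,\infty}(\Omega')$ functions $\phi$ with $\phi=0$ and $\mathrm{D}\phi=0$ on $\partial\Omega'$.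
   Formalization: In (B), the equivalence of (1) with (2)–(4) is stated for u also in W^{2,∞}(Ω), since (2)⇒(1) fails otherwise (u=|x|²/2 on ℝⁿ, A=I); the equivalence of (2), (3), (4) is stated for every u in C³(Ω). *)

(* Defs.v *)
From HB Require Import structures.
From mathcomp Require Import all_boot all_order all_algebra.
From mathcomp Require Import all_classical all_reals all_analysis.

Set Implicit Arguments.
Unset Strict Implicit.
Unset Printing Implicit Defensive.

Import Order.TTheory GRing.Theory Num.Theory.
Import numFieldNormedType.Exports.

Local Open Scope classical_set_scope.
Local Open Scope ring_scope.

(* The library has no measurable structure on row vectors and no
   n-dimensional Lebesgue measure: row vectors get the product sigma-algebra
   (the Borel one when T is the real line), exactly as the library does for
   n.-tuple T, and the measure is the iterated product of the one on the line. *)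
Section measurable_row_vector.
Context d (T : measurableType d) (n : nat).

Let coord (i : 'I_n) (v : 'rV[T]_n) : T := v ord0 i.

Let row_set0 : g_sigma_preimage coord set0.
Proof. exact: sigma_algebra0. Qed.

Let row_setC A : g_sigma_preimage coord A -> g_sigma_preimage coord (~` A).
Proof. exact: sigma_algebraC. Qed.

Let row_bigcup (F : (set 'rV[T]_n)^nat) :
  (forall i, g_sigma_preimage coord (F i)) ->
  g_sigma_preimage coord (\bigcup_i (F i)).
Proof. exact: sigma_algebra_bigcup. Qed.

HB.instance Definition _ := @isMeasurable.Build (measure_tuple_display d)
  'rV[T]_n (g_sigma_preimage coord) row_set0 row_setC row_bigcup.

End measurable_row_vector.

Definition row_cons (T : Type) (n : nat) (p : T * 'rV[T]_n) : 'rV[T]_n.+1 :=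
  \row_i (if unlift ord0 i is Some j then p.2 ord0 j else p.1).

Lemma measurable_row_coord d (T : measurableType d) n (i : 'I_n) :
  measurable_fun [set: 'rV[T]_n] (fun v => v ord0 i).
Proof.
move=> _ Y mY; rewrite setTI; apply: sub_sigma_algebra => /=.
rewrite -bigcup_seq/=; exists i => /=; first by rewrite mem_index_enum.
by exists Y => //; rewrite setTI.
Qed.

Lemma measurable_rowP d d' (S : measurableType d') (T : measurableType d) n
    (f : S -> 'rV[T]_n) :
  (forall i, measurable_fun [set: S] (fun x => f x ord0 i)) ->
  measurable_fun [set: S] f.
Proof.
move=> mf.
suff sub : @measurable _ 'rV[T]_n `<=` [set A | measurable (f @^-1` A)].
  by move=> _ A mA; rewrite setTI; exact: sub.
apply: smallest_sub.
  split=> [|A mA|F mF] /=; first by rewrite preimage_set0.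
    by rewrite setTD -preimage_setC; exact: measurableC.
  by rewrite preimage_bigcup; apply: bigcupT_measurable.
rewrite -bigcup_seq/=; apply: bigcup_sub => i _ A [B mB <-].
by have := mf i measurableT B mB; rewrite !setTI.
Qed.

Lemma measurable_row_cons d (T : measurableType d) n :
  measurable_fun [set: T * 'rV[T]_n] (@row_cons T n).
Proof.
apply: measurable_rowP => i; rewrite /row_cons.
under eq_fun do rewrite mxE.
case: unliftP => [j _|_]; last exact: measurable_fst.
exact: measurableT_comp (measurable_row_coord j) measurable_snd.
Qed.

Definition row_uncons (T : Type) (n : nat) (v : 'rV[T]_n.+1) : T * 'rV[T]_n :=
  (v ord0 ord0, \row_j v ord0 (lift ord0 j)).

Lemma row_consK (T : Type) n : cancel (@row_cons T n) (@row_uncons T n).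
Proof.
move=> [x v]; rewrite /row_uncons /row_cons mxE unlift_none; congr pair.
by apply/rowP => j; rewrite !mxE liftK.
Qed.

Lemma measurable_row_uncons d (T : measurableType d) n :
  measurable_fun [set: 'rV[T]_n.+1] (@row_uncons T n).
Proof.
apply/measurable_fun_pairP; split; first exact: measurable_row_coord.
apply: measurable_rowP => i.
by under eq_fun do rewrite /= mxE; exact: measurable_row_coord.
Qed.

Section lebesgue_measure_row_vector.
Variable R : realType.

Section successor.
Variables (n : nat) (mu : {sigma_finite_measure set 'rV[R]_n -> \bar R}).

Let prod :
  {measure set (measurableTypeR R * 'rV[R]_n)%type -> \bar R} :=
  (lebesgue_measure \x mu)%E.

Definition leb_cons : set 'rV[R]_n.+1 -> \bar R :=
  pushforward prod (@row_cons R n).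

Let leb_cons0 : leb_cons set0 = 0%E.
Proof. by rewrite /leb_cons /pushforward preimage_set0 measure0. Qed.

Let leb_cons_ge0 A : (0 <= leb_cons A)%E.
Proof. exact: (measure_ge0 prod). Qed.

Let leb_cons_sigma_additive : semi_sigma_additive leb_cons.
Proof.
have mpre A : measurable A -> measurable (@row_cons R n @^-1` A).
  by move=> mA; rewrite -[X in measurable X]setTI; exact: measurable_row_cons.
move=> F mF tF mUF; rewrite /leb_cons /pushforward preimage_bigcup.
apply: measure_semi_sigma_additive.
- by move=> k; exact: mpre.
- apply/trivIsetP => i j _ _ ij; rewrite -preimage_setI.
  by move/trivIsetP : tF => /(_ _ _ _ _ ij) ->//; rewrite preimage_set0.
- by rewrite -preimage_bigcup; exact: mpre.
Qed.

HB.instance Definition _ := isMeasure.Build _ _ _ leb_cons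
  leb_cons0 leb_cons_ge0 leb_cons_sigma_additive.

Let leb_cons_sigma_finite : sigma_finite setT leb_cons.
Proof.
have /sigma_finiteP[F [FT ndF Foo]] := sigma_finiteT (@lebesgue_measure R).
have /sigma_finiteP[G [GT ndG Goo]] := sigma_finiteT mu.
exists (fun k => @row_uncons R n @^-1` (F k `*` G k)).
  apply/esym; rewrite -subTset => v _.
  have [i _ Fi] : (\bigcup_i F i) (v ord0 ord0) by rewrite -FT.
  have [j _ Gj] : (\bigcup_i G i) (row_uncons v).2 by rewrite -GT.
  exists (maxn i j) => //; split.
    by move: Fi; exact/subsetPset/ndF/leq_maxl.
  by move: Gj; exact/subsetPset/ndG/leq_maxr.
move=> k; have [mF Fk] := Foo k; have [mG Gk] := Goo k; split.
  rewrite -[X in measurable X]setTI.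
  have := @measurable_row_uncons _ (measurableTypeR R) n.
  by apply => //; exact: measurableX.
rewrite /leb_cons /pushforward.
rewrite [X in prod X](_ : _ = F k `*` G k); last first.
  by rewrite -comp_preimage (_ : _ \o _ = id) ?preimage_id//; exact/funext/row_consK.
rewrite [ltLHS](product_measure1E _ _ mF mG).
by rewrite lte_mul_pinfty// ge0_fin_numE.
Qed.

HB.instance Definition _ :=
  Measure_isSigmaFinite.Build _ _ _ leb_cons leb_cons_sigma_finite.

End successor.

Fixpoint leb (n : nat) : {sigma_finite_measure set 'rV[R]_n -> \bar R} :=
  match n return {sigma_finite_measure set 'rV[R]_n -> \bar R} with
  | 0 => \d_(0 : 'rV[R]_0)
  | m.+1 => leb_cons (leb m)
  end.

End lebesgue_measure_row_vector.

Section classical_calculus.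
Variables (R : realType) (n : nat).
Implicit Types (Om O : set 'rV[R]_n) (f u : 'rV[R]_n -> R).

Definition partial (i : 'I_n) f : 'rV[R]_n -> R :=
  fun x => 'D_(delta_mx ord0 i) f x.

(* For open Om this is the space of functions all of whose iterated partial
   derivatives of order at most k exist and are continuous on Om; nothing is
   required of f outside of Om. *)
Fixpoint Ck (k : nat) Om f : Prop :=
  (forall x, Om x -> {for x, continuous f}) /\
  match k with
  | 0 => True
  | k'.+1 => forall i, (forall x, Om x -> derivable f x (delta_mx ord0 i)) /\
                       Ck k' Om (partial i f)
  end.

Definition hessian u (x : 'rV[R]_n) : 'M[R]_n :=
  \matrix_(i, j) partial j (partial i u) x.

Definition third u (x : 'rV[R]_n) (i k l : 'I_n) : R :=
  partial l (partial k (partial i u)) x.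

Definition compactly_contained O Om : Prop :=
  compact (closure O) /\ closure O `<=` Om.

Definition test_function Om (z : 'rV[R]_n -> R) : Prop :=
  (forall k, Ck k setT z) /\ compactly_contained [set x | z x != 0] Om.

End classical_calculus.

Section symmetric_matrices.
Variables (R : realType) (n : nat).
Implicit Types (X Y A : 'M[R]_n) (H : 'M[R]_n -> R).

Definition mxdot X Y : R := \sum_i \sum_j X i j * Y i j.

Definition posdef A : Prop :=
  forall v : 'rV[R]_n, v != 0 -> 0 < (v *m A *m v^T) ord0 ord0.

(* A function on symmetric matrices is a function on all matrices of which
   only the values at symmetric ones matter. The inner product of a symmetric
   matrix G with sym_unit i j is G i j: differentiating along it thus yields
   the (i, j) entry of the gradient of H in the space of symmetric matrices. *)
Definition sym_unit (i j : 'I_n) : 'M[R]_n :=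
  2^-1 *: (delta_mx i j + delta_mx j i).

Definition mxgrad H X : 'M[R]_n := \matrix_(i, j) 'D_(sym_unit i j) H X.

Definition C1_sym H : Prop :=
  forall i j,
    (forall X, X \is symmetricmx -> derivable H X (sym_unit i j)) /\
    {within [set X : 'M[R]_n | X \is symmetricmx],
       continuous (fun X => mxgrad H X i j)}.

Definition A2infty H (u : 'rV[R]_n -> R) (x : 'rV[R]_n) : R :=
  let G := mxgrad H (hessian u x) in
  \sum_i \sum_j \sum_k \sum_l \sum_p \sum_q
    G i j * G k l * G p q * third u x i k l * third u x j p q.

End symmetric_matrices.

Section real_functions.
Variable R : realType.
Implicit Type h : R -> R.

Definition C1 h : Prop := (forall t, derivable h t 1) /\ continuous (derive1 h).

Definition level_convex h : Prop :=
  forall t, 0 <= t -> convex_set ([set s | h s <= t] : set R^o).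

End real_functions.

Section sobolev.
Variables (R : realType) (n : nat).
Local Notation mu := (leb R n).
Implicit Types (Om O : set 'rV[R]_n) (f g u phi : 'rV[R]_n -> R).

(* Elements of Lebesgue and Sobolev spaces are represented by functions that
   are Borel on Om; values outside of Om are irrelevant, and all the notions
   below are invariant under modification on a null set. *)
Definition Linfty_norm Om f : \bar R := 'N[mu]_+oo[EFin \o (f \_ Om)].

Definition Linfty Om f : Prop :=
  measurable_fun Om f /\ (Linfty_norm Om f < +oo)%E.

Definition weak_partial Om (i : 'I_n) f g : Prop :=
  forall z, test_function Om z ->
    \int[mu]_(x in Om) (f x * partial i z x) =
    - \int[mu]_(x in Om) (g x * z x).

Definition weak_jet Om u (p : 'rV[R]_n -> 'rV[R]_n) (X : 'rV[R]_n -> 'M[R]_n)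
    : Prop :=
  Linfty Om u /\
  (forall i, Linfty Om (fun x => p x ord0 i) /\
             weak_partial Om i u (fun x => p x ord0 i)) /\
  (forall i j, Linfty Om (fun x => X x i j) /\
               weak_partial Om j (fun x => p x ord0 i) (fun x => X x i j)).

Definition W2infty Om u : Prop := exists p X, weak_jet Om u p X.

(* Weak derivatives are unique up to null sets; a representative is chosen
   (with dummy value 0 when u is not in the Sobolev space). *)
Definition weak_gradient Om u : 'rV[R]_n -> 'rV[R]_n :=
  xget (cst 0) [set p | exists X, weak_jet Om u p X].

Definition weak_hessian Om u : 'rV[R]_n -> 'M[R]_n :=
  xget (cst 0) [set X | exists p, weak_jet Om u p X].

(* f = 0 on the boundary of O, for the representative of f which is
   continuous up to the boundary. *)
Definition zero_on_boundary O f : Prop :=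
  exists g, [/\ {within closure O, continuous g},
                {ae mu, forall x, O x -> g x = f x} &
                forall x, (closure O `\` O^°) x -> g x = 0].

Definition W2infty0 O phi : Prop :=
  [/\ W2infty O phi, zero_on_boundary O phi &
      forall i, zero_on_boundary O (fun x => weak_gradient O phi x ord0 i)].

Definition Einfty (H : 'M[R]_n -> R) Om u O : \bar R :=
  Linfty_norm O (H \o weak_hessian Om u).

(* A competitor u + phi lives on O only, so both sides are computed with the
   Sobolev functions restricted to O. *)
Definition AM2 (H : 'M[R]_n -> R) Om u : Prop :=
  W2infty Om u /\
  forall O, open O -> compactly_contained O Om ->
  forall phi, W2infty0 O phi ->
    (Einfty H O u O <= Einfty H O (u \+ phi)%R O)%E.

End sobolev.

(* Main.v *)
From mathcomp Require Import all_boot all_order all_algebra.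
From mathcomp Require Import all_classical all_reals all_analysis.
From mathcomp Require Import measurable_realfun ess_sup_inf.
From mathcomp Require Import ring lra.
Require Import Defs.
Set Implicit Arguments.
Unset Strict Implicit.
Unset Printing Implicit Defensive.
Import Order.TTheory GRing.Theory Num.Theory.
Import numFieldNormedType.Exports.
Local Open Scope classical_set_scope.
Local Open Scope ring_scope.

(** Throughout, [G] denotes the gradient of [H] at the Hessian of [u], and the
    drift is the gradient of the energy density [H (hessian u)]; the operator is
    the quadratic form of [G] at the drift ([A2infty_drift]).

    Minimisers solve the equation ([AM2_A2infty]). Suppose that the operator does
    not vanish at [x0], and let [v] be the drift there. Put [x = x0 + rho z]. To
    first order in [rho], the energy density is [H] at the Hessian at [x0] plus
    [rho] times the linear function [v . z], whose maximum over the ball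
    [|z| <= |v|] is attained at [z = v] only. The quartic
    [(e / rho) (rho^2 |v|^2 - |x - x0|^2)^2] vanishes on the sphere
    [|x - x0| = rho |v|] together with its gradient, so it is an admissible
    variation. Its Hessian is of order [rho] too, and at [z = v] it is
    [8 rho e v v^T]; there it changes the energy density by [8 rho e] times the
    operator at [x0]. For a suitable small [e] of the right sign the maximum over
    the whole ball goes down ([perturbed_maximum]), by an amount of order [rho]
    that dominates the error of the expansion ([perturbed_expansion]). This
    contradicts minimality.

    Functions of a linear contraction. Let [s] be the contraction of [A] with the
    Hessian. The operator is [h'(s)^3] times the quadratic form of [A] at the
    gradient of [s] ([A2infty_linear]). As [A] is positive, it vanishes if and
    only if [h'(s)] times the gradient of [s], that is the gradient of [h(s)],
    does; on a connected set this means that [h(s)] is constant. As level sets of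
    [h] have at most two points and [s] is continuous, [s] is constant as well
    ([constant_equivalences]).

    Constant contractions minimise ([constant_AM2]). If [s] is a constant [C], then
    the contraction for a competitor [u + phi] is [C + a], where [a] is the
    contraction of [A] with the weak Hessian of [phi]. The integral of [a] over
    the domain [O] of the variation is zero, because the gradient of [phi]
    vanishes on the boundary. If the energy of [u + phi] were less than [h(C)],
    then [C + a] would almost everywhere belong to a sublevel set of [h], an
    interval without [C]; so [a] would be positive almost everywhere or negative
    almost everywhere, which is absurd.

    The analytic core is that a weak derivative [X] in the direction [j] of a
    function [f] vanishing on the boundary of an arbitrary bounded open set [O]
    has integral zero ([zero_trace_integral]). Testing the weak derivative with
    functions whose [j]-th derivative is the difference of two translates of a
    bump shows that [f] is locally Lipschitz in the direction [j]. A
    one-dimensional argument extends the bound across the zeros of the extension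
    of [f] by zero ([zero_extension_lipschitz]). For a cutoff function
    [0 <= z <= 1] in [O] it follows, by moving difference quotients from [z] to
    [f], that the integral of [X z] is at most [M] times that of [1 - z] over [O]
    ([cutoff_estimate]), and [z] can be taken arbitrarily close to [1].

    These arguments rest on three facts about Lebesgue measure and Sobolev
    functions. Translation invariance makes the integral of a partial derivative
    with compact support vanish, whence integration by parts
    ([integral_partial0], [integral_by_parts]). There are enough smooth bumps on
    boxes for a bounded function to be determined by its integrals against test
    functions ([test_fundamental]); so weak derivatives are unique, and weak
    Hessians are symmetric and agree with classical ones ([weak_jet_unique],
    [weak_jet_sym], [Ck_weak_jet]). Finally [H] is only differentiable along symmetric
    matrices, with continuous derivatives, and this suffices for a first order
    expansion ([taylor_sym]). *)

(** * Lebesgue measure on row vectors *)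

Section boxes.
Variable R : realType.

Definition rbox n (a b : 'rV[R]_n) : set 'rV[R]_n :=
  [set v | forall i, a ord0 i < v ord0 i < b ord0 i].

Definition rboxes n : set (set 'rV[R]_n) :=
  [set B | exists a b, B = rbox a b].

Lemma rboxE n (a b : 'rV[R]_n) : rbox a b =
  \bigcap_(i : 'I_n) ((fun v : 'rV[R]_n => v ord0 i) @^-1` `]a ord0 i, b ord0 i[).
Proof.
apply/seteqP; split => v /= h; first by move=> i _; rewrite /= in_itv/= h.
by move=> i; have := h i I; rewrite /= in_itv.
Qed.

Lemma measurable_rbox n (a b : 'rV[R]_n) : measurable (rbox a b).
Proof.
rewrite rboxE; apply: fin_bigcap_measurable => [|i _]; first exact: finite_finset.
rewrite -[X in measurable X]setTI.
by apply: (@measurable_row_coord _ (measurableTypeR R) n i measurableT); exact: measurable_itv.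
Qed.

Lemma setI_rboxE n (a b c d : 'rV[R]_n) :
  rbox a b `&` rbox c d = rbox (\row_i Num.max (a ord0 i) (c ord0 i))
                               (\row_i Num.min (b ord0 i) (d ord0 i)).
Proof.
apply/seteqP; split => v /=.
  move=> [h1 h2] i; rewrite !mxE gt_max lt_min.
  have /andP[a1 b1] := h1 i; have /andP[c1 d1] := h2 i.
  by rewrite a1 b1 c1 d1.
by move=> h; split => i; have := h i; rewrite !mxE gt_max lt_min => /andP[/andP[p1 p2] /andP[p3 p4]]; apply/andP.
Qed.

Lemma setI_rboxes n : setI_closed (@rboxes n).
Proof.
by move=> _ _ [a [b ->]] [c [d ->]]; rewrite setI_rboxE; eexists; eexists.
Qed.

(** The cubes exhaust the space; bounded supports are measured against them. *)
Definition cube n (k : nat) : set 'rV[R]_n := rbox (const_mx (- k%:R)) (const_mx k%:R).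

Lemma bigcup_cube n : \bigcup_k (@cube n k) = setT.
Proof.
apply/seteqP; split => // v _; exists (Num.bound (\sum_i `|v ord0 i|)) => // i.
rewrite !mxE -ltr_norml (le_lt_trans _ (archi_boundP _)) ?sumr_ge0//.
by rewrite (bigD1 i)//= lerDl sumr_ge0.
Qed.

(** A half-space given by one coordinate is the union of its traces on the cubes,
    so that boxes generate the product sigma-algebra. *)
Lemma measurable_rowE n : @measurable _ 'rV[R]_n = <<s @rboxes n >>.
Proof.
apply/seteqP; split; last first.
  apply: smallest_sub; first exact: sigma_algebra_measurable.
  by move=> _ [a [b ->]]; exact: measurable_rbox.
apply: smallest_sub; first exact: smallest_sigma_algebra.
rewrite -bigcup_seq/=; apply: bigcup_sub => i _ A [B mB <-]; rewrite setTI.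
suff : measurable `<=` [set B : set R | <<s @rboxes n >> ((fun v : 'rV[R]_n => v ord0 i) @^-1` B)].
  exact.
have mE : @measurable _ (measurableTypeR R) = <<s @RGenInftyO.G R >>.
  exact: RGenInftyO.measurableE.
rewrite [X in X `<=` _]mE; apply: smallest_sub.
  have := @sigma_algebra_image _ _ setT (fun v : 'rV[R]_n => v ord0 i) <<s @rboxes n >> (smallest_sigma_algebra _ _).
  by rewrite /image_set_system; under eq_fun do rewrite setTI.
move=> _ [x ->] /=.
have -> : (fun v : 'rV[R]_n => v ord0 i) @^-1` `]-oo, x[ =
    \bigcup_k rbox (const_mx (- k%:R)) (\row_l if l == i then x else k%:R : R).
  apply/seteqP; split => v /=.
    rewrite in_itv/= => vx.
    have : [set: 'rV[R]_n] v by [].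
    rewrite -bigcup_cube => -[k _ vk]; exists k => // l.
    have := vk l; rewrite !mxE => /andP[-> ?] /=.
    by case: eqP => [->|].
  move=> [k _ /(_ i)]; rewrite !mxE eqxx in_itv/=.
  by case/andP.
apply: sigma_algebra_bigcup => k; apply: sub_sigma_algebra.
by eexists; eexists.
Qed.

(** Boxes form a generating pi-system that covers the space. *)
Lemma measure_rboxes_unique n (m1 m2 : {measure set 'rV[R]_n -> \bar R}) :
  (forall a b, m1 (rbox a b) = m2 (rbox a b)) ->
  (forall k, (m1 (@cube n k) < +oo)%E) ->
  forall A, measurable A -> m1 A = m2 A.
Proof.
move=> m12 fin; apply: (measure_unique (@rboxes n) (@cube n)) => //.
- exact: measurable_rowE.
- exact: setI_rboxes.
- by move=> i; eexists; eexists.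
- exact: bigcup_cube.
- by move=> _ [a [b ->]].
Qed.

Lemma row_cons_rbox n (a b : 'rV[R]_n.+1) : @row_cons R n @^-1` (rbox a b) =
  `]a ord0 ord0, b ord0 ord0[%classic `*` rbox (row_uncons a).2 (row_uncons b).2.
Proof.
have c0 t y : @row_cons R n (t, y) ord0 ord0 = t by rewrite mxE unlift_none.
have cl t y k : @row_cons R n (t, y) ord0 (lift ord0 k) = y ord0 k by rewrite mxE liftK.
apply/seteqP; split => -[t y] /=.
  move=> h; split; first by rewrite in_itv/=; have := h ord0; rewrite c0.
  by move=> k; rewrite !mxE; have := h (lift ord0 k); rewrite cl.
rewrite in_itv/= => -[h1 h2] i; case: (unliftP ord0 i) => [k ->|->].
  by rewrite cl; have := h2 k; rewrite !mxE.
by rewrite c0.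
Qed.

Lemma leb_rbox n (a b : 'rV[R]_n) :
  leb R n (rbox a b) = (\prod_i Num.max 0 (b ord0 i - a ord0 i))%:E.
Proof.
elim: n a b => [|n ih] a b.
  rewrite big_ord0 /= diracE mem_set// /rbox/=.
  by case.
rewrite [LHS](_ : _ = (lebesgue_measure \x leb R n)%E (@row_cons R n @^-1` (rbox a b)))//.
rewrite row_cons_rbox [LHS](@product_measure1E _ _ _ _ _ lebesgue_measure (leb R n) _ _ _ _)//; last first.
  exact: measurable_rbox.
rewrite ih.
rewrite (bigD1_ord ord0)//= EFinM; congr (_ * _)%E.
  rewrite lebesgue_measure_itv/= lte_fin; case: ltP => h.
    by rewrite max_r// subr_ge0 ltW.
  by rewrite max_l// subr_le0.
by congr EFin; apply: eq_bigr => i _; rewrite !mxE.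
Qed.

Lemma leb_rbox_lty n (a b : 'rV[R]_n) : (leb R n (rbox a b) < +oo)%E.
Proof. by rewrite [ltLHS]leb_rbox ltry. Qed.

End boxes.

Section row_borel.
Variables (R : realType) (n : nat).
Implicit Types (O : set 'rV[R]_n) (f : 'rV[R]_n -> R).

Lemma rbox_ballP (x y : 'rV[R]_n) (e : R) : 0 < e ->
  ball x e y <-> rbox (x - const_mx e) (x + const_mx e) y.
Proof.
move=> e0; split.
  move=> [_ h] i; have := h ord0 i; rewrite /ball/= !mxE.
  by rewrite ltr_distlC.
move=> h; split => // k i; rewrite ord1; have := h i.
by rewrite /ball/= !mxE ltr_distlC.
Qed.

Lemma open_rboxP O : open O <->
  forall x, O x -> exists2 e : R, 0 < e & rbox (x - const_mx e) (x + const_mx e) `<=` O.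
Proof.
rewrite openE; split.
  move=> h x /h /nbhs_ballP[e /= e0 xO]; exists e => // y.
  by move=> /(rbox_ballP _ _ e0) /xO.
move=> h x /h[e e0 xO]; apply/nbhs_ballP; exists e => //= y.
by move=> /(rbox_ballP _ _ e0) /xO.
Qed.

Definition rat_row (q : 'rV[rat]_n) : 'rV[R]_n := map_mx ratr q.

Lemma rat_between_row (x : 'rV[R]_n) (e : R) : 0 < e ->
  exists p q : 'rV[rat]_n, forall i,
    x ord0 i - e < ratr (p ord0 i) < x ord0 i /\ x ord0 i < ratr (q ord0 i) < x ord0 i + e.
Proof.
move=> e0.
have h i : exists pq : rat * rat, x ord0 i - e < ratr pq.1 < x ord0 i /\ x ord0 i < ratr pq.2 < x ord0 i + e.
  have [p] : exists p : rat, ratr p \in `]x ord0 i - e, x ord0 i[.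
    by apply: rat_in_itvoo; rewrite gtrBl.
  have [q] : exists p : rat, ratr p \in `]x ord0 i, x ord0 i + e[.
    by apply: rat_in_itvoo; rewrite ltrDl.
  by rewrite !in_itv/= => hq hp; exists (p, q).
have /choice[F hF] := h.
by exists (\row_i (F i).1), (\row_i (F i).2) => i; rewrite !mxE; exact: hF.
Qed.

(** Rational boxes are countably many, which reduces statements about open sets
    to statements about boxes; the closed boxes are required to stay in [O], so
    that test functions may live on them. *)
Lemma open_bigcup_rat_rbox O : open O ->
  O = \bigcup_(pq in [set pq : 'rV[rat]_n * 'rV[rat]_n |
        [set v : 'rV[R]_n | forall i, ratr (pq.1 ord0 i) <= v ord0 i <= ratr (pq.2 ord0 i)] `<=` O])
      rbox (rat_row pq.1) (rat_row pq.2).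
Proof.
move=> /open_rboxP oO; apply/seteqP; split => x; last first.
  move=> [pq /= pqO xpq]; apply: pqO => i /=; have := xpq i; rewrite !mxE.
  by move=> /andP[/ltW -> /ltW ->].
move=> /oO[e e0 xO]; have [p [q pq]] := rat_between_row x e0.
exists (p, q) => /=; last by move=> i; rewrite !mxE; have [/andP[_ ->] /andP[->]] := pq i.
move=> v vpq; apply: xO => i; rewrite !mxE.
have [/andP[p1 p2] /andP[q1 q2]] := pq i; have /andP[v1 v2] := vpq i.
by rewrite (lt_le_trans p1)//= (le_lt_trans v2).
Qed.

Lemma open_measurable_row O : open O -> measurable O.
Proof.
move=> /open_bigcup_rat_rbox ->; rewrite bigcup_mkcond.
apply: countable_bigcupT_measurable; first exact: countableP.
move=> pq; case: ifPn => _; [exact: measurable_rbox|exact: measurable0].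
Qed.

Lemma open_continuous_preimage O f (B : set R) : open O -> open B ->
  (forall x, O x -> {for x, continuous f}) -> open (O `&` f @^-1` B).
Proof.
move=> oO oB cf; rewrite openE => x [Ox Bx]; apply: filterI.
  exact: open_nbhs_nbhs.
by apply: (cf x Ox); exact: open_nbhs_nbhs.
Qed.

Lemma continuous_on_measurable O f : open O ->
  (forall x, O x -> {for x, continuous f}) -> measurable_fun O f.
Proof.
move=> oO cf; apply: (measurability (@RGenOpens.G R)).
  exact: RGenOpens.measurableE.
move=> _ [_ [a [b ->] <-]].
apply: open_measurable_row; exact: open_continuous_preimage.
Qed.

Lemma continuous_measurable_row f : continuous f -> measurable_fun setT f.
Proof. by move=> cf; exact: (@continuous_on_measurable setT f openT (fun x _ => cf x)). Qed.

Lemma leb_open_gt0 O : open O -> O !=set0 -> (0 < leb R n O)%E.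
Proof.
move=> oO [x Ox]; have [e e0 xO] := (open_rboxP O).1 oO x Ox.
apply: (@lt_le_trans _ _ (leb R n (rbox (x - const_mx e) (x + const_mx e)))).
  rewrite leb_rbox lte_fin prodr_gt0// => i _; rewrite !mxE lt_max.
  by apply/orP; right; lra.
by apply: le_measure => //; rewrite inE; [exact: measurable_rbox|exact: open_measurable_row].
Qed.

Lemma bounded_sub_cube O : bounded_set O -> exists k, O `<=` @cube R n k.
Proof.
move=> [M [_ h]]; exists (Num.bound (M + 1)) => v Ov i; rewrite !mxE -ltr_norml.
have vM : `|v| <= M + 1 by apply: (h (M + 1)) => //; rewrite ltrDl.
have M0 : 0 <= M + 1 by exact: le_trans vM.
apply: le_lt_trans (archi_boundP M0); apply: le_trans vM.
rewrite [leRHS]/Num.norm /= mx_normrE; apply/bigmax_geP; right => /=.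
by exists (ord0, i).
Qed.

Lemma leb_bounded O : measurable O -> bounded_set O -> (leb R n O < +oo)%E.
Proof.
move=> mO /bounded_sub_cube[k Ok].
apply: (@le_lt_trans _ _ (leb R n (@cube R n k))).
  by apply: le_measure => //; rewrite inE//; exact: measurable_rbox.
exact: leb_rbox_lty.
Qed.

Lemma compact_leb O : compact (closure O) -> measurable O -> (leb R n O < +oo)%E.
Proof.
move=> cO mO; apply: leb_bounded => //.
have [M [Mr h]] := compact_bounded cO.
by exists M; split => // N /h hN x /subset_closure; exact: hN.
Qed.
End row_borel.

Section translation.
Variables (R : realType) (n : nat) (c : 'rV[R]_n).
Local Notation mu := (leb R n).

Lemma measurable_translate : measurable_fun setT (fun x : 'rV[R]_n => x + c).
Proof.
apply: measurable_rowP => i; under eq_fun do rewrite mxE.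
by apply: measurable_funD => //; exact: measurable_row_coord.
Qed.

Let translated : {measure set 'rV[R]_n -> \bar R}.
Proof.
unshelve refine [the measure _ _ of pushforward mu (fun x : 'rV[R]_n => x + c)].
exact: measurable_translate.
Defined.

(** The volume of a box only depends on its side lengths. *)
Lemma leb_translate A : measurable A -> mu A = pushforward mu (fun x => x + c) A.
Proof.
have E (a b : 'rV[R]_n) : mu (rbox a b) = translated (rbox a b).
  rewrite [RHS](_ : _ = mu (rbox (a - c) (b - c))).
    rewrite !leb_rbox; congr (_ %:E); apply: eq_bigr => i _; congr Num.max.
    by rewrite !mxE; ring.
  congr (mu _); apply/seteqP; split => x /= h i; have := h i; rewrite !mxE.
    by rewrite ltrBlDr ltrBrDr.
  by rewrite ltrBlDr ltrBrDr.
by apply: (measure_rboxes_unique (m2 := translated)) => // k; exact: leb_rbox_lty.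
Qed.

Lemma integral_translate (f : 'rV[R]_n -> \bar R) : measurable_fun setT f ->
  mu.-integrable setT (fun x : 'rV[R]_n => f (x + c)) ->
  (\int[mu]_x f ((x : 'rV[R]_n) + c)%R = \int[mu]_x f x)%E.
Proof.
move=> mf intf.
rewrite [RHS](eq_measure_integral translated); last by move=> A mA _; exact: leb_translate.
exact/esym/(integral_pushforward measurable_translate mf intf measurableT).
Qed.
End translation.

(** * Functions whose integrals over boxes vanish *)

Lemma ae_forall_count d (T : measurableType d) (R : realType)
    (mu : {measure set T -> \bar R}) (I : countType) (P : I -> T -> Prop) :
  (forall i, \forall x \ae mu, P i x) -> \forall x \ae mu, forall i, P i x.
Proof.
move=> h.
have : \forall x \ae mu, forall k, (if unpickle k is Some i then P i x else True).
  apply: ae_foralln => k; case: unpickle => [i|]; first exact: h.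
  exact: nearW.
by apply: filterS => x hx i; have := hx (pickle i); rewrite pickleK.
Qed.

Lemma integrable_bounded d (T : measurableType d) (R : realType)
    (mu : {measure set T -> \bar R}) (A : set T) (f : T -> R) (M : R) :
  measurable A -> (mu A < +oo)%E -> measurable_fun A f ->
  (forall x, A x -> `|f x| <= M) -> mu.-integrable A (EFin \o f).
Proof.
move=> mA Aoo mf fM; apply: measurable_bounded_integrable => //.
exists M; split; first exact: num_real.
by move=> N MN x Ax; exact: le_trans (fM _ Ax) (ltW MN).
Qed.

Section box_fundamental.
Variables (R : realType) (n : nat).
Local Notation mu := (leb R n).
Local Open Scope ereal_scope.
Implicit Types (O : set 'rV[R]_n) (g : 'rV[R]_n -> R).

Definition cbox (a b : 'rV[R]_n) : set 'rV[R]_n :=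
  [set v | forall i, (a ord0 i <= v ord0 i <= b ord0 i)%R].

Lemma rbox_cbox a b : rbox a b `<=` cbox a b.
Proof. by move=> v h i; have /andP[/ltW -> /ltW ->] := h i. Qed.

Let vanish_on_box g p q (M : R) :
  measurable_fun (rbox p q) g -> (forall x, rbox p q x -> (`|g x| <= M)%R) ->
  (forall a b, cbox a b `<=` cbox p q -> \int[mu]_(x in rbox a b) (g x)%:E = 0) ->
  {ae mu, forall x, rbox p q x -> g x = 0%R}.
Proof.
set B := rbox p q => mg gM g0.
have mB : measurable B by exact: measurable_rbox.
have ig : mu.-integrable B (EFin \o g).
  by apply: (integrable_bounded (M := M)) => //; exact: leb_rbox_lty.
have igE (E : set 'rV[R]_n) : measurable E -> mu.-integrable (E `&` B) (EFin \o g).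
  by move=> mE; apply: integrableS ig => //; exact: measurableI.
have E0 (E : set 'rV[R]_n) : measurable E -> \int[mu]_(x in E `&` B) (g x)%:E = 0.
  rewrite measurable_rowE.
  apply: (dynkin_induction (P := fun E => \int[mu]_(x in E `&` B) (g x)%:E = 0)
    (@measurable_rowE R n) (@setI_rboxes R n)).
  - by rewrite setTI; apply: g0.
  - move=> _ [a [b ->]] /=.
    have -> : rbox a b `&` B = rbox (\row_i Num.max (a ord0 i) (p ord0 i))
        (\row_i Num.min (b ord0 i) (q ord0 i)) by exact: setI_rboxE.
    by apply: g0 => v vab i; have := vab i; rewrite !mxE ge_max le_min;
      move=> /andP[/andP[_ ->] /andP[_ ->]].
  - move=> S mS S0.
    have : \int[mu]_(x in (S `&` B) `|` (~` S `&` B)) (g x)%:E = 0.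
      by rewrite -setIUl setUv setTI; exact: g0.
    rewrite integral_setU.
    + by rewrite S0 add0e.
    + exact: measurableI.
    + by apply: measurableI => //; exact: measurableC.
    + by rewrite -setIUl setUv setTI; apply/measurable_EFinP.
    + by apply/disj_set2P; rewrite setIACA setICr set0I.
  - move=> F mF tF F0; rewrite setI_bigcupl integral_bigcup.
    + by apply: eseries0 => i _ _; exact: F0.
    + exact: trivIset_setIr.
    + by move=> k; exact: measurableI.
    + by rewrite -setI_bigcupl; apply: igE; exact: bigcupT_measurable.
have : ae_eq mu B (EFin \o g) (cst 0).
  apply: integral_ae_eq => // E EB mE.
  rewrite integral_cst// mul0e -(E0 E mE); congr (integral _ _ _).
  by apply/esym/setIidl.
by apply: filterS => x /= h Bx; have := h Bx => -[].
Qed.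

(** The sets on which the integral of [g] vanishes form a Dynkin system containing
    the boxes; thus [g] is null on each of countably many rational boxes. *)
Lemma box_fundamental O g (M : R) : open O -> measurable_fun O g ->
  (forall x, O x -> (`|g x| <= M)%R) ->
  (forall a b, cbox a b `<=` O -> \int[mu]_(x in rbox a b) (g x)%:E = 0) ->
  {ae mu, forall x, O x -> g x = 0%R}.
Proof.
move=> oO mg gM g0.
have : \forall x \ae mu, forall pq : 'rV[rat]_n * 'rV[rat]_n,
    [set v : 'rV[R]_n | forall i, (ratr (pq.1 ord0 i) <= v ord0 i <= ratr (pq.2 ord0 i))%R] `<=` O ->
    rbox (rat_row R pq.1) (rat_row R pq.2) x -> g x = 0%R.
  apply: ae_forall_count => -[p q] /=.
  have [pqO|npqO] := pselect ([set v : 'rV[R]_n | forall i, (ratr (p ord0 i) <= v ord0 i <= ratr (q ord0 i))%R] `<=` O); last first.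
    by apply: nearW => x /npqO.
  have cO : cbox (rat_row R p) (rat_row R q) `<=` O.
    by move=> v vpq; apply: pqO => i; have := vpq i; rewrite !mxE.
  have rO : rbox (rat_row R p) (rat_row R q) `<=` O.
    by apply: subset_trans cO; exact: rbox_cbox.
  suff : {ae mu, forall x, rbox (rat_row R p) (rat_row R q) x -> g x = 0%R}.
    by apply: filterS => x h _.
  apply: (@vanish_on_box _ _ _ M).
  - by apply: measurable_funS mg => //; exact: open_measurable_row.
  - by move=> x /rO; exact: gM.
  - by move=> a b abO; apply: g0; exact: subset_trans cO.
apply: filterS => x h Ox.
move: (Ox); rewrite {1}(open_bigcup_rat_rbox oO) => -[pq pqO xpq].
exact: h xpq.
Qed.
End box_fundamental.

(** * Smooth functions *)

Section derive_line.
Variables (R : realType) (V : normedModType R).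
Implicit Types (f : V -> R) (x v : V).

(** The derivative of [f] along [v] is the derivative of the restriction of [f] to a
    line; both directions are used to reduce directional derivatives to
    one-variable calculus. *)
Lemma is_derive_line f x v (s df : R) :
  is_derive (s *: v + x) v f df -> is_derive s 1 (fun t : R => f (t *: v + x)) df.
Proof.
have E : (fun h : R => h^-1 *: (f (h *: v + (s *: v + x)) - f (s *: v + x))) =
   (fun h : R => h^-1 *: (((fun t : R => f (t *: v + x)) \o shift s) (h *: 1) - f (s *: v + x))).
  by apply/funext => h /=; rewrite scalerDl [_%:A]mulr1 addrA.
move=> [df1 df2]; split; first by move: df1; rewrite /derivable /= E.
by move: df2; rewrite /derive /= E.
Qed.

Lemma is_derive_coord_line f x v (df : R) :
  is_derive (0 : R) 1 (fun t : R => f (t *: v + x)) df -> is_derive x v f df.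
Proof.
have E : (fun h : R => h^-1 *: (f (h *: v + x) - f x)) =
   (fun h : R => h^-1 *: (((fun t : R => f (t *: v + x)) \o shift 0) (h *: 1) - f (0 *: v + x))).
  by apply/funext => h /=; rewrite scale0r add0r addr0 [_%:A]mulr1.
move=> [df1 df2]; split; first by move: df1; rewrite /derivable /= E.
by move: df2; rewrite /derive /= E.
Qed.
End derive_line.

Section Ck_algebra.
Variables (R : realType) (n : nat).
Implicit Types (Om : set 'rV[R]_n) (f g : 'rV[R]_n -> R).

Lemma near_eq_on Om f g x : open Om -> (forall y, Om y -> f y = g y) -> Om x ->
  \near x, f x = g x.
Proof.
by move=> oO fg Ox; near=> y; apply: fg; near: y; exact: open_nbhs_nbhs.
Unshelve. all: by end_near. Qed.

Lemma partial_eq Om f g i x : open Om -> (forall y, Om y -> f y = g y) -> Om x ->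
  partial i f x = partial i g x.
Proof. by move=> oO fg Ox; apply: near_eq_derive; exact: near_eq_on oO fg Ox. Qed.

Lemma derivable_eq Om f g (v : 'rV[R]_n) x : open Om -> (forall y, Om y -> f y = g y) -> Om x ->
  derivable f x v -> derivable g x v.
Proof. by move=> oO fg Ox; apply: near_eq_derivable; exact: near_eq_on oO fg Ox. Qed.

Lemma continuous_eq Om f g x : open Om -> (forall y, Om y -> f y = g y) -> Om x ->
  {for x, continuous f} -> {for x, continuous g}.
Proof.
move=> oO fg Ox cf; rewrite /prop_for /continuous_at -(fg _ Ox); apply: cvg_trans cf.
exact: (near_eq_cvg (near_eq_on oO fg Ox)).
Qed.

Lemma Ck_cont k Om f : Ck k Om f -> forall x, Om x -> {for x, continuous f}.
Proof. by case: k => [|k] []. Qed.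

Lemma Ck_derivable k Om f i x : Ck k.+1 Om f -> Om x ->
  is_derive x (delta_mx ord0 i) f (partial i f x).
Proof. by move=> [_ h] Ox; have [d _] := h i; apply: derivableP; exact: d. Qed.

Lemma Ck_partial k Om f i : Ck k.+1 Om f -> Ck k Om (partial i f).
Proof. by move=> [_ h]; have [] := h i. Qed.

Lemma Ck_eq k Om f g : open Om -> (forall y, Om y -> f y = g y) ->
  Ck k Om f -> Ck k Om g.
Proof.
move=> oO; elim: k f g => [|k ih] f g fg /= [cf df].
  by split => // x Ox; exact: continuous_eq oO fg Ox (cf x Ox).
split => [x Ox|i]; first exact: continuous_eq oO fg Ox (cf x Ox).
have [d h] := df i; split => [x Ox|].
  exact: derivable_eq oO fg Ox (d x Ox).
by apply: ih h => y Oy; exact: partial_eq oO fg Oy.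
Qed.

Lemma Ck_intro_eq k Om f (df : 'I_n -> 'rV[R]_n -> R) : open Om ->
  (forall x, Om x -> {for x, continuous f}) ->
  (forall i x, Om x -> is_derive x (delta_mx ord0 i) f (df i x)) ->
  (forall i, Ck k Om (df i)) -> Ck k.+1 Om f.
Proof.
move=> oO cf d h; split => // i; split => [x Ox|]; first by have [] := d i x Ox.
by apply: Ck_eq (h i) => // y Oy; have [_ <-] := d i y Oy.
Qed.

Lemma CkW k Om f : Ck k.+1 Om f -> Ck k Om f.
Proof.
elim: k f => [|k ih] f [cf df]; first by split.
by split => // i; have [d h] := df i; split => //; exact: ih.
Qed.

Lemma Ck_sub k Om Om' f : Om' `<=` Om -> Ck k Om f -> Ck k Om' f.
Proof.
move=> O'O; elim: k f => [|k ih] f [cf df]; first by split => // x /O'O; exact: cf.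
split => [x /O'O|i]; first exact: cf.
have [d h] := df i; split => [x /O'O|]; first exact: d.
exact: ih.
Qed.

Variable Om : set 'rV[R]_n.
Hypothesis oO : open Om.

Lemma CkD k f g : Ck k Om f -> Ck k Om g -> Ck k Om (fun x => f x + g x).
Proof.
elim: k f g => [|k ih] f g cf cg.
  by split => // x Ox; apply: continuousD; [exact: (Ck_cont cf Ox)|exact: (Ck_cont cg Ox)].
apply: (@Ck_intro_eq _ _ _ (fun i x => partial i f x + partial i g x)) => //.
- by move=> x Ox; apply: continuousD; [exact: (Ck_cont cf Ox)|exact: (Ck_cont cg Ox)].
- by move=> i x Ox; exact: is_deriveD (Ck_derivable i cf Ox) (Ck_derivable i cg Ox).
- by move=> i; exact: ih (Ck_partial i cf) (Ck_partial i cg).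
Qed.

Lemma CkM k f g : Ck k Om f -> Ck k Om g -> Ck k Om (fun x => f x * g x).
Proof.
elim: k f g => [|k ih] f g cf cg.
  by split => // x Ox; apply: continuousM; [exact: (Ck_cont cf Ox)|exact: (Ck_cont cg Ox)].
apply: (@Ck_intro_eq _ _ _ (fun i x => f x * partial i g x + g x * partial i f x)) => //.
- by move=> x Ox; apply: continuousM; [exact: (Ck_cont cf Ox)|exact: (Ck_cont cg Ox)].
- by move=> i x Ox; exact: is_deriveM (Ck_derivable i cf Ox) (Ck_derivable i cg Ox).
- move=> i; apply: CkD; first exact: ih (CkW cf) (Ck_partial i cg).
  exact: ih (CkW cg) (Ck_partial i cf).
Qed.

Lemma Ck_cst k (c : R) : Ck k Om (fun=> c).
Proof.
elim: k c => [|k ih] c; first by split => // x Ox; exact: cst_continuous.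
apply: (@Ck_intro_eq _ _ _ (fun i x => 0)) => //.
by move=> x Ox; exact: cst_continuous.
Qed.

Lemma CkN k f : Ck k Om f -> Ck k Om (fun x => - f x).
Proof.
move=> cf; apply: (@Ck_eq _ _ (fun x => -1 * f x)) => //.
  by move=> y _; rewrite mulN1r.
by apply: CkM => //; exact: Ck_cst.
Qed.

Lemma Ck_sum k (I : Type) (r : seq I) (P : pred I) (F : I -> 'rV[R]_n -> R) :
  (forall i, P i -> Ck k Om (F i)) -> Ck k Om (fun x => \sum_(i <- r | P i) F i x).
Proof.
move=> h; elim: r => [|i r ih].
  by apply: Ck_eq (Ck_cst k 0) => // y _; rewrite big_nil.
have [Pi|nPi] := boolP (P i).
  by apply: Ck_eq (CkD (h i Pi) ih) => // y _; rewrite big_cons Pi.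
by apply: Ck_eq ih => // y _; rewrite big_cons (negbTE nPi).
Qed.

Lemma Ck_prod k (I : Type) (r : seq I) (P : pred I) (F : I -> 'rV[R]_n -> R) :
  (forall i, P i -> Ck k Om (F i)) -> Ck k Om (fun x => \prod_(i <- r | P i) F i x).
Proof.
move=> h; elim: r => [|i r ih].
  by apply: Ck_eq (Ck_cst k 1) => // y _; rewrite big_nil.
have [Pi|nPi] := boolP (P i).
  by apply: Ck_eq (CkM (h i Pi) ih) => // y _; rewrite big_cons Pi.
by apply: Ck_eq ih => // y _; rewrite big_cons (negbTE nPi).
Qed.

End Ck_algebra.

Section smooth_real.
Variable R : realType.
Implicit Types f g : R -> R.

(** The one-variable counterpart of [Ck] on the whole line. The derivative is a
    witness rather than [derive1], which makes closure properties direct. *)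
Fixpoint Sk (k : nat) f : Prop :=
  if k is k'.+1 then exists2 f', (forall t : R, is_derive t 1 f (f' t)) & Sk k' f'
  else continuous f.

Lemma is_derive1_continuous f f' : (forall t : R, is_derive t 1 f (f' t)) -> continuous f.
Proof.
by move=> d t; apply/differentiable_continuous/derivable1_diffP; have [] := d t.
Qed.

Lemma Sk_cont k f : Sk k f -> continuous f.
Proof. by case: k => // k [f' + _]; exact: is_derive1_continuous. Qed.

Lemma SkW k f : Sk k.+1 f -> Sk k f.
Proof.
elim: k f => [|k ih] f [f' d h]; first exact: is_derive1_continuous d.
by exists f' => //; exact: ih.
Qed.

Lemma SkD k f g : Sk k f -> Sk k g -> Sk k (fun t => f t + g t).
Proof.
elim: k f g => [|k ih] f g; first by move=> cf cg t; apply: cvgD; [exact: cf|exact: cg].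
move=> [f' df hf] [g' dg hg]; exists (fun t => f' t + g' t); last exact: ih.
by move=> t; exact: is_deriveD.
Qed.

Lemma SkM k f g : Sk k f -> Sk k g -> Sk k (fun t => f t * g t).
Proof.
elim: k f g => [|k ih] f g; first by move=> cf cg t; apply: cvgM; [exact: cf|exact: cg].
move=> hf1 hg1; have hf2 := SkW hf1; have hg2 := SkW hg1.
case: hf1 hg1 => [f' df hf] [g' dg hg]; exists (fun t => f t * g' t + g t * f' t).
  by move=> t; exact: is_deriveM.
by apply: SkD; exact: ih.
Qed.

Lemma Sk_cst k (c : R) : Sk k (fun=> c).
Proof.
elim: k c => [|k ih] c; first by move=> t; exact: cst_continuous.
by exists (fun=> 0) => // t; exact: is_derive_cst.
Qed.

Lemma Sk_shift k f (c : R) : Sk k f -> Sk k (fun t => f (t + c)).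
Proof.
elim: k f => [|k ih] f.
  by move=> cf t; apply: (@continuous_comp _ _ _ (fun t => t + c) f) => //;
     [apply: cvgD => //; exact: cvg_cst|exact: cf].
move=> [f' d h]; exists (fun t => f' (t + c)); last exact: ih.
move=> t; have := @is_derive1_comp _ f (fun t => t + c) t (f' (t + c)) 1.
rewrite mulr1; apply => //.
by apply: is_derive_eq; last exact: addr0.
Qed.

Lemma Sk_opp k f : Sk k f -> Sk k (fun t => f (- t)).
Proof.
elim: k f => [|k ih] f.
  by move=> cf t; apply: (@continuous_comp _ _ _ (fun t => - t) f) => //;
     [apply: cvgN => //; exact: cvg_cst|exact: cf].
move=> [f' d h]; exists (fun t => -1 * f' (- t)).
  move=> t; have := @is_derive1_comp _ f (fun t => - t) t (f' (- t)) (-1).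
  by rewrite mulrC; apply => //; exact: is_deriveNid.
by apply: SkM; [exact: Sk_cst|exact: ih].
Qed.

(** Multivariate smooth functions are built from one-variable ones of a coordinate. *)
Lemma Ck_coord n k f (i : 'I_n) : Sk k f ->
  Ck k setT (fun x : 'rV[R]_n => f (x ord0 i)).
Proof.
have cc (g : R -> R) : continuous g -> continuous (fun x : 'rV[R]_n => g (x ord0 i)).
  move=> cg x; apply: (@continuous_comp _ _ _ (fun x : 'rV[R]_n => x ord0 i) g).
    exact: coord_continuous.
  exact: cg.
elim: k f => [|k ih] f; first by move=> cf; split => // x _; exact: cc.
move=> hf; have cf := Sk_cont hf; case: hf => [f' d h].
apply: (@Ck_intro_eq _ _ _ _ _ (fun j x => (i == j)%:R * f' (x ord0 i))).
- exact: openT.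
- by move=> x _; exact: cc.
- move=> j x _; apply: is_derive_coord_line.
  have [<-|ij] := eqVneq i j.
    rewrite mul1r.
    have -> : (fun t : R => f ((t *: delta_mx ord0 i + x) ord0 i)) = (fun t => f (t + x ord0 i)).
      by apply/funext => t; rewrite !mxE !eqxx mulr1.
    have := @is_derive1_comp _ f (fun t => t + x ord0 i) 0 (f' (x ord0 i)) 1.
    rewrite mulr1; apply; first by rewrite add0r; exact: d.
    by apply: is_derive_eq; last exact: addr0.
  rewrite mul0r.
  have -> : (fun t : R => f ((t *: delta_mx ord0 j + x) ord0 i)) = cst (f (x ord0 i)).
    by apply/funext => t; rewrite !mxE (negbTE ij) andbF mulr0 add0r.
  exact: is_derive_cst.
- by move=> j; apply: CkM; [exact: openT|apply: Ck_cst; exact: openT|exact: ih].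
Qed.
End smooth_real.

(** * Smooth steps *)

Section flat_exponential.
Variable R : realType.

Lemma SkV k (f : R -> R) : (forall t, f t != 0) -> Sk k f -> Sk k (fun t => (f t)^-1).
Proof.
move=> f0; elim: k f f0 => [|k ih] f f0; first by move=> cf t; apply: cvgV => //; exact: cf.
move=> hf; have hf2 := SkW hf; case: hf => [f' df hf].
exists (fun t => - 1 * (f' t * ((f t)^-1 * (f t)^-1))).
  move=> t; have [d1 d2] := df t; split; first exact: derivableV.
  by rewrite deriveV// d2 /GRing.scale/= expr2 -invfM; ring.
by apply: SkM; [exact: Sk_cst|apply: SkM => //; apply: SkM; exact: ih].
Qed.

(** The exponent [m] makes the family closed under differentiation:
    [flat 0] is the standard smooth function that is flat at the origin. *)
Definition flat (m : nat) (t : R) : R := if 0 < t then t^-1 ^+ m * expR (- t^-1) else 0.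

Lemma flat_ge0 m t : 0 <= flat m t.
Proof. by rewrite /flat; case: ifPn => // t0; rewrite mulr_ge0 ?expR_ge0 ?exprn_ge0 ?invr_ge0 ?ltW. Qed.

Lemma flat_gt0 m t : 0 < t -> 0 < flat m t.
Proof. by move=> t0; rewrite /flat t0 mulr_gt0 ?expR_gt0 ?exprn_gt0 ?invr_gt0. Qed.

Lemma flat_eq0 m t : t <= 0 -> flat m t = 0.
Proof. by rewrite /flat ltNge => ->. Qed.

(** This bound is what makes [flat m] differentiable at [0], with derivative [0]; it is
    the Taylor lower bound of the exponential function. *)
Lemma flat_le m t : 0 < t -> flat m t <= (m.+2)`!%:R * t ^+ 2.
Proof.
move=> t0; rewrite /flat t0 expRN ler_pdivrMr ?expR_gt0//.
have s0 : 0 < t^-1 by rewrite invr_gt0.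
have := expR_ge1Dxn m.+1 (ltW s0) => h.
have {h} : t^-1 ^+ m.+2 / (m.+2)`!%:R <= expR t^-1 by apply: le_trans h; rewrite lerDr.
rewrite ler_pdivrMr ?ltr0n ?fact_gt0// => h.
have -> : t^-1 ^+ m = t^-1 ^+ m.+2 * t ^+ 2.
  by rewrite -addn2 exprD -mulrA -exprMn mulVf ?gt_eqF// expr1n mulr1.
by rewrite [leRHS]mulrAC ler_pM2r ?exprn_gt0// mulrC.
Qed.

Lemma is_derive_flat m (t : R) :
  is_derive t 1 (flat m) (flat m.+2 t - m%:R * flat m.+1 t).
Proof.
have [t0|t0|->] := ltgtP t 0.
- rewrite !flat_eq0 ?ltW// mulr0 subr0.
  apply: (near_eq_is_derive (f := cst 0)).
  near=> s; rewrite flat_eq0//; near: s.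
  by apply: filterS (lt_nbhsl t0) => s; exact: ltW.
- have tn0 : t != 0 by rewrite gt_eqF.
  have fE : \near t, t^-1 ^+ m * expR (- t^-1) = flat m t.
    by near=> s; rewrite /flat ifT//; near: s; exact: lt_nbhsr.
  suff : is_derive t 1 (fun t => t^-1 ^+ m * expR (- t^-1)) (flat m.+2 t - m%:R * flat m.+1 t).
    exact: near_eq_is_derive.
  have dV : is_derive t 1 (fun t : R => t^-1) (- (t^-1) ^+ 2).
    split; first exact: derivableV.
    rewrite (@deriveV _ _ id)// derive_id /GRing.scale/= mulr1.
    by rewrite exprVn.
  have dX : is_derive t 1 (fun t : R => t^-1 ^+ m) (m%:R * t^-1 ^+ m.-1 * - (t^-1) ^+ 2).
    have dm : is_derive (t^-1) 1 (fun s : R => s ^+ m) (m%:R * t^-1 ^+ m.-1).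
      split; first exact: exprn_derivable.
      by rewrite exp_derive /GRing.scale/= mulr1.
    exact: is_derive1_comp dV.
  have dE : is_derive t 1 (fun t : R => expR (- t^-1)) (expR (- t^-1) * t^-1 ^+ 2).
    have dN : is_derive t 1 (fun t : R => - t^-1) (t^-1 ^+ 2).
      by have := is_deriveN dV; rewrite opprK.
    exact: is_derive1_comp dN.
  rewrite /flat t0.
  apply: (is_derive_eq (is_deriveM dX dE)); rewrite /GRing.scale/=.
  by case: m {dX fE} => [|m]; rewrite /= !exprS; ring.
- rewrite !flat_eq0// mulr0 subrr.
  have sq : (fun h : R => h^-1 *: ((flat m \o shift 0) (h *: 1) - flat m 0)) @ 0^' --> (0 : R).
    apply/cvgr0Pnorm_lt => e e0.
    have C0 : 0 < (m.+2)`!%:R + 1 :> R by rewrite ltr_wpDl.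
    near=> h.
    rewrite /= addr0 [h%:A]mulr1 (@flat_eq0 m 0)// subr0 /GRing.scale/=.
    have [h0|h0] := leP h 0; first by rewrite flat_eq0// mulr0 normr0.
    rewrite ger0_norm ?mulr_ge0 ?invr_ge0 ?flat_ge0 ?(ltW h0)//.
    rewrite mulrC ltr_pdivrMr// (le_lt_trans (flat_le m h0))//.
    rewrite expr2 mulrA ltr_pM2r//.
    have he : `|h| < e / ((m.+2)`!%:R + 1).
      by near: h; apply: dnbhs0_lt; rewrite divr_gt0.
    rewrite (ger0_norm (ltW h0)) ltr_pdivlMr// in he.
    apply: le_lt_trans he; rewrite mulrC ler_pM2l//.
    by rewrite lerDl.
  split; first by apply/cvg_ex; exists 0.
  exact: cvg_lim sq.
Unshelve. all: by end_near. Qed.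

Lemma Sk_flat k m : Sk k (flat m).
Proof.
elim: k m => [|k ih] m; first exact: is_derive1_continuous (is_derive_flat m).
exists (fun t => flat m.+2 t + -1 * (m%:R * flat m.+1 t)).
  by move=> t; rewrite mulN1r; exact: is_derive_flat.
by apply: SkD => //; apply: SkM; [exact: Sk_cst|apply: SkM => //; exact: Sk_cst].
Qed.
End flat_exponential.

Section steps.
Variable R : realType.
Implicit Types a b t : R.

Let den a b t : R := flat 0 (t - a) + flat 0 (b - t).

Let den_gt0 a b t : a < b -> 0 < den a b t.
Proof.
move=> ab; rewrite /den; have [ta|ta] := ltP a t.
  by rewrite ltr_pwDl ?flat_ge0// flat_gt0// subr_gt0.
by rewrite ltr_wpDl ?flat_ge0// flat_gt0// subr_gt0 (le_lt_trans ta).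
Qed.

(** A smooth function that increases from [0] at [a] to [1] at [b]. *)
Definition step a b t : R := flat 0 (t - a) / den a b t.

Lemma Sk_flatB k m (c : R) : Sk k (fun t => flat m (c - t)).
Proof.
have := Sk_opp (Sk_shift c (Sk_flat R k m)).
by congr Sk; apply/funext => t; rewrite addrC.
Qed.

Lemma Sk_step k a b : a < b -> Sk k (step a b).
Proof.
move=> ab; apply: SkM; first exact: Sk_shift (Sk_flat _ _ _).
apply: SkV => [t|]; first by rewrite gt_eqF// den_gt0.
by apply: SkD; [exact: Sk_shift (Sk_flat _ _ _)|exact: Sk_flatB].
Qed.

Lemma step_ge0 a b t : a < b -> 0 <= step a b t.
Proof. by move=> ab; rewrite divr_ge0 ?flat_ge0// ltW// den_gt0. Qed.

Lemma step_le1 a b t : a < b -> step a b t <= 1.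
Proof. by move=> ab; rewrite ler_pdivrMr ?den_gt0// mul1r lerDl flat_ge0. Qed.

Lemma step_eq0 a b t : t <= a -> step a b t = 0.
Proof. by move=> ta; rewrite /step flat_eq0 ?mul0r// subr_le0. Qed.

Lemma step_eq1 a b t : a < b -> b <= t -> step a b t = 1.
Proof.
move=> ab bt; rewrite /step /den (@flat_eq0 _ 0 (b - t)) ?subr_le0// addr0 divff//.
by rewrite gt_eqF// flat_gt0// subr_gt0 (lt_le_trans ab).
Qed.

(** The slope is nonnegative because [flat 0] is nondecreasing. *)
Lemma step_derive a b : a < b -> exists2 ds : R -> R,
  (forall t, is_derive t 1 (step a b) (ds t) /\ 0 <= ds t) & forall k, Sk k ds.
Proof.
move=> ab.
have dl t : is_derive t 1 (fun t => flat 0 (t - a)) (flat 2 (t - a)).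
  have := is_derive_flat 0 (t - a); rewrite mul0r subr0 => df.
  have := @is_derive1_comp _ (flat 0) (fun t => t - a) t _ 1 df.
  rewrite mulr1; apply.
  by apply: is_derive_eq; last exact: subr0.
have dr t : is_derive t 1 (fun t => flat 0 (b - t)) (- flat 2 (b - t)).
  have := is_derive_flat 0 (b - t); rewrite mul0r subr0 => df.
  have := @is_derive1_comp _ (flat 0) (fun t => b - t) t _ (-1) df.
  rewrite mulrN1; apply.
  have := is_deriveB (is_derive_cst b t 1) (is_derive_id t 1); rewrite sub0r; exact.
have dd t : is_derive t 1 (den a b) (flat 2 (t - a) - flat 2 (b - t)).
  exact: is_deriveD.
have d0 t : den a b t != 0 by rewrite gt_eqF// den_gt0.
exists (fun t => (flat 2 (t - a) * flat 0 (b - t) + flat 0 (t - a) * flat 2 (b - t)) *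
                 ((den a b t)^-1 * (den a b t)^-1)).
  move=> t; split; last first.
    have dg := ltW (den_gt0 t ab).
    by rewrite mulr_ge0// ?addr_ge0// ?mulr_ge0 ?invr_ge0 ?flat_ge0.
  have [d1 d2] := dd t.
  have dV : is_derive t 1 (fun t => (den a b t)^-1) (- (den a b t)^-1 ^+ 2 * (flat 2 (t - a) - flat 2 (b - t))).
    split; first exact: derivableV.
    by rewrite deriveV// d2 /GRing.scale/= exprVn.
  apply: (is_derive_eq (is_deriveM (dl t) dV)); rewrite /GRing.scale/=.
  move: (d0 t); rewrite /den; set A := flat 0 (t - a); set B := flat 0 (b - t) => AB.
  by field.
move=> k; apply: SkM; last first.
  by apply: SkM; apply: SkV => //; apply: SkD; (exact: Sk_shift (Sk_flat _ _ _) || exact: Sk_flatB).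
by apply: SkD; apply: SkM; (exact: Sk_shift (Sk_flat _ _ _) || exact: Sk_flatB).
Qed.
End steps.

(** * Smooth bumps and test functions *)

Section plateau.
Variable R : realType.
Implicit Types a b t : R.

Definition margin a b (m : nat) : R := (b - a) / m.+3%:R.

Lemma margin_gt0 a b m : a < b -> 0 < margin a b m.
Proof. by move=> ab; rewrite divr_gt0 ?subr_gt0. Qed.

Lemma margin_lt a b m : a < b -> a + margin a b m < b - margin a b m.
Proof.
move=> ab; rewrite -ltrBrDl -subr_gt0.
have -> : b - margin a b m - a - margin a b m = (b - a) * (m.+1%:R / m.+3%:R).
  have -> : m.+1%:R = m.+3%:R - 2 :> R by rewrite -[m.+3]addn2 natrD addrK.
  have : m.+3%:R != 0 :> R by rewrite pnatr_eq0.
  by rewrite /margin => ?; field.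
by rewrite mulr_gt0 ?subr_gt0 ?divr_gt0.
Qed.

(** A smooth bump on the interval from [a] to [b]; as [m] grows the shoulders become
    narrower and the bumps tend to the indicator of the interval. *)
Definition plateau a b m t : R :=
  step a (a + margin a b m) t - step (b - margin a b m) b t.

Section facts.
Variables (a b : R) (m : nat).
Hypothesis ab : a < b.
Let l := margin_gt0 m ab.
Let r := margin_lt m ab.
Let al : a < a + margin a b m. Proof. by rewrite ltrDl. Qed.
Let rb : b - margin a b m < b. Proof. by rewrite gtrBl. Qed.

Lemma Sk_plateau k : Sk k (plateau a b m).
Proof.
have h := SkM (Sk_cst k (-1)) (Sk_step k rb).
have := SkD (Sk_step k al) h.
by congr Sk; apply/funext => t; rewrite mulN1r.
Qed.

Lemma plateau_ge0 t : 0 <= plateau a b m t.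
Proof.
rewrite subr_ge0; have [tb|tb] := leP t (b - margin a b m).
  by rewrite (step_eq0 _ tb) step_ge0.
by rewrite (step_eq1 al) ?step_le1// (le_trans (ltW r))// ltW.
Qed.

Lemma plateau_le1 t : plateau a b m t <= 1.
Proof. by rewrite lerBlDr (le_trans (step_le1 _ al))// lerDl step_ge0. Qed.

Lemma plateau_norm t : `|plateau a b m t| <= 1.
Proof. by rewrite ger0_norm ?plateau_ge0 ?plateau_le1. Qed.

Lemma plateau_out t : ~~ (a < t < b) -> plateau a b m t = 0.
Proof.
rewrite negb_and -!leNgt => /orP[ta|bt].
  rewrite /plateau !step_eq0 ?subrr//.
  by rewrite (le_trans ta)// (le_trans _ (ltW r))// lerDl ltW.
rewrite /plateau !step_eq1 ?subrr//.
by rewrite (le_trans (ltW r))// (le_trans _ bt)// gerBl ltW.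
Qed.
End facts.

Lemma near_margin a b e : 0 < e -> \forall m \near \oo, `|margin a b m| < e.
Proof.
have lim : margin a b m @[m --> \oo] --> (0 : R).
  rewrite -[X in _ --> X](mulr0 (b - a)); apply: cvgM; first exact: cvg_cst.
  by have := @cvg_harmonic R; rewrite -cvg_shiftS -cvg_shiftS.
by move=> e0; have /cvgr0Pnorm_lt := lim; apply.
Qed.

Lemma plateau_eventually1 a b t : a < t < b ->
  \forall m \near \oo, plateau a b m t = 1.
Proof.
move=> /andP[aat tb]; have ab := lt_trans aat tb.
near=> m.
have h1 : `|margin a b m| < t - a by near: m; apply: near_margin; rewrite subr_gt0.
have h2 : `|margin a b m| < b - t by near: m; apply: near_margin; rewrite subr_gt0.
rewrite (gtr0_norm (margin_gt0 m ab)) in h1 h2.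
rewrite /plateau step_eq1 ?step_eq0 ?subr0//.
- by rewrite lerBrDr -lerBrDl ltW.
- by rewrite ltrDl margin_gt0.
- by rewrite -lerBrDl ltW.
Unshelve. all: by end_near. Qed.
End plateau.

Section integral_helpers.
Context d (T : measurableType d) (R : realType) (mu : {measure set T -> \bar R}).

Lemma integral_subset (D D' : set T) (f : T -> \bar R) : D' `<=` D ->
  (forall x, D x -> ~ D' x -> f x = 0%E) ->
  (\int[mu]_(x in D) f x = \int[mu]_(x in D') f x)%E.
Proof.
move=> D'D f0; rewrite integral_mkcond [RHS]integral_mkcond.
apply: eq_integral => x _; rewrite /patch.
case: ifPn; case: ifPn => //; rewrite ?inE ?notin_setE.
- by move=> nD' Dx; exact: f0.
- by move=> /D'D Dx nDx.
Qed.
End integral_helpers.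

Section test_functions.
Variables (R : realType) (n : nat).
Local Notation mu := (leb R n).
Implicit Types (O : set 'rV[R]_n) (g : 'rV[R]_n -> R).

Lemma cbox_compact (a b : 'rV[R]_n) : compact (cbox a b).
Proof.
have := @rV_compact R n (fun i => `[a ord0 i, b ord0 i]%classic) (fun i => @segment_compact _ _ _).
by congr compact; apply/seteqP; split => v /= h i; have := h i; rewrite ?in_itv.
Qed.

Lemma cbox_closed (a b : 'rV[R]_n) : closed (cbox a b).
Proof. by apply: compact_closed; [exact: norm_hausdorff|exact: cbox_compact]. Qed.

Lemma cbox_contained (a b : 'rV[R]_n) O S : cbox a b `<=` O -> S `<=` cbox a b ->
  compactly_contained S O.
Proof.
move=> abO Sab.
have cS : closure S `<=` cbox a b.
  rewrite [X in _ `<=` X](closure_id _).1; last exact: cbox_closed.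
  exact: closureS.
split; last exact: subset_trans cS abO.
by apply: (subclosed_compact _ (@cbox_compact a b) cS); exact: closed_closure.
Qed.

Definition rbump (a b : 'rV[R]_n) (m : nat) (x : 'rV[R]_n) : R :=
  \prod_i plateau (a ord0 i) (b ord0 i) m (x ord0 i).

Section rbump.
Variables (a b : 'rV[R]_n).
Hypothesis ab : forall i, a ord0 i < b ord0 i.

Lemma rbump_Ck k m : Ck k setT (rbump a b m).
Proof.
apply: Ck_prod => [|i _]; first exact: openT.
by apply: Ck_coord; exact: Sk_plateau.
Qed.

Lemma rbump_out m x : ~ rbox a b x -> rbump a b m x = 0.
Proof.
move=> /existsNP[i /negP hi]; rewrite /rbump (bigD1 i)//= plateau_out ?mul0r//.
Qed.

Lemma rbump_norm m x : `|rbump a b m x| <= 1.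
Proof.
rewrite normr_prod; apply: prodr_ile1 => i _.
by rewrite normr_ge0 plateau_norm.
Qed.

Lemma rbump_test m O : cbox a b `<=` O -> test_function O (rbump a b m).
Proof.
move=> abO; split => [k|]; first exact: rbump_Ck.
apply: cbox_contained abO _ => x /= zx; apply: rbox_cbox.
by apply: contrapT => /rbump_out zx0; rewrite zx0 eqxx in zx.
Qed.

Lemma rbump_eventually1 x : rbox a b x -> \forall m \near \oo, rbump a b m x = 1.
Proof.
move=> abx.
have : \forall m \near \oo, forall i, plateau (a ord0 i) (b ord0 i) m (x ord0 i) = 1.
  apply: filter_forall => i; apply: plateau_eventually1; exact: abx.
by apply: filterS => m h; rewrite /rbump big1.
Qed.
End rbump.

Lemma test_continuous O z : test_function O z -> continuous z.
Proof. by move=> [h _] x; exact: (Ck_cont (h 0%N)). Qed.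

(** A bounded function whose integral against every test function vanishes is
    null, because the indicators of boxes are bounded limits of test functions. *)
Lemma test_fundamental O g (M : R) : open O -> measurable_fun O g ->
  (forall x, O x -> `|g x| <= M) ->
  (forall z, test_function O z -> \int[mu]_(x in O) (g x * z x)%:E = 0)%E ->
  {ae mu, forall x, O x -> g x = 0}.
Proof.
move=> oO mg gM g0; apply: (box_fundamental (M := M)) => // a b abO.
have [ab|/existsNP[i /negP]] := pselect (forall i, a ord0 i < b ord0 i); last first.
  rewrite -leNgt => ba; rewrite (_ : rbox a b = set0) ?integral_set0//.
  apply/seteqP; split => // x /(_ i) /andP[h1 h2].
  by have := lt_le_trans (lt_trans h1 h2) ba; rewrite ltxx.
have rO : rbox a b `<=` O by apply: subset_trans abO; exact: rbox_cbox.
have mR : measurable (rbox a b) by exact: measurable_rbox.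
have mgR : measurable_fun (rbox a b) g.
  by apply: measurable_funS mg => //; exact: open_measurable_row.
have [] := @dominated_convergence _ _ _ mu _ mR
  (fun m x => (g x * rbump a b m x)%:E) (EFin \o g) (cst M%:E).
- move=> m; apply/measurable_EFinP; apply: measurable_funM => //.
  apply: measurable_funTS; apply: continuous_measurable_row => x.
  by have := Ck_cont (rbump_Ck ab 0 m); apply.
- exact/measurable_EFinP.
- apply: nearW => x abx; apply: cvg_near_cst.
  by apply: filterS (rbump_eventually1 abx) => m ->; rewrite mulr1.
- by apply: (@integrable_bounded _ _ _ mu _ (cst M) `|M|) => //; exact: leb_rbox_lty.
- apply: nearW => x m abx; rewrite lee_fin normrM.
  by rewrite (le_trans _ (gM x _)) ?ler_piMr ?rbump_norm//; exact: rO.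
move=> _ _ h.
have h0 m : (\int[mu]_(x in rbox a b) (g x * rbump a b m x)%:E = 0)%E.
  rewrite -(g0 _ (rbump_test ab m abO)); apply/esym/integral_subset => // x _ nx.
  by rewrite rbump_out// mulr0.
move: h; rewrite (_ : [sequence _]_m = cst 0%E); last by apply/funext => m; exact: h0.
by move=> /(cvg_lim (@ereal_hausdorff R)) <-; rewrite lim_cst.
Qed.
End test_functions.

(** * Compact supports and differential calculus *)

Section compact_support.
Variables (R : realType) (n : nat).
Local Notation mu := (leb R n).
Implicit Types (O S : set 'rV[R]_n) (f g z : 'rV[R]_n -> R).

Lemma compact_continuous_bounded (K : set 'rV[R]_n) f : compact K ->
  (forall x, K x -> {for x, continuous f}) -> exists2 M, 0 <= M & forall x, K x -> `|f x| <= M.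
Proof.
move=> cK cf.
have cw : {within K, continuous f}.
  by apply: continuous_in_subspaceT => x; rewrite inE => /cf.
have [M [_ h]] := compact_bounded (continuous_compact cw cK).
exists (`|M| + 1) => // x Kx; apply: h; last by exists x.
by rewrite (le_lt_trans (ler_norm M))// ltrDl.
Qed.

Lemma near_zero_out z x : ~ closure [set y | z y != 0] x -> \near x, z x = 0.
Proof.
move=> nx; have : nbhs x (~` closure [set y | z y != 0]).
  by apply: open_nbhs_nbhs; split => //; rewrite openC; exact: closed_closure.
apply: filterS => y ny; apply: contrapT => zy; apply: ny; apply: subset_closure.
by apply/eqP.
Qed.

Lemma partial_out z i x : ~ closure [set y | z y != 0] x -> partial i z x = 0.
Proof.
move=> /near_zero_out nz; rewrite /partial.
rewrite (@near_eq_derive _ _ _ z (cst 0)) ?derive_cst//.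
Qed.

Lemma test_partial O z i : test_function O z -> test_function O (partial i z).
Proof.
move=> [zk [cz zO]]; split => [k|]; first exact: Ck_partial (zk k.+1).
have sub : closure [set x | partial i z x != 0] `<=` closure [set x | z x != 0].
  rewrite [X in _ `<=` X](closure_id _).1; last exact: closed_closure.
  apply: closureS => x /= /eqP px; apply: contrapT => /partial_out h; exact: px.
split; last exact: subset_trans zO.
by apply: (subclosed_compact _ cz sub); exact: closed_closure.
Qed.

Lemma test_out O z x : test_function O z -> ~ O x -> z x = 0.
Proof.
move=> [_ [_ zO]] nO; apply/eqP/negPn/negP => zx; apply/nO/zO.
exact: subset_closure.
Qed.

Lemma test_bounded O z : test_function O z -> exists2 M, 0 <= M & forall x, `|z x| <= M.
Proof.
move=> tz; have [_ [cz _]] := tz.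
have [M M0 h] := compact_continuous_bounded cz (fun x _ => @test_continuous R n O z tz x).
exists M => // x; have [/eqP zx|zx] := boolP (z x == 0); first by rewrite zx normr0.
by apply: h; exact: subset_closure.
Qed.

Lemma Ck_cover k (A B : set 'rV[R]_n) f : (forall x, A x \/ B x) -> Ck k A f -> Ck k B f ->
  Ck k setT f.
Proof.
move=> AB; elim: k f => [|k ih] f [cA hA] [cB hB].
  by split => // x _; have [/cA|/cB] := AB x.
split => [x _|i]; first by have [/cA|/cB] := AB x.
have [dA kA] := hA i; have [dB kB] := hB i; split => [x _|]; last exact: ih.
by have [/dA|/dB] := AB x.
Qed.

(** Cutting a [Ck] function off by a test function makes it globally [Ck]: the
    product is [Ck] on [O] and vanishes off the support of the test function. *)
Lemma Ck_cutoff k O f z : open O -> Ck k O f -> test_function O z ->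
  Ck k setT ((fun x => f x * z x) \_ O).
Proof.
move=> oO fk [zk [cz zO]].
have oV : open (~` closure [set y | z y != 0]) by rewrite openC; exact: closed_closure.
apply: (@Ck_cover _ O (~` closure [set y | z y != 0])).
- by move=> x; have [/zO|] := pselect (closure [set y | z y != 0] x); [left|right].
- apply: (@Ck_eq _ _ _ _ (fun x => f x * z x)) => //.
    by move=> y Oy; rewrite patchE mem_set.
  by apply: CkM => //; apply: Ck_sub (zk k).
- apply: (@Ck_eq _ _ _ _ (fun=> 0)) => //; last exact: Ck_cst.
  move=> y /= nz; rewrite patchE; case: ifPn => // _.
  by rewrite (nbhs_singleton (near_zero_out nz)) mulr0.
Qed.
End compact_support.

Section mean_value_line.
Variables (R : realType) (V : normedModType R).
Implicit Types (f df : V -> R) (x v : V).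

Lemma MVT_line f df x v (h : R) :
  (forall s : R, `|s| <= `|h| -> is_derive (s *: v + x) v f (df (s *: v + x))) ->
  exists2 s : R, `|s| <= `|h| & f (h *: v + x) - f x = h * df (s *: v + x).
Proof.
move=> d.
pose F := fun s : R => f (s *: v + x).
have dF (s : R) : `|s| <= `|h| -> is_derive s 1 F (df (s *: v + x)).
  by move=> /d; exact: is_derive_line.
have mvt (a b : R) : a <= b -> (forall s, a <= s <= b -> `|s| <= `|h|) ->
    exists2 s, `|s| <= `|h| & F b - F a = df (s *: v + x) * (b - a).
  move=> ab hab; have [||s sab ->] := @MVT_segment R F (fun s => df (s *: v + x)) a b ab.
  - by move=> s; rewrite in_itv/= => /andP[/ltW s1 /ltW s2]; apply: dF; apply: hab; rewrite s1.
  - apply: derivable_within_continuous => s; rewrite in_itv/= => sab.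
    by have [] := dF s (hab s sab).
  by exists s => //; apply: hab; rewrite in_itv/= in sab.
have F0 : F 0 = f x by rewrite /F scale0r add0r.
have [h0|h0] := leP 0 h.
  have [|s sh E] := mvt 0 h h0.
    by move=> s /andP[s0 sh]; rewrite !ger0_norm.
  by exists s => //; rewrite -F0 E subr0 mulrC.
have [|s sh E] := mvt h 0 (ltW h0).
  by move=> s /andP[hs s0]; rewrite !ler0_norm ?lerN2// ltW.
exists s => //; rewrite -F0 -[LHS]opprB E sub0r; ring.
Qed.
End mean_value_line.

Lemma symmetricmxP (R : realType) n (X : 'M[R]_n) :
  (X \is symmetricmx) <-> forall i j, X i j = X j i.
Proof.
rewrite is_hermitianmxE expr0 scale1r; split.
  by move=> /eqP XT i j; rewrite {1}XT !mxE.
by move=> h; apply/eqP/matrixP => i j; rewrite !mxE; exact: h.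
Qed.

Section row_calculus.
Variables (R : realType) (n : nat).
Implicit Types (Om : set 'rV[R]_n) (f u : 'rV[R]_n -> R) (x y : 'rV[R]_n).
Local Notation e i := (delta_mx ord0 i : 'rV[R]_n).

Lemma normr_row_ltP x (r : R) : 0 < r -> `|x| < r <-> forall i, `|x ord0 i| < r.
Proof.
move=> r0; rewrite [`|x|]/Num.norm /= mx_normrE; split.
  move=> /bigmax_ltP[_ h] i; exact: (h (ord0, i)).
by move=> h; apply/bigmax_ltP; split => // -[k i] _ /=; rewrite ord1.
Qed.

Lemma normr_row_coord x i : `|x ord0 i| <= `|x|.
Proof.
by rewrite [`|x|]/Num.norm /= mx_normrE; apply/bigmax_geP; right; exists (ord0, i).
Qed.

Lemma normr_delta_le (s : R) i : `|s *: e i| <= `|s|.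
Proof.
rewrite normrZ ler_piMr//.
rewrite [`|_|]/Num.norm /= mx_normrE; apply/bigmax_leP; split => // -[k j] _ /=.
by rewrite !mxE; case: (_ && _); rewrite ?normr1 ?normr0.
Qed.

Lemma open_ball_sub Om x : open Om -> Om x ->
  exists2 r : R, 0 < r & forall y, `|y| < r -> Om (y + x).
Proof.
move=> oO Ox; have : nbhs x Om by exact: open_nbhs_nbhs.
move=> /nbhs_ballP[r /= r0 h]; exists r => // y yr; apply: h.
by rewrite -ball_normE /= opprD addrCA subrr addr0 normrN.
Qed.

Lemma continuous_delta f x (eps : R) : {for x, continuous f} -> 0 < eps ->
  exists2 r : R, 0 < r & forall y, `|y| < r -> `|f (y + x) - f x| < eps.
Proof.
move=> /cvgrPdist_lt/(_ eps) h e0; have := h e0.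
move=> /nbhs_ballP[r /= r0 hr]; exists r => // y yr; rewrite distrC; apply: hr.
by rewrite -ball_normE /= opprD addrCA subrr addr0 normrN.
Qed.

(** The mean value theorem, applied once in each direction. *)
Lemma second_difference (f p q : 'rV[R]_n -> R) x i j (r h : R) :
  (forall y, `|y| < r -> is_derive (y + x) (e i) f (p (y + x))) ->
  (forall y, `|y| < r -> is_derive (y + x) (e j) p (q (y + x))) ->
  0 < h -> h + h < r ->
  exists2 y, `|y| <= h + h &
   f (h *: e i + (h *: e j + x)) - f (h *: e i + x) - (f (h *: e j + x) - f x) =
   h * (h * q (y + x)).
Proof.
move=> df dp h0 hhr.
have near s t : `|s| <= `|h| -> `|t| <= `|h| -> `|s *: e i + t *: e j| <= h + h.
  move=> sh th; rewrite (le_trans (ler_normD _ _))//.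
  rewrite (gtr0_norm h0) in sh th.
  by rewrite lerD// (le_trans (normr_delta_le _ _)).
have d2 s t : `|s| <= `|h| -> `|t| <= `|h| ->
    is_derive (s *: e i + t *: e j + x) (e i) f (p (s *: e i + t *: e j + x)).
  by move=> sh th; apply: df; exact: le_lt_trans (near _ _ sh th) hhr.
have [g gE] : exists g, g = fun y => f (y + h *: e j) - f y by eexists.
have [dg dgE] : exists dg, dg = fun y => p (y + h *: e j) - p y by eexists.
have [|s sh E] := @MVT_line R _ g dg x (e i) h.
  move=> s sh.
  have D2 : is_derive (s *: e i + x) (e i) f (p (s *: e i + x)).
    by have := d2 s 0 sh; rewrite scale0r addr0; apply; rewrite normr0.
  have D1 : is_derive (s *: e i + x) (e i) (fun y => f (y + h *: e j)) (p (s *: e i + x + h *: e j)).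
    have := d2 s h sh (lexx _) => dsh.
    apply: is_derive_coord_line.
    have := is_derive_line (s := 0) (x := s *: e i + x + h *: e j) (v := e i) (f := f).
    rewrite scale0r add0r -addrA [x + _]addrC addrA => /(_ _ dsh).
    by congr is_derive; apply/funext => t; congr f; rewrite -!addrA; congr (_ + (_ + _)); rewrite addrC.
  by rewrite gE dgE; exact: is_deriveB D1 D2.
have [|t th E2] := @MVT_line R _ p q (s *: e i + x) (e j) h.
  move=> t th; rewrite addrA; apply: dp; rewrite addrC; exact: le_lt_trans (near _ _ sh th) hhr.
exists (t *: e j + s *: e i); first by rewrite addrC near.
rewrite -[t *: e j + s *: e i + x]addrA -E2.
have -> : p (h *: e j + (s *: e i + x)) - p (s *: e i + x) = dg (s *: e i + x).
  by rewrite dgE [h *: e j + _]addrC.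
rewrite -E gE.
have -> : h *: e i + (h *: e j + x) = h *: e i + x + h *: e j by rewrite -addrA [x + _]addrC.
by rewrite [h *: e j + x]addrC.
Qed.

Lemma half_dist (a b c eps : R) : `|c - b| < eps / 2 -> `|c - a| < eps / 2 -> `|a - b| <= eps.
Proof.
move=> c1 c2; rewrite [eps]splitr.
have -> : a - b = (c - b) - (c - a) by ring.
by rewrite (le_trans (ler_normB _ _))// ltW// ltrD.
Qed.

(** The second difference is symmetric in the two directions, and approximates both
    mixed derivatives. *)
Lemma schwarz Om u x i j : open Om -> Ck 2 Om u -> Om x ->
  partial j (partial i u) x = partial i (partial j u) x.
Proof.
move=> oO uC Ox; apply/eqP; rewrite -subr_eq0 -normr_le0; apply/ler_addgt0Pr => eps e0.
rewrite add0r.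
have [r r0 hr] := open_ball_sub oO Ox.
have e2 : 0 < eps / 2 by rewrite divr_gt0.
have [r1 r10 h1] := continuous_delta (Ck_cont (Ck_partial j (Ck_partial i uC)) Ox) e2.
have [r2 r20 h2] := continuous_delta (Ck_cont (Ck_partial i (Ck_partial j uC)) Ox) e2.
pose m := Num.min r (Num.min r1 r2).
have m0 : 0 < m by rewrite !lt_min r0 r10 r20.
pose h := m / 4.
have h0 : 0 < h by rewrite divr_gt0.
have hm : h + h < m by rewrite /h; lra.
have hhr : h + h < r by apply: lt_le_trans hm _; rewrite ge_min lexx.
have hhr1 : h + h < r1 by apply: lt_le_trans hm _; rewrite !ge_min lexx orbT.
have hhr2 : h + h < r2 by apply: lt_le_trans hm _; rewrite !ge_min lexx !orbT.
have du k y : `|y| < r -> is_derive (y + x) (e k) u (partial k u (y + x)).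
  by move=> /hr; exact: Ck_derivable uC.
have ddu k l y : `|y| < r -> is_derive (y + x) (e l) (partial k u) (partial l (partial k u) (y + x)).
  by move=> /hr; exact: Ck_derivable (Ck_partial k uC).
have [y yh E1] := @second_difference u _ _ x i j r h (du i) (ddu i j) h0 hhr.
have [z zh E2] := @second_difference u _ _ x j i r h (du j) (ddu j i) h0 hhr.
have E : partial j (partial i u) (y + x) = partial i (partial j u) (z + x).
  apply: (@mulfI _ h); first by rewrite gt_eqF.
  apply: (@mulfI _ h); first by rewrite gt_eqF.
  have swap (p q v w : R) : p - q - (v - w) = p - v - (q - w) by ring.
  apply: etrans (etrans (esym E1) _) E2.
  by rewrite (addrCA (h *: e i)); exact: swap.
have := h1 y (le_lt_trans yh hhr1); have := h2 z (le_lt_trans zh hhr2).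
rewrite E; exact: half_dist.
Qed.

(** Moves the first index to the last place, where it is an ordinary derivative of an
    entry of the Hessian. *)
Lemma third_sym Om u x i k l : open Om -> Ck 3 Om u -> Om x ->
  third u x i k l = partial i (partial l (partial k u)) x.
Proof.
move=> oO uC Ox.
have e1 : partial l (partial k (partial i u)) x = partial l (partial i (partial k u)) x.
  apply: (@partial_eq _ _ Om (partial k (partial i u)) (partial i (partial k u)) l x oO _ Ox) => y Oy.
  exact: (@schwarz Om u y i k oO (CkW uC) Oy).
have e2 := @schwarz Om (partial k u) x i l oO (Ck_partial k uC) Ox.
rewrite /third; exact: (eq_trans e1 e2).
Qed.

Lemma hessian_sym Om u x : open Om -> Ck 2 Om u -> Om x -> hessian u x \is symmetricmx.
Proof.
by move=> oO uC Ox; apply/symmetricmxP => i j; rewrite !mxE; exact: (@schwarz Om u x i j oO uC Ox).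
Qed.

Let prefix (y : 'rV[R]_n) (k : nat) : 'rV[R]_n := \row_i (if (i < k)%N then y ord0 i else 0).

(** Moving from [x] to [y + x] one coordinate at a time. *)
Lemma row_increment Om f (df : 'I_n -> 'rV[R]_n -> R) x (r : R) :
  (forall y, `|y| < r -> Om (y + x)) ->
  (forall i y, Om y -> is_derive y (e i) f (df i y)) ->
  forall y, `|y| < r -> exists2 z : 'I_n -> 'rV[R]_n, (forall i, `|z i| <= `|y|) &
    f (y + x) - f x = \sum_i y ord0 i * df i (z i + x).
Proof.
move=> hr d y yr.
have pnorm (k : nat) (i : 'I_n) (s : R) : k = i -> `|s| <= `|y ord0 i| -> `|s *: e i + prefix y k| <= `|y|.
  move=> -> sy; rewrite [leLHS]/Num.norm /= mx_normrE; apply/bigmax_leP; split => // -[l p] _ /=.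
  rewrite (ord1 l) !mxE eqxx /=; have [pi|pi|/val_inj ->] := ltngtP p i.
  - have -> : (p == i) = false by apply/eqP => E; rewrite E ltnn in pi.
    by rewrite mulr0 add0r normr_row_coord.
  - have -> : (p == i) = false by apply/eqP => E; rewrite E ltnn in pi.
    by rewrite mulr0 add0r normr0.
  - by rewrite ?eqxx mulr1 addr0 (le_trans sy) ?normr_row_coord.
have step (i : 'I_n) : exists2 z, `|z| <= `|y| &
    f (prefix y i.+1 + x) - f (prefix y i + x) = y ord0 i * df i (z + x).
  have [|s sy E] := @MVT_line R _ f (df i) (prefix y i + x) (e i) (y ord0 i).
    by move=> s sy; apply: d; rewrite addrA; apply: hr; apply: le_lt_trans yr; exact: pnorm.
  exists (s *: e i + prefix y i); first exact: pnorm.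
  rewrite -addrA -E addrA; congr (f (_ + _) - _).
  apply/rowP => p; rewrite !mxE eqxx /= ltnS leq_eqVlt -[(p : nat) == i]/(p == i).
  have [->|pi] := eqVneq p i; first by rewrite ltnn mulr1 addr0.
  by rewrite mulr0 add0r.
have /choice[z hz] : forall i : 'I_n, exists zi : 'rV[R]_n, `|zi| <= `|y| /\
    f (prefix y i.+1 + x) - f (prefix y i + x) = y ord0 i * df i (zi + x).
  by move=> i; have [zi h1 h2] := step i; exists zi.
exists z; first by move=> i; have [] := hz i.
have pn : prefix y n = y by apply/rowP => p; rewrite mxE ltn_ord.
have p0 : prefix y 0 = 0 by apply/rowP => p; rewrite !mxE.
transitivity (\sum_(i < n) (f (prefix y i.+1 + x) - f (prefix y i + x))).
  rewrite -(big_mkord xpredT (fun i => f (prefix y i.+1 + x) - f (prefix y i + x))).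
  by rewrite telescope_sumr// pn p0 add0r.
by apply: eq_bigr => i _; have [_ ->] := hz i.
Qed.

(** Each term of [row_increment] differs little from its value at [x]. *)
Lemma taylor1 Om f (df : 'I_n -> 'rV[R]_n -> R) x (eps : R) : open Om -> Om x ->
  (forall i y, Om y -> is_derive y (e i) f (df i y)) ->
  (forall i, {for x, continuous (df i)}) -> 0 < eps ->
  exists2 r : R, 0 < r & forall y, `|y| < r ->
    `|f (y + x) - f x - \sum_i df i x * y ord0 i| <= eps * `|y|.
Proof.
move=> oO Ox d cdf e0.
have [r r0 hr] := open_ball_sub oO Ox.
pose eta := eps / n.+1%:R.
have eta0 : 0 < eta by rewrite divr_gt0.
have /choice[rr hrr] : forall i, exists ri : R, 0 < ri /\ forall y, `|y| < ri -> `|df i (y + x) - df i x| < eta.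
  by move=> i; have [ri ri0 h] := continuous_delta (cdf i) eta0; exists ri.
pose m := \big[Num.min/r]_i rr i.
have m0 : 0 < m by apply: lt_bigmin => // i _; have [] := hrr i.
exists m => // y ym.
have yr : `|y| < r by apply: lt_le_trans ym _; exact: bigmin_le_id.
have yri i : `|y| < rr i by apply: lt_le_trans ym _; exact: bigmin_le.
have [z zy ->] := row_increment hr d yr.
rewrite -sumrB (le_trans (ler_norm_sum _ _ _))//.
have : \sum_i `|y ord0 i * df i (z i + x) - df i x * y ord0 i| <= \sum_(i < n) eta * `|y|.
  apply: ler_sum => i _; rewrite mulrC -mulrBl normrM ler_pM//.
    by apply: ltW; have [_ ] := hrr i; apply; exact: le_lt_trans (zy i) (yri i).
  exact: normr_row_coord.
move=> /le_trans; apply.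
rewrite sumr_const card_ord -[leLHS]mulr_natl mulrA ler_wpM2r//.
rewrite /eta mulrCA ler_piMr//; first exact: ltW.
by rewrite ler_pdivrMr// mul1r ler_nat.
Qed.
(** The set on which [f] takes a given value is open by the mean value theorem, and so
    is its complement. *)
Lemma partials0_constant Om f : open Om -> connected Om ->
  (forall i x, Om x -> is_derive x (e i) f 0) ->
  forall x y, Om x -> Om y -> f x = f y.
Proof.
move=> oO cO d x y Ox Oy.
have loc c z : Om z -> exists2 r : R, 0 < r &
    forall v, `|v| < r -> Om (v + z) /\ (f (v + z) == c) = (f z == c).
  move=> Oz; have [r r0 hr] := open_ball_sub oO Oz; exists r => // v vr; split; first exact: hr.
  have [w _ E] := @row_increment Om f (fun _ _ => 0) z r hr d v vr.
  have : f (v + z) = f z by apply/eqP; rewrite -subr_eq0 E big1// => i _; rewrite mulr0.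
  by move=> ->.
have oP (P : R -> Prop) : open (Om `&` [set z | P (f z)]).
  rewrite openE => z [Oz Pz]; have [r r0 hr] := loc (f z) z Oz.
  apply/nbhs_ballP; exists r => //= w; rewrite -ball_normE /= distrC => zw.
  have [] := hr (w - z) zw; rewrite subrK eqxx => Ow /eqP fw; split => //=.
  by rewrite fw.
have : Om `&` [set z | f z = f x] = Om.
  apply: cO; first by exists x.
    by exists (Om `&` [set z | f z = f x]); [exact: (oP (fun t => t = f x))|rewrite setIA setIid].
  exists (~` (Om `&` [set z | f z <> f x])); first exact/open_closedC/(oP (fun t => t <> f x)).
  apply/seteqP; split => z /= [Oz].
    by move=> fz; split => // -[_]; apply.
  by move=> h; split => //; apply: contrapT => fz; apply: h.
by move=> E; move: Oy; rewrite -{1}E => -[_ /= ->].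
Qed.
End row_calculus.

(** * Translation, difference quotients and integration *)

Section tame.
Variables (R : realType) (n : nat).
Local Notation mu := (leb R n).
Implicit Types f g : 'rV[R]_n -> R.

(** A class stable under translation and under products with bounded functions, and on
    which integration over the whole space behaves as a linear functional. *)
Definition tame f : Prop := measurable_fun setT f /\
  exists M k, (forall x, `|f x| <= M) /\ forall x, ~ @cube R n k x -> f x = 0.

Lemma tame_measurable f : tame f -> measurable_fun setT f.
Proof. by case. Qed.

Lemma integrable_tame f : tame f -> mu.-integrable setT (EFin \o f).
Proof.
move=> [mf [M [k [fM f0]]]].
have mc : measurable (@cube R n k) by exact: measurable_rbox.
have := @integrable_bounded _ _ _ mu (@cube R n k) f M mc (leb_rbox_lty _ _) (measurable_funTS mf) (fun x _ => fM x).
move=> /(integrable_mkcond _ mc).1; congr (_.-integrable _ _).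
apply/funext => x; rewrite /patch /=; case: ifPn => //; rewrite notin_setE => /f0 -> //.
Qed.

Lemma cube_sub k l : (k <= l)%N -> @cube R n k `<=` @cube R n l.
Proof.
move=> kl x kx i; have := kx i; rewrite !mxE -!ltr_norml => /lt_le_trans; apply.
by rewrite ler_nat.
Qed.

Lemma tameD f g : tame f -> tame g -> tame (fun x => f x + g x).
Proof.
move=> [mf [M [k [fM f0]]]] [mg [N [l [gN g0]]]]; split; first exact: measurable_funD.
exists (M + N), (maxn k l); split => x; first exact: le_trans (ler_normD _ _) (lerD _ _).
move=> nx; rewrite f0 ?g0 ?addr0// => h; apply: nx; apply: cube_sub h.
  exact: leq_maxr.
exact: leq_maxl.
Qed.

Lemma tameM f g (N : R) : tame f -> measurable_fun setT g -> (forall x, `|g x| <= N) ->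
  tame (fun x => f x * g x).
Proof.
move=> [mf [M [k [fM f0]]]] mg gN; split; first exact: measurable_funM.
exists (M * N), k; split => [x|x /f0 ->]; last by rewrite mul0r.
by rewrite normrM ler_pM.
Qed.

Lemma tameZ c f : tame f -> tame (fun x => c * f x).
Proof.
move=> tf; have := @tameM f (fun=> c) `|c| tf (measurable_cst _) (fun=> lexx _).
by congr tame; apply/funext => x; rewrite mulrC.
Qed.

Lemma tameN f : tame f -> tame (fun x => - f x).
Proof. by move=> /(tameZ (-1)); congr tame; apply/funext => x; rewrite mulN1r. Qed.

Lemma tameB f g : tame f -> tame g -> tame (fun x => f x - g x).
Proof. by move=> tf /tameN; exact: tameD. Qed.

Lemma tame_translate f c : tame f -> tame (fun x => f (x + c)).
Proof.
move=> [mf [M [k [fM f0]]]]; split.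
  by apply: (measurableT_comp mf); exact: measurable_translate.
pose l := Num.bound `|c|.
exists M, (k + l)%N; split => // x nx; apply: f0 => h; apply: nx => i.
have := h i; rewrite !mxE -!ltr_norml => h1; rewrite natrD.
have cl : `|c ord0 i| < l%:R by exact: le_lt_trans (normr_row_coord _ _) (archi_boundP _).
have -> : x ord0 i = (x ord0 i + c ord0 i) - c ord0 i by rewrite addrK.
by apply: le_lt_trans (ler_normB _ _) _; exact: ltrD.
Qed.

Lemma tame_continuous f S : continuous f -> compact S -> (forall x, ~ S x -> f x = 0) -> tame f.
Proof.
move=> cf cS f0; split; first exact: continuous_measurable_row.
have [M M0 fM] := compact_continuous_bounded cS (fun x _ => cf x).
have [k Sk] := bounded_sub_cube (compact_bounded cS).
exists M, k; split => [x|x kx]; last by apply: f0 => /Sk.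
by have [/fM//|/f0 ->] := pselect (S x); rewrite normr0.
Qed.

Lemma test_tame O z : test_function O z -> tame z.
Proof.
move=> tz; have [_ [cz _]] := tz.
apply: (tame_continuous (test_continuous tz) cz) => x nx.
by apply/eqP/negPn/negP => zx; apply: nx; exact: subset_closure.
Qed.

(** Nonempty open sets have positive measure. *)
Lemma ae_open_witness O (P : 'rV[R]_n -> Prop) : open O -> O !=set0 ->
  {ae mu, forall x, O x -> P x} -> exists2 x, O x & P x.
Proof.
move=> oO O0 aeP; apply: contrapT => nex.
have := leb_open_gt0 oO O0; rewrite lt_neqAle => /andP[/eqP + _]; apply; apply/esym.
move: aeP => [N [mN N0 PN]]; apply/eqP; rewrite eq_le measure_ge0 andbT -N0.
apply: le_measure; rewrite ?inE//; first exact: open_measurable_row.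
by move=> x Ox; apply: PN => /= h; apply: nex; exists x => //; exact: h.
Qed.

Definition Itg f : R := (\int[mu]_x f x)%R.

Lemma ItgD f g : tame f -> tame g -> Itg (fun x => f x + g x) = Itg f + Itg g.
Proof. by move=> tf tg; apply: RintegralD => //; exact: integrable_tame. Qed.

Lemma ItgB f g : tame f -> tame g -> Itg (fun x => f x - g x) = Itg f - Itg g.
Proof. by move=> tf tg; apply: RintegralB => //; exact: integrable_tame. Qed.

Lemma ItgZ c f : tame f -> Itg (fun x => c * f x) = c * Itg f.
Proof. by move=> tf; apply: RintegralZl => //; exact: integrable_tame. Qed.

Lemma Itg_le f g : tame f -> tame g -> (forall x, f x <= g x) -> Itg f <= Itg g.
Proof. by move=> tf tg fg; apply: le_Rintegral => //; exact: integrable_tame. Qed.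

Lemma Itg_norm_le f g : tame f -> tame g -> (forall x, `|f x| <= g x) -> `|Itg f| <= Itg g.
Proof.
move=> tf tg fg; rewrite ler_norml; apply/andP; split.
  rewrite -mulN1r -ItgZ//; apply: Itg_le => //; first exact: tameZ.
  by move=> x; rewrite mulN1r; have /ler_normlP[] := fg x; lra.
by apply: Itg_le => // x; apply: le_trans (fg x); exact: ler_norm.
Qed.

Lemma Itg_translate f c : tame f -> Itg (fun x => f (x + c)) = Itg f.
Proof.
move=> tf; congr fine; apply: (@integral_translate R n c (EFin \o f)).
  by apply/measurable_EFinP; exact: tame_measurable.
exact: integrable_tame (tame_translate c tf).
Qed.

Lemma Itg_restrict O f : (forall x, ~ O x -> f x = 0) -> (\int[mu]_(x in O) f x)%R = Itg f.
Proof.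
move=> f0; rewrite Rintegral_mkcond; congr Rintegral; apply/funext => x.
by rewrite /patch; case: ifPn => //; rewrite notin_setE => /f0.
Qed.

(** A continuous nonnegative function that is positive somewhere is positive on an
    open set. *)
Lemma Itg_eq0 f : tame f -> (forall x, 0 <= f x) -> continuous f -> Itg f <= 0 -> forall x, f x = 0.
Proof.
move=> tf f0 cf If x; apply/eqP; apply: contrapT => /negP fx.
have intf := integrable_tame tf.
have I0 : (\int[mu]_x (EFin \o f) x = 0)%E.
  have fin := integrable_fin_num measurableT intf.
  rewrite -(fineK fin); congr (_ %:E); apply/eqP; rewrite eq_le If/=.
  exact: Rintegral_ge0.
have ae0 : {ae mu, forall y, setT y -> f y = 0}.
  have /(ae_eq_integral_abs mu measurableT (measurable_int _ intf)) : (\int[mu]_x `|(EFin \o f) x| = 0)%E.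
    by rewrite -I0; apply: eq_integral => y _; rewrite gee0_abs// lee_fin.
  by apply: filterS => y h /h /= [].
have oS : open [set y | 0 < f y].
  rewrite (_ : [set _ | _] = setT `&` f @^-1` [set t | 0 < t]); last by rewrite setTI.
  by apply: (open_continuous_preimage openT (@open_gt R 0)) => y _; exact: cf.
have [y /= fy fy0] : exists2 y, [set y | 0 < f y] y & f y = 0.
  apply: (ae_open_witness oS); first by exists x; rewrite /= lt_neqAle eq_sym fx f0.
  by apply: filterS ae0 => y h _; exact: h.
by rewrite fy0 ltxx in fy.
Qed.
End tame.

Section limits.
Variables (R : realType) (n : nat).
Local Notation mu := (leb R n).
Implicit Types (F X f g z : 'rV[R]_n -> R) (x : 'rV[R]_n).

Lemma Itg_dominated (f_ : nat -> 'rV[R]_n -> R) f g :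
  (forall k, tame (f_ k)) -> measurable_fun setT f -> tame g ->
  (forall k x, `|f_ k x| <= g x) -> (forall x, f_ k x @[k --> \oo] --> f x) ->
  Itg (f_ k) @[k --> \oo] --> Itg f.
Proof.
move=> tf mf tg fg cf.
have ig := integrable_tame tg.
have h1 k : measurable_fun setT (EFin \o f_ k) by apply/measurable_EFinP; exact: tame_measurable.
have h2 : measurable_fun setT (EFin \o f) by apply/measurable_EFinP.
have [||intf _ cI] := @dominated_convergence _ _ _ mu _ measurableT
  (fun k => EFin \o f_ k) (EFin \o f) (EFin \o g) h1 h2 _ ig.
- by apply: aeW => x _; apply: cvg_EFin; [exact: nearW|exact: cf].
- by apply: aeW => x k _; rewrite /= lee_fin.
have fin := integrable_fin_num measurableT intf.
by apply: fine_cvg; rewrite fineK.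
Qed.

Definition ind (O : set 'rV[R]_n) x : R := \1_O x.

Lemma ind_in O x : O x -> ind O x = 1.
Proof. by move=> Ox; rewrite /ind indicE mem_set. Qed.

Lemma ind_out (O : set 'rV[R]_n) x : ~ O x -> ind O x = 0.
Proof. by move=> Ox; rewrite /ind indicE memNset. Qed.

Lemma ind_norm O x : `|ind O x| <= 1.
Proof. by have [h|h] := pselect (O x); rewrite ?(ind_in h) ?(ind_out h) ?normr0 ?normr1. Qed.

Lemma ind_ge0 O x : 0 <= ind O x.
Proof. by have [h|h] := pselect (O x); rewrite ?(ind_in h) ?(ind_out h). Qed.

Lemma indC_norm O x : `|1 - ind O x| <= 1.
Proof.
by have [h|h] := pselect (O x); rewrite ?(ind_in h) ?(ind_out h) ?subrr ?subr0 ?normr0 ?normr1.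
Qed.

Lemma ind_tame O k : measurable O -> O `<=` @cube R n k -> tame (ind O).
Proof.
move=> mO Ok; split; first exact/measurable_indicP.
by exists 1, k; split => [x|x nx]; [exact: ind_norm|apply: ind_out => /Ok].
Qed.
End limits.

Section difference_quotients.
Variables (R : realType) (n : nat) (j : 'I_n).
Local Notation e := (delta_mx ord0 j : 'rV[R]_n).
Implicit Types (F z : 'rV[R]_n -> R) (x : 'rV[R]_n).

Definition shrink (k : nat) : R := k.+1%:R^-1.

Lemma shrink_gt0 k : 0 < shrink k.
Proof. by rewrite invr_gt0. Qed.

Lemma near_shrink (r : R) : 0 < r -> \forall k \near \oo, shrink k < r.
Proof.
move=> r0; have /cvgr0Pnorm_lt/(_ r r0) := @cvg_harmonic R.
by apply: filterS => k; rewrite gtr0_norm// invr_gt0.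
Qed.

(** The steps of the quotients form a sequence, to which dominated convergence applies. *)
Definition quotient k z x : R := (z x - z (x - shrink k *: e)) / shrink k.

(** The mean value theorem gives the limit of the quotients as well as a bound. *)
Lemma quotient_mvt k z x : Ck 1 setT z ->
  exists2 s : R, `|s| <= shrink k & quotient k z x = partial j z (s *: e + x).
Proof.
move=> zC.
have [s sh E] := @MVT_line R _ z (partial j z) x e (- shrink k)
  (fun s _ => Ck_derivable j zC I).
exists s; first by move: sh; rewrite normrN (gtr0_norm (shrink_gt0 k)).
rewrite /quotient.
have -> : x - shrink k *: e = (- shrink k) *: e + x by rewrite scaleNr [RHS]addrC.
apply: (canLR (mulfK _)); first by rewrite gt_eqF// shrink_gt0.
by apply: oppr_inj; rewrite opprB E mulNr mulrC.
Qed.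

Variables (F z : 'rV[R]_n -> R) (N : R).
Hypotheses (tF : tame F) (zC : Ck 1 setT z) (zN : forall x, `|partial j z x| <= N).

Let measurable_quotient k : measurable_fun setT (quotient k z).
Proof.
have mz : measurable_fun setT z.
  by apply: continuous_measurable_row => x; exact: (Ck_cont zC).
apply: measurable_funM; last exact: measurable_cst.
apply: measurable_funB => //.
by apply: (measurableT_comp mz); exact: measurable_translate.
Qed.

Lemma quotient_tame k : tame (fun x => F x * quotient k z x).
Proof.
apply: tameM tF (measurable_quotient k) _ => x.
by have [s _ ->] := quotient_mvt k x zC; exact: zN.
Qed.

Lemma quotient_cvg :
  Itg (fun x => F x * quotient k z x) @[k --> \oo] --> Itg (fun x => F x * partial j z x).
Proof.
have cp : continuous (partial j z) by move=> x; exact: (Ck_cont (Ck_partial j zC)).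
apply: (@Itg_dominated R n _ _ (fun x => N * `|F x|)).
- by move=> k; exact: quotient_tame.
- by apply: measurable_funM; [exact: tame_measurable tF|exact: continuous_measurable_row].
- apply: tameZ; have := tF => -[mF [K [k [FK Fk]]]].
  split; first exact: measurableT_comp mF.
  by exists K, k; split => x; [rewrite normr_id|move=> /Fk ->; rewrite normr0].
- by move=> k x; have [s _ ->] := quotient_mvt k x zC; rewrite normrM mulrC ler_wpM2r.
move=> x; apply/cvgrPdist_lt => eps eps0.
have eps1 : 0 < eps / (`|F x| + 1) by rewrite divr_gt0// ltr_wpDl.
have [r r0 hr] := continuous_delta (cp x) eps1.
apply: filterS (near_shrink r0) => k hk.
have [s sk ->] := quotient_mvt k x zC.
rewrite -mulrBr normrM distrC.
have sr : `|s *: e| < r.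
  by apply: le_lt_trans (normr_delta_le s j) _; exact: le_lt_trans sk hk.
have := hr _ sr; rewrite ltr_pdivlMr ?ltr_wpDl// => h1.
by apply: le_lt_trans h1; rewrite mulrC ler_wpM2l// lerDl.
Qed.
End difference_quotients.

(** The difference quotients of a compactly supported function have integral
    zero by translation invariance. *)
Lemma integral_partial0 (R : realType) n (j : 'I_n) (w : 'rV[R]_n -> R) :
  Ck 1 setT w -> compact (closure [set x | w x != 0]) -> Itg (partial j w) = 0.
Proof.
set S := closure _ => wC cS.
have w0 x : ~ S x -> w x = 0.
  by move=> nx; apply/eqP/negPn/negP => wx; apply: nx; exact: subset_closure.
have cw : continuous w by move=> x; exact: (Ck_cont wC).
have cdw : continuous (partial j w) by move=> x; exact: (Ck_cont (Ck_partial j wC)).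
have [N N0 hN] := compact_continuous_bounded cS (fun x _ => cdw x).
have dwN x : `|partial j w x| <= N.
  by have [/hN//|/(@partial_out _ _ w j) ->] := pselect (S x); rewrite normr0.
have tw : tame w := tame_continuous cw cS w0.
have [k Sk] := bounded_sub_cube (compact_bounded cS).
pose F := ind (@cube R n k.+1).
have tF : tame F by apply: (ind_tame (k := k.+1)) => //; exact: measurable_rbox.
have Sk1 x : S x -> F x = 1 by move=> /Sk xk; apply: ind_in; exact: cube_sub xk.
have qE l : (fun x => F x * quotient j l w x) = quotient j l w.
  apply/funext => x; rewrite /quotient.
  have [xk|nx] := pselect (@cube R n k.+1 x); first by rewrite /F (ind_in xk) mul1r.
  rewrite !w0 ?subrr ?mul0r ?mulr0// => Sx; apply: nx; last exact: cube_sub (Sk _ Sx).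
  move=> i; have := Sk _ Sx i; rewrite !mxE -!ltr_norml => h.
  rewrite -[x ord0 i](subrK (shrink R l * (true && (i == j))%:R)).
  apply: le_lt_trans (ler_normD _ _) _; rewrite -natr1 ltr_leD//.
  rewrite normrM gtr0_norm ?shrink_gt0//; case: (i == j); rewrite ?normr0 ?mulr0// normr1 mulr1.
  by rewrite /shrink invf_le1 ?ler1n ?ltr0n.
have q0 l : Itg (quotient j l w) = 0.
  have tt := tame_translate (- (shrink R l *: delta_mx ord0 j)) tw.
  have -> : quotient j l w = (fun x => (shrink R l)^-1 * (w x - w (x - shrink R l *: delta_mx ord0 j))).
    by apply/funext => x; rewrite /quotient mulrC.
  by rewrite ItgZ ?ItgB ?Itg_translate ?subrr ?mulr0//; exact: tameB.
have := quotient_cvg tF wC dwN.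
rewrite (_ : (fun k => _) = fun=> 0); last by apply/funext => l; rewrite qE q0.
have -> : (fun x => F x * partial j w x) = partial j w.
  apply/funext => x; have [Sx|nS] := pselect (S x); first by rewrite Sk1// mul1r.
  by rewrite (@partial_out _ _ w j x nS) mulr0.
by move=> /(cvg_lim (@Rhausdorff R)) <-; rewrite lim_cst.
Qed.

(** * Weak derivatives *)

Section weak_derivatives.
Variables (R : realType) (n : nat).
Local Notation mu := (leb R n).
Implicit Types (O S : set 'rV[R]_n) (f g z u : 'rV[R]_n -> R).

Lemma integrable_ae O f g : measurable O -> measurable_fun O f ->
  mu.-integrable O (EFin \o g) -> {ae mu, forall x, O x -> f x = g x} ->
  mu.-integrable O (EFin \o f).
Proof.
move=> mO /measurable_EFinP mf /integrableP[mg ig] fg; apply/integrableP; split => //.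
apply: le_lt_trans ig; apply: ae_ge0_le_integral => //.
- exact: measurableT_comp.
- exact: measurableT_comp.
- by apply: filterS fg => x h Ox /=; rewrite h.
Qed.

Lemma integrable_cont_test O f z : open O -> (forall x, O x -> {for x, continuous f}) ->
  test_function O z -> mu.-integrable O (EFin \o (fun x => f x * z x)).
Proof.
move=> oO cf tz; have mO := open_measurable_row oO.
have wC : Ck 0 setT ((fun x => f x * z x) \_ O) by apply: Ck_cutoff.
have tw : tame ((fun x => f x * z x) \_ O).
  have [_ [cz _]] := tz; apply: (tame_continuous (fun x => Ck_cont wC (I : setT x)) cz) => x nz.
  rewrite patchE; case: ifPn => // _; rewrite (_ : z x = 0) ?mulr0//.
  by apply/eqP/negPn/negP => zx; apply: nz; exact: subset_closure.
apply: eq_integrable (integrableS measurableT mO (@subsetT _ O) (integrable_tame tw)) => //.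
by move=> x xO; rewrite /= patchE xO.
Qed.

(** The product [f * z], extended by zero, is a compactly supported function, and its
    partial derivative has integral zero. *)
Lemma integral_by_parts O f z i : open O -> Ck 1 O f -> test_function O z ->
  \int[mu]_(x in O) (f x * partial i z x + partial i f x * z x) = 0.
Proof.
move=> oO fC tz; have [zk [cz zO]] := tz.
set w := (fun x => f x * z x) \_ O.
have wC : Ck 1 setT w by exact: Ck_cutoff.
have w0 x : z x = 0 -> w x = 0 by move=> zx; rewrite /w patchE zx mulr0 if_same.
have sub : closure [set x | w x != 0] `<=` closure [set x | z x != 0].
  by apply: closureS => x /= /eqP wx; apply/eqP => /w0.
have cw : compact (closure [set x | w x != 0]).
  by apply: (subclosed_compact _ cz sub); exact: closed_closure.
rewrite -(integral_partial0 i wC cw) -(@Itg_restrict _ _ O); last first.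
  by move=> x nO; apply: partial_out => /sub/zO.
apply: eq_Rintegral => x; rewrite inE => Ox.
rewrite (@partial_eq _ _ O w (fun x => f x * z x)) //; last first.
  by move=> y Oy; rewrite /w patchE mem_set.
have d1 := Ck_derivable i fC Ox.
have d2 := Ck_derivable i (Ck_sub (@subsetT _ O) (zk 1%N)) Ox.
have -> : partial i (fun x => f x * z x) x = f x *: partial i z x + z x *: partial i f x.
  by have [] := is_deriveM d1 d2.
by rewrite /GRing.scale/= [z x * _]mulrC.
Qed.

Lemma weak_partial_Ck1 O f i : open O -> Ck 1 O f -> weak_partial O i f (partial i f).
Proof.
move=> oO fC z tz.
have mO : measurable O by exact: open_measurable_row.
have i1 : mu.-integrable O (EFin \o (fun x => f x * partial i z x)).
  apply: integrable_cont_test => //; [exact: Ck_cont fC|exact: test_partial].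
have i2 : mu.-integrable O (EFin \o (fun x => partial i f x * z x)).
  by apply: integrable_cont_test => //; exact: Ck_cont (Ck_partial i fC).
apply/eqP; rewrite -addr_eq0 -RintegralD//.
by rewrite integral_by_parts.
Qed.

Lemma leb_setT_gt0 : (0 < mu setT)%E.
Proof. by apply: leb_open_gt0; [exact: openT|exists 0]. Qed.

Lemma Linfty_normE O f : Linfty_norm O f = ess_sup mu (abse \o (EFin \o (f \_ O))).
Proof. by rewrite /Linfty_norm unlock leb_setT_gt0. Qed.

(** The norm is an essential supremum over the whole space, of the extension by zero. *)
Lemma Linfty_norm_leP O f (y : \bar R) : (0 <= y)%E ->
  (Linfty_norm O f <= y)%E <-> {ae mu, forall x, O x -> (`|f x|%:E <= y)%E}.
Proof.
move=> y0; rewrite Linfty_normE; split.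
  by move=> /ess_supP; apply: filterS => x /= + Ox; rewrite patchE mem_set.
move=> h; apply/ess_supP; apply: filterS h => x /= h; rewrite patchE.
by case: ifPn => [|_]; rewrite ?inE ?normr0.
Qed.

Lemma Linfty_norm_ge0 O f : (0 <= Linfty_norm O f)%E.
Proof. exact: Lnorm_ge0. Qed.

Lemma Linfty_bounded O f (M : R) : measurable_fun O f -> (forall x, O x -> `|f x| <= M) ->
  Linfty O f.
Proof.
move=> mf fM; split => //; apply: (@le_lt_trans _ _ (`|M|)%:E); last exact: ltry.
apply/Linfty_norm_leP; first by rewrite lee_fin.
by apply: nearW => x Ox; rewrite lee_fin (le_trans (fM _ Ox))// ler_norm.
Qed.

Lemma Linfty_ae_bounded O f : Linfty O f ->
  exists2 M, 0 <= M & {ae mu, forall x, O x -> `|f x| <= M}.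
Proof.
move=> [mf foo]; have f0 := Linfty_norm_ge0 O f.
exists (fine (Linfty_norm O f)); first exact: fine_ge0.
have /(Linfty_norm_leP _ _ f0) : (Linfty_norm O f <= Linfty_norm O f)%E by [].
apply: filterS => x h /h; rewrite -{1}(@fineK _ (Linfty_norm O f)) ?lee_fin//.
by rewrite ge0_fin_numE.
Qed.

(** Truncating at its essential bound turns a representative of an element of
    Linfty into one that is bounded everywhere and vanishes off [O]. *)
Lemma Linfty_trunc O f : measurable O -> Linfty O f -> exists g (M : R),
  [/\ measurable_fun setT g, forall x, `|g x| <= M, forall x, ~ O x -> g x = 0 &
      {ae mu, forall x, O x -> f x = g x}].
Proof.
move=> mO fL; have [M M0 fM] := Linfty_ae_bounded fL.
exists ((fun x => if `|f x| <= M then f x else 0) \_ O), M; split.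
- apply/(measurable_restrictT _ _).1 => //; apply: measurable_fun_if => //.
  + apply: measurable_fun_ler => //; apply: measurableT_comp => //; exact: fL.1.
  + by apply: measurable_funS fL.1.
- by move=> x; rewrite patchE; case: ifP => _; [case: ifPn|]; rewrite ?normr0.
- by move=> x nO; rewrite patchE memNset.
- by apply: filterS fM => x h Ox; rewrite patchE mem_set// h.
Qed.

Lemma integrable_Linfty_test O g z : open O -> Linfty O g -> test_function O z ->
  mu.-integrable O (EFin \o (fun x => g x * z x)).
Proof.
move=> oO gL tz; have mO := open_measurable_row oO.
have [g' [M [mg' g'M g'0 gg']]] := Linfty_trunc mO gL.
have i' : mu.-integrable O (EFin \o (fun x => z x * g' x)).
  exact: integrableS (integrable_tame (tameM (test_tame tz) mg' g'M)).
apply: (integrable_ae mO _ i'); last by apply: filterS gg' => x h Ox; rewrite h// mulrC.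
apply: measurable_funM; first exact: gL.1.
by apply: measurable_funTS; exact: tame_measurable (test_tame tz).
Qed.

Lemma Linfty_integral_ae O f f' z : open O -> Linfty O f -> Linfty O f' ->
  {ae mu, forall x, O x -> f x = f' x} -> test_function O z ->
  \int[mu]_(x in O) (f x * z x) = \int[mu]_(x in O) (f' x * z x).
Proof.
move=> oO [mf _] [mf' _] ff' tz; have mO := open_measurable_row oO.
have mz : measurable_fun O z.
  by apply: continuous_on_measurable => // x _; exact: (test_continuous tz).
congr fine; apply: ae_eq_integral => //.
- by apply/measurable_EFinP; exact: measurable_funM.
- by apply/measurable_EFinP; exact: measurable_funM.
- by apply: filterS ff' => x h Ox; rewrite h.
Qed.

(** The difference of two truncations is bounded, so [test_fundamental] applies to it. *)
Lemma Linfty_test_unique O g1 g2 : open O -> Linfty O g1 -> Linfty O g2 ->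
  (forall z, test_function O z ->
    \int[mu]_(x in O) (g1 x * z x) = \int[mu]_(x in O) (g2 x * z x)) ->
  {ae mu, forall x, O x -> g1 x = g2 x}.
Proof.
move=> oO L1 L2 h; have mO := open_measurable_row oO.
have [k1 [M1 [mk1 kM1 k10 e1]]] := Linfty_trunc mO L1.
have [k2 [M2 [mk2 kM2 k20 e2]]] := Linfty_trunc mO L2.
have K1 : Linfty O k1.
  by apply: (Linfty_bounded (M := M1)) => //; exact: measurable_funTS.
have K2 : Linfty O k2.
  by apply: (Linfty_bounded (M := M2)) => //; exact: measurable_funTS.
have : {ae mu, forall x, O x -> k1 x - k2 x = 0}.
  apply: (@test_fundamental _ _ _ _ (M1 + M2)) => //.
  - by apply: measurable_funB; exact: measurable_funTS.
  - by move=> x _; rewrite (le_trans (ler_normB _ _))// lerD.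
  - move=> z tz.
    have i1 := integrable_Linfty_test oO K1 tz.
    have i2 := integrable_Linfty_test oO K2 tz.
    have hz := h z tz; rewrite (Linfty_integral_ae oO L1 K1 e1 tz) in hz.
    rewrite (Linfty_integral_ae oO L2 K2 e2 tz) in hz.
    under eq_integral do rewrite mulrBl.
    rewrite (integralB_EFin mO i1 i2).
    rewrite -[X in (X - _)%E](fineK (integrable_fin_num mO i1)).
    rewrite -[X in (_ - X)%E](fineK (integrable_fin_num mO i2)).
    by rewrite [fine _]hz subee.
by apply: filterS3 e1 e2 => x h1 h2 h3 Ox; rewrite h1// h2//; apply/eqP; rewrite -subr_eq0 h3.
Qed.

Lemma weak_partial_unique O f i g1 g2 : open O -> Linfty O g1 -> Linfty O g2 ->
  weak_partial O i f g1 -> weak_partial O i f g2 ->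
  {ae mu, forall x, O x -> g1 x = g2 x}.
Proof.
move=> oO L1 L2 h1 h2; apply: Linfty_test_unique => // z tz.
by apply: oppr_inj; rewrite -h1// -h2.
Qed.
End weak_derivatives.

(** * Differentiation along symmetric matrices *)

Section symmetric_calculus.
Variables (R : realType) (n : nat).
Implicit Types (H : 'M[R]_n -> R) (X Y : 'M[R]_n).

(** The orthogonal projection onto symmetric matrices, which makes a function of
    symmetric matrices a function of all matrices. *)
Definition sym_part X : 'M[R]_n := 2^-1 *: (X + X^T).

Lemma sym_part_sym X : sym_part X \is symmetricmx.
Proof.
apply/symmetricmxP => i j; rewrite !mxE; congr (_ * _).
by rewrite addrC.
Qed.

Lemma sym_part_id X : X \is symmetricmx -> sym_part X = X.
Proof.
move=> /symmetricmxP XT; apply/matrixP => i j; rewrite !mxE (XT j i); lra.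
Qed.

Lemma sym_part_delta i j : sym_part (delta_mx i j) = sym_unit R i j.
Proof. by rewrite /sym_part trmx_delta. Qed.

Lemma sym_partD a X Y : sym_part (a *: X + Y) = a *: sym_part X + sym_part Y.
Proof.
by apply/matrixP => i j; rewrite !mxE; ring.
Qed.

Lemma sym_part_continuous : continuous sym_part.
Proof.
move=> X A /nbhs_ballP[e /= e0 h]; apply/nbhs_ballP; exists e => //= Y [_ XY]; apply: h.
split => // i j; have := XY i j; have := XY j i; rewrite /ball /= !mxE !ltr_norml.
by move=> /andP[h1 h2] /andP[h3 h4]; apply/andP; split; lra.
Qed.

Lemma vec_mx_continuous : continuous (vec_mx : 'rV[R]_(n * n) -> 'M[R]_n).
Proof.
move=> v A /nbhs_ballP[e /= e0 h]; apply/nbhs_ballP; exists e => //= w [_ vw]; apply: h.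
by split => // i j; rewrite !mxE; exact: vw.
Qed.

Lemma mxvec_norm_le X : `|mxvec X| <= `|X|.
Proof.
rewrite [leLHS]/Num.norm /= mx_normrE; apply/bigmax_leP; split => // -[k l] _ /=.
case/mxvec_indexP: l => i j; rewrite ord1 mxvecE.
rewrite [leRHS]/Num.norm /= mx_normrE; apply/bigmax_geP; right.
by exists (i, j).
Qed.

Lemma sum_mxvec (F : 'I_(n * n) -> R) : \sum_k F k = \sum_i \sum_j F (mxvec_index i j).
Proof.
rewrite pair_bigA /= (reindex (uncurry (@mxvec_index n n))) /=.
  by apply: eq_bigr => -[i j] _.
exact: (subon_bij _ (curry_mxvec_bij n n)).
Qed.

(** Only the directional derivatives along the [sym_unit i j] are given; since
    these span the symmetric matrices, in the coordinates of [mxvec] they are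
    the partial derivatives of [H \o sym_part \o vec_mx]. *)
Lemma taylor_sym H X (eps : R) : C1_sym H -> X \is symmetricmx -> 0 < eps ->
  exists2 r : R, 0 < r & forall Y, Y \is symmetricmx -> `|Y| < r ->
    `|H (Y + X) - H X - mxdot (mxgrad H X) Y| <= eps * `|Y|.
Proof.
move=> HC sX e0.
pose s (c : 'rV[R]_(n * n)) := sym_part (vec_mx c).
pose df (k : 'I_(n * n)) (c : 'rV[R]_(n * n)) : R := mxvec (mxgrad H (s c)) ord0 k.
have scont : continuous s.
  move=> c; apply: (@continuous_comp _ _ _ vec_mx sym_part); first exact: vec_mx_continuous.
  exact: sym_part_continuous.
have d k c : is_derive c (delta_mx ord0 k) (H \o s) (df k c).
  case/mxvec_indexP: k => i j; rewrite /df mxvecE mxE.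
  apply: is_derive_coord_line.
  have [dH _] := HC i j.
  have dX : is_derive (0 *: sym_unit R i j + s c) (sym_unit R i j) H ('D_(sym_unit R i j) H (s c)).
    by rewrite scale0r add0r; exact: derivableP (dH _ (sym_part_sym _)).
  have := is_derive_line dX.
  congr is_derive; apply/funext => t; congr H.
  have vd : vec_mx (delta_mx ord0 (mxvec_index i j)) = delta_mx i j :> 'M[R]_n by exact: vec_mx_delta.
  by rewrite /s linearP /= vd sym_partD sym_part_delta.
have cdf k : {for mxvec X, continuous (df k)}.
  case/mxvec_indexP: k => i j.
  have -> : df (mxvec_index i j) = (fun Z => mxgrad H Z i j) \o s.
    by apply/funext => c; rewrite /df mxvecE.
  have [_ cH] := HC i j.
  move/subspace_continuousP : cH => /(_ (s (mxvec X)) (sym_part_sym _)) cH.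
  move=> A hA.
  have hB : nbhs (mxvec X) [set c | s c \is symmetricmx -> A (mxgrad H (s c) i j)].
    exact: scont (mxvec X) _ (cH A hA).
  by apply: (@filterS _ (nbhs (mxvec X)) _ _ _ _ hB) => c /=; apply; exact: sym_part_sym.
have [r r0 h] := @taylor1 R (n * n) setT (H \o s) df (mxvec X) eps openT I (fun k c _ => d k c) cdf e0.
exists r => // Y sY Yr.
have := h (mxvec Y) (le_lt_trans (mxvec_norm_le Y) Yr).
have sE Z : Z \is symmetricmx -> s (mxvec Z) = Z by move=> sZ; rewrite /s mxvecK sym_part_id.
have -> : (H \o s) (mxvec Y + mxvec X) = H (Y + X).
  by rewrite /= /s linearD /= !mxvecK -[Y in sym_part (Y + _)]scale1r sym_partD scale1r !sym_part_id.
rewrite /= sE// sum_mxvec => hY.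
apply: le_trans (_ : eps * `|mxvec Y| <= _); last by rewrite ler_wpM2l ?mxvec_norm_le// ltW.
apply: le_trans hY; rewrite le_eqVlt; apply/orP; left; apply/eqP; congr (`|_ - _|).
apply: eq_bigr => i _; apply: eq_bigr => j _.
by rewrite /df !mxvecE sE.
Qed.
End symmetric_calculus.

(** * Second order weak jets *)

Section jets.
Variables (R : realType) (n : nat).
Local Notation mu := (leb R n).
Implicit Types (O Om : set 'rV[R]_n) (f g u v z : 'rV[R]_n -> R).
Implicit Types (p q : 'rV[R]_n -> 'rV[R]_n) (X Y : 'rV[R]_n -> 'M[R]_n).

Lemma Linfty_compact O Om f : open O -> compactly_contained O Om ->
  (forall x, Om x -> {for x, continuous f}) -> Linfty O f.
Proof.
move=> oO [cO OOm] cf.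
have [M _ fM] := compact_continuous_bounded cO (fun x Ox => cf x (OOm x Ox)).
apply: (Linfty_bounded (M := M)).
  by apply: continuous_on_measurable => // x /subset_closure/OOm; exact: cf.
by move=> x /subset_closure; exact: fM.
Qed.

Definition grad u (x : 'rV[R]_n) : 'rV[R]_n := \row_i partial i u x.

(** The classical derivatives are bounded because the closure of [O] is a compact
    subset of [Om]. *)
Lemma Ck_weak_jet O Om u : open O -> open Om -> compactly_contained O Om -> Ck 2 Om u ->
  weak_jet O u (grad u) (hessian u).
Proof.
move=> oO oOm cO uC.
have OOm : O `<=` Om by apply: subset_trans cO.2; exact: subset_closure.
have uCO : Ck 2 O u by exact: Ck_sub uC.
split; first by apply: Linfty_compact cO _ => //; exact: Ck_cont uC.
split=> [i|i j].
  have -> : (fun x => grad u x ord0 i) = partial i u by apply/funext => x; rewrite mxE.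
  split; first by apply: Linfty_compact cO _ => //; exact: Ck_cont (Ck_partial i uC).
  by apply: weak_partial_Ck1 => //; exact: CkW uCO.
have -> : (fun x => grad u x ord0 i) = partial i u by apply/funext => x; rewrite mxE.
have -> : (fun x => hessian u x i j) = partial j (partial i u) by apply/funext => x; rewrite mxE.
split; last by apply: weak_partial_Ck1 => //; exact: Ck_partial.
by apply: Linfty_compact cO _ => //; exact: (Ck_cont (Ck_partial j (Ck_partial i uC))).
Qed.

Lemma weak_partial_ae O i f f' g : open O -> Linfty O f -> Linfty O f' ->
  {ae mu, forall x, O x -> f x = f' x} -> weak_partial O i f g -> weak_partial O i f' g.
Proof.
move=> oO fL f'L ff' h z tz; rewrite -(h z tz).
by apply/esym/Linfty_integral_ae => //; exact: test_partial.
Qed.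

Lemma weak_jet_unique O u p q X Y : open O -> weak_jet O u p X -> weak_jet O u q Y ->
  {ae mu, forall x, O x -> p x = q x} /\ {ae mu, forall x, O x -> X x = Y x}.
Proof.
move=> oO [uL [pu Xp]] [_ [qu Yq]].
have pq : forall i, {ae mu, forall x, O x -> p x ord0 i = q x ord0 i}.
  move=> i; have [p1 p2] := pu i; have [q1 q2] := qu i.
  exact: weak_partial_unique p2 q2.
have XY : forall ij : 'I_n * 'I_n, {ae mu, forall x, O x -> X x ij.1 ij.2 = Y x ij.1 ij.2}.
  move=> [i j] /=; have [X1 X2] := Xp i j; have [Y1 Y2] := Yq i j.
  apply: (weak_partial_unique oO X1 Y1 _ Y2).
  by apply: (weak_partial_ae oO _ _ (pq i) X2); [have [] := pu i|have [] := qu i].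
split.
  by apply: filterS (ae_forall_count pq) => x h Ox; apply/rowP => i; exact: h.
by apply: filterS (ae_forall_count XY) => x h Ox; apply/matrixP => i j; exact: (h (i, j)).
Qed.

(** Whatever jet is chosen in the definition of [weak_hessian], it agrees almost
    everywhere with any jet at hand. *)
Lemma weak_hessian_ae O u p X : open O -> weak_jet O u p X ->
  {ae mu, forall x, O x -> weak_hessian O u x = X x}.
Proof.
move=> oO uX; have [q uY] : exists q, weak_jet O u q (weak_hessian O u).
  by rewrite /weak_hessian; case: xgetP => [Y -> //|/(_ X)[]]; exists p.
by have [_] := weak_jet_unique oO uY uX.
Qed.

Lemma weak_gradient_ae O u p X : open O -> weak_jet O u p X ->
  {ae mu, forall x, O x -> weak_gradient O u x = p x}.
Proof.
move=> oO uX; have [Y uY] : exists Y, weak_jet O u (weak_gradient O u) Y.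
  by rewrite /weak_gradient; case: xgetP => [q -> //|/(_ p)[]]; exists X.
by have [] := weak_jet_unique oO uY uX.
Qed.

Lemma LinftyD O f g : open O -> Linfty O f -> Linfty O g -> Linfty O (fun x => f x + g x).
Proof.
move=> oO fL gL; have [M M0 fM] := Linfty_ae_bounded fL; have [N N0 gN] := Linfty_ae_bounded gL.
split; first by apply: measurable_funD; [exact: fL.1|exact: gL.1].
apply: (@le_lt_trans _ _ (M + N)%:E); last exact: ltry.
apply/Linfty_norm_leP; first by rewrite lee_fin addr_ge0.
apply: filterS2 fM gN => x h1 h2 Ox; rewrite lee_fin (le_trans (ler_normD _ _))//.
by rewrite lerD ?h1 ?h2.
Qed.

Lemma Rintegral_testD O f g z : open O -> Linfty O f -> Linfty O g -> test_function O z ->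
  \int[mu]_(x in O) ((f x + g x) * z x) =
  \int[mu]_(x in O) (f x * z x) + \int[mu]_(x in O) (g x * z x).
Proof.
move=> oO fL gL tz; rewrite -RintegralD//.
- by apply: eq_Rintegral => x _; rewrite mulrDl.
- exact: open_measurable_row.
- exact: integrable_Linfty_test.
- exact: integrable_Linfty_test.
Qed.

Lemma weak_partialD O i f f' g g' : open O -> Linfty O f -> Linfty O f' ->
  Linfty O g -> Linfty O g' ->
  weak_partial O i f g -> weak_partial O i f' g' ->
  weak_partial O i (fun x => f x + f' x) (fun x => g x + g' x).
Proof.
move=> oO fL f'L gL g'L h h' z tz; have tz' := test_partial i tz.
by rewrite !Rintegral_testD// h// h'// opprD.
Qed.

Lemma weak_jetD O u v p q X Y : open O -> weak_jet O u p X -> weak_jet O v q Y ->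
  weak_jet O (u \+ v) (fun x => p x + q x) (fun x => X x + Y x).
Proof.
move=> oO [uL [pu Xp]] [vL [qv Yq]]; split; first exact: LinftyD.
split=> [i|i j].
  under [X in Linfty _ X]eq_fun do rewrite mxE.
  under [X in weak_partial _ _ _ X]eq_fun do rewrite mxE.
  have [p1 p2] := pu i; have [q1 q2] := qv i.
  by split; [exact: LinftyD|exact: weak_partialD].
under [X in Linfty _ X]eq_fun do rewrite mxE.
under [X in weak_partial _ _ _ X]eq_fun do rewrite mxE.
under [X in weak_partial _ _ X _]eq_fun do rewrite mxE.
have [p1 p2] := pu i; have [q1 q2] := qv i.
have [X1 X2] := Xp i j; have [Y1 Y2] := Yq i j.
by split; [exact: LinftyD|exact: weak_partialD].
Qed.

Lemma Rintegral_mull_ext O u f g : f =1 g ->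
  \int[mu]_(x in O) (u x * f x) = \int[mu]_(x in O) (u x * g x).
Proof. by move=> fg; apply: eq_Rintegral => x _; rewrite fg. Qed.

(** Second derivatives of test functions commute, hence weak ones do. *)
Lemma weak_jet_sym O u p X : open O -> weak_jet O u p X ->
  {ae mu, forall x, O x -> X x \is symmetricmx}.
Proof.
move=> oO [uL [pu Xp]].
have XX : forall ij : 'I_n * 'I_n, {ae mu, forall x, O x -> X x ij.1 ij.2 = X x ij.2 ij.1}.
  move=> [i j] /=; have [X1 X2] := Xp i j; have [Y1 Y2] := Xp j i.
  apply: Linfty_test_unique => // z tz.
  have [_ pi] := pu i; have [_ pj] := pu j.
  have ti := test_partial i tz; have tj := test_partial j tz.
  have e : \int[mu]_(x in O) (u x * partial i (partial j z) x) =
           \int[mu]_(x in O) (u x * partial j (partial i z) x).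
    have zz x := @schwarz R n setT z x j i openT (tz.1 2%N) I.
    exact: (@Rintegral_mull_ext O u _ _ zz).
  apply: oppr_inj; apply: etrans (esym (X2 z tz)) _; apply: etrans _ (Y2 z tz).
  apply: oppr_inj; apply: etrans (esym (pi _ tj)) _; apply: etrans _ (pj _ ti).
  exact: e.
apply: filterS (ae_forall_count XX) => x h Ox; apply/symmetricmxP => i j.
exact: (h (i, j) Ox).
Qed.
End jets.

(** * Functions of a linear contraction of the Hessian *)

Section quadratic_form.
Variables (R : realType) (n : nat).
Implicit Types (H : 'M[R]_n -> R) (A X Y : 'M[R]_n) (u : 'rV[R]_n -> R).

(** The gradient at [x] of [H (hessian u)], by the chain rule. *)
Definition drift H u x (i : 'I_n) : R :=
  \sum_k \sum_l mxgrad H (hessian u x) k l * third u x i k l.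

Lemma tensor_contract (G : 'I_n -> 'I_n -> R) (T : 'I_n -> 'I_n -> 'I_n -> R) :
  \sum_i \sum_j \sum_k \sum_l \sum_p \sum_q
    G i j * G k l * G p q * T i k l * T j p q =
  \sum_i \sum_j G i j * ((\sum_k \sum_l G k l * T i k l) * (\sum_k \sum_l G k l * T j k l)).
Proof.
apply: eq_bigr => i _; apply: eq_bigr => j _.
rewrite mulr_suml mulr_sumr; apply: eq_bigr => k _.
rewrite mulr_suml mulr_sumr; apply: eq_bigr => l _.
rewrite mulr_sumr mulr_sumr; apply: eq_bigr => p _.
rewrite mulr_sumr mulr_sumr; apply: eq_bigr => q _.
ring.
Qed.

(** Grouping the sums over the last four indices turns the operator into the quadratic
    form of the gradient of [H] at the drift. *)
Lemma A2infty_drift H u x : A2infty H u x =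
  \sum_i \sum_j mxgrad H (hessian u x) i j * (drift H u x i * drift H u x j).
Proof. exact: (tensor_contract (mxgrad H (hessian u x)) (third u x)). Qed.

Lemma mxdotD A X Y : mxdot A (X + Y) = mxdot A X + mxdot A Y.
Proof.
rewrite /mxdot -big_split; apply: eq_bigr => i _; rewrite -big_split.
by apply: eq_bigr => j _; rewrite mxE mulrDr.
Qed.

Lemma mxdotZ A t X : mxdot A (t *: X) = t * mxdot A X.
Proof.
rewrite /mxdot mulr_sumr; apply: eq_bigr => i _; rewrite mulr_sumr.
by apply: eq_bigr => j _; rewrite mxE mulrCA.
Qed.

Lemma sum_delta (F : 'I_n -> 'I_n -> R) i j :
  \sum_k \sum_l F k l * ((k == i) && (l == j))%:R = F i j.
Proof.
rewrite (bigD1 i)//= (bigD1 j)//= !eqxx mulr1 !big1 ?addr0//.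
  by move=> k ki; rewrite big1// => l _; rewrite (negbTE ki) mulr0.
by move=> l lj; rewrite (negbTE lj) andbF mulr0.
Qed.

Lemma mxdot_unit A i j : A \is symmetricmx -> mxdot A (sym_unit R i j) = A i j.
Proof.
move=> /symmetricmxP sA; rewrite /sym_unit mxdotZ mxdotD /mxdot.
under eq_bigr do under eq_bigr do rewrite mxE.
under [X in _ * (_ + X)]eq_bigr do under eq_bigr do rewrite mxE.
by rewrite !sum_delta (sA j i); lra.
Qed.

Lemma sym_unit_sym (i j : 'I_n) : sym_unit R i j \is symmetricmx.
Proof. by rewrite -sym_part_delta sym_part_sym. Qed.

Lemma symD X Y : X \is symmetricmx -> Y \is symmetricmx -> X + Y \is symmetricmx.
Proof.
by move=> /symmetricmxP sX /symmetricmxP sY; apply/symmetricmxP => i j; rewrite !mxE sX sY.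
Qed.

Lemma symZ (t : R) X : X \is symmetricmx -> t *: X \is symmetricmx.
Proof. by move=> /symmetricmxP sX; apply/symmetricmxP => i j; rewrite !mxE sX. Qed.
End quadratic_form.

(** A third value would lie between two distinct ones. *)
Lemma connected_two_values (R : realType) n (Om : set 'rV[R]_n) (f : 'rV[R]_n -> R) a b :
  connected Om -> (forall x, Om x -> {for x, continuous f}) ->
  (forall x, Om x -> f x = a \/ f x = b) ->
  forall x y, Om x -> Om y -> f x = f y.
Proof.
move=> cO cf fab x y Ox Oy.
have cs : {within Om, continuous f}.
  by apply: continuous_in_subspaceT => z; rewrite inE; exact: cf.
have /connected_intervalP int := connected_continuous_connected cO cs.
have wlg x1 x2 : Om x1 -> Om x2 -> f x1 < f x2 -> False.
  move=> O1 O2 lt12.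
  have [z Oz zm] : [set f y | y in Om] ((f x1 + f x2) / 2).
    apply: (int (f x1) (f x2)); [by exists x1|by exists x2|].
    by apply/andP; split; lra.
  by case: (fab _ O1) (fab _ O2) (fab _ Oz) => E1 [|] E2 [|] E3; lra.
have [lt|gt|//] := ltgtP (f x) (f y); first by have := wlg _ _ Ox Oy lt.
by have := wlg _ _ Oy Ox gt.
Qed.

Section linear_argument.
Variables (R : realType) (n : nat) (n_gt0 : (0 < n)%N).
Variables (H : 'M[R]_n -> R) (A : 'M[R]_n) (h : R -> R).
Hypotheses (symA : A \is symmetricmx) (posA : posdef A) (hC : C1 h).
Hypothesis HE : forall X, X \is symmetricmx -> H X = h (mxdot A X).
Hypothesis H_ge0 : forall X, X \is symmetricmx -> 0 <= H X.
Variables (Om : set 'rV[R]_n) (u : 'rV[R]_n -> R).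
Hypotheses (oO : open Om) (uC : Ck 3 Om u).
Local Notation s x := (mxdot A (hessian u x)).
Local Notation ds x i := (\sum_k \sum_l A k l * third u x i k l).

(** Chain rule: along [sym_unit i j] the contraction grows at the rate [A i j]. *)
Lemma mxgrad_linear X : X \is symmetricmx -> mxgrad H X = derive1 h (mxdot A X) *: A.
Proof.
move=> sX; apply/matrixP => i j; rewrite !mxE.
suff [_ ->] : is_derive X (sym_unit R i j) H (derive1 h (mxdot A X) * A i j) by [].
apply: is_derive_coord_line.
have -> : (fun t : R => H (t *: sym_unit R i j + X)) = h \o (fun t => t * A i j + mxdot A X).
  apply/funext => t; rewrite /= HE; last by apply: symD => //; apply: symZ; exact: sym_unit_sym.
  by rewrite mxdotD mxdotZ mxdot_unit.
have hd : is_derive (0 * A i j + mxdot A X) 1 h (derive1 h (mxdot A X)).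
  by rewrite mul0r add0r derive1E; apply: derivableP; exact: hC.1.
apply: is_derive1_comp.
have := is_deriveD (@is_deriveM _ _ _ _ (0 : R) 1 1 0 (is_derive_id _ _) (is_derive_cst (A i j) _ _)) (is_derive_cst (mxdot A X) (0 : R) 1).
by rewrite scaler0 add0r addr0 /GRing.scale/= mulr1.
Qed.

Lemma drift_linear x i : Om x -> drift H u x i = derive1 h (s x) * ds x i.
Proof.
move=> Ox; have sX := hessian_sym oO (CkW uC) Ox.
rewrite /drift mxgrad_linear// mulr_sumr; apply: eq_bigr => k _.
by rewrite mulr_sumr; apply: eq_bigr => l _; rewrite mxE mulrA.
Qed.

Lemma is_derive_hessian x i k l : Om x ->
  is_derive x (delta_mx ord0 i) (fun y => hessian u y k l) (third u x i k l).
Proof.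
move=> Ox; rewrite (third_sym _ _ _ oO uC Ox).
have -> : (fun y => hessian u y k l) = partial l (partial k u) by apply/funext => y; rewrite mxE.
exact: (Ck_derivable i (Ck_partial l (Ck_partial k uC)) Ox).
Qed.

Lemma hessian_continuous x k l : Om x -> {for x, continuous (fun y => hessian u y k l)}.
Proof.
move=> Ox; have -> : (fun y => hessian u y k l) = partial l (partial k u) by apply/funext => y; rewrite mxE.
exact: (Ck_cont (Ck_partial l (Ck_partial k uC)) Ox).
Qed.

Lemma is_derive_s x i : Om x -> is_derive x (delta_mx ord0 i) (fun y => s y) (ds x i).
Proof.
move=> Ox.
have -> : (fun y => s y) = \sum_k \sum_l ((A k l) \*: (fun y => hessian u y k l)).
  apply/funext => y; rewrite /mxdot fct_sumE; apply: eq_bigr => k _.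
  by rewrite fct_sumE; apply: eq_bigr => l _.
apply: is_derive_sum => k; apply: is_derive_sum => l.
exact: is_deriveZ (is_derive_hessian _ _ _ Ox).
Qed.

Lemma continuous_s x : Om x -> {for x, continuous (fun y => s y)}.
Proof.
move=> Ox.
have -> : (fun y => s y) = \sum_k \sum_l (fun y => A k l * hessian u y k l).
  apply/funext => y; rewrite /mxdot fct_sumE; apply: eq_bigr => k _.
  by rewrite fct_sumE.
elim/big_rec : _ => [|k f _ cf]; first exact: cst_continuous.
apply: continuousD => //; elim/big_rec : _ => [|l g _ cg]; first exact: cst_continuous.
apply: continuousD => //; apply: continuousM; first exact: cst_continuous.
exact: hessian_continuous.
Qed.

Lemma is_derive_hs x i : Om x ->
  is_derive x (delta_mx ord0 i) (fun y => h (s y)) (derive1 h (s x) * ds x i).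
Proof.
move=> Ox; apply: is_derive_coord_line.
have d0 : is_derive (0 *: delta_mx ord0 i + x) (delta_mx ord0 i : 'rV[R]_n) (fun y => s y) (ds x i).
  by rewrite scale0r add0r; exact: is_derive_s.
have d1 := is_derive_line d0.
have hd : is_derive (s (0 *: delta_mx ord0 i + x)) 1 h (derive1 h (s x)).
  by rewrite scale0r add0r derive1E; apply: derivableP; exact: hC.1.
exact: (@is_derive1_comp _ h (fun t : R => s (t *: delta_mx ord0 i + x))).
Qed.

Let cube_out (c a p q : R) : c * a * (c * p * (c * q)) = c ^+ 3 * (a * (p * q)).
Proof. by ring. Qed.

(** With [s] the contraction of the Hessian with [A], the operator is the cube of the
    derivative of [h] at [s] times the quadratic form of [A] at the gradient of [s]. *)
Lemma A2infty_linear x : Om x ->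
  A2infty H u x = derive1 h (s x) ^+ 3 * \sum_i \sum_j A i j * (ds x i * ds x j).
Proof.
move=> Ox; rewrite A2infty_drift mxgrad_linear; last exact: hessian_sym oO (CkW uC) Ox.
rewrite mulr_sumr; apply: eq_bigr => i _; rewrite mulr_sumr; apply: eq_bigr => j _.
rewrite (drift_linear i Ox) (drift_linear j Ox) mxE; exact: cube_out.
Qed.

Lemma posdef_eq0 (v : 'I_n -> R) : \sum_i \sum_j A i j * (v i * v j) = 0 -> forall i, v i = 0.
Proof.
move=> E i; have [v0|v0] := eqVneq (\row_i v i) 0.
  by have /rowP/(_ i) := v0; rewrite !mxE.
have := posA v0; rewrite mxE.
suff -> : \sum_j ((\row_i v i) *m A) ord0 j * (\row_i v i)^T j ord0 = \sum_i \sum_j A i j * (v i * v j).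
  by rewrite E ltxx.
rewrite [RHS]exchange_big; apply: eq_bigr => j _; rewrite !mxE mulr_suml.
by apply: eq_bigr => k _; rewrite !mxE; ring.
Qed.

Lemma trace_gt0 : 0 < mxdot A 1%:M.
Proof.
have -> : mxdot A 1%:M = \sum_i A i i.
  apply: eq_bigr => i _; rewrite (bigD1 i)//= mxE eqxx mulr1 big1 ?addr0// => j ji.
  by rewrite mxE eq_sym (negbTE ji) mulr0.
have Aii i : 0 < A i i.
  have e0 : delta_mx ord0 i != 0 :> 'rV[R]_n.
    by apply/eqP => /matrixP /(_ ord0 i)/eqP; rewrite !mxE !eqxx oner_eq0.
  have := posA e0.
  by rewrite -rowE mxE (bigD1 i)//= !mxE !eqxx mulr1 big1 ?addr0// => j ji; rewrite !mxE (negbTE ji) mulr0.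
by rewrite (bigD1 (Ordinal n_gt0))//= ltr_pwDl// sumr_ge0// => i _; exact: ltW.
Qed.

(** Multiples of the identity matrix realise every value of the contraction. *)
Lemma h_ge0 t : 0 <= h t.
Proof.
have := @H_ge0 ((t / mxdot A 1%:M) *: 1%:M); rewrite HE ?mxdotZ ?divfK ?gt_eqF ?trace_gt0//.
  apply; apply: symZ; apply/symmetricmxP => i j; by rewrite !mxE eq_sym.
by apply: symZ; apply/symmetricmxP => i j; rewrite !mxE eq_sym.
Qed.

Hypothesis cO : connected Om.
Hypothesis two_points : forall t, exists a b, [set s | h s = t] `<=` [set a; b].

(** A level set of [h] has at most two points, and the contraction is continuous on a
    connected set. *)
Lemma level_constant c : (forall x, Om x -> h (s x) = c) ->
  forall x y, Om x -> Om y -> s x = s y.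
Proof.
move=> hc; have [a [b sub]] := two_points c.
apply: (@connected_two_values R n Om (fun y => s y) a b cO continuous_s) => x Ox.
exact: sub (hc x Ox).
Qed.

Let contraction_const := exists C : R, forall x, Om x -> s x = C.
Let level_const := exists2 c : R, 0 <= c & forall x, Om x -> h (s x) = c.
Let solution := forall x, Om x -> A2infty H u x = 0.

Lemma contraction_const_level : contraction_const -> level_const.
Proof. by move=> [C hCC]; exists (h C); [exact: h_ge0|move=> x /hCC ->]. Qed.

(** A constant has zero gradient, and the gradient of [h (s x)] is the drift. *)
Lemma level_const_solution : level_const -> solution.
Proof.
move=> [c _ hc] x Ox.
have d0 i : derive1 h (s x) * ds x i = 0.
  have [_ <-] := is_derive_hs i Ox.
  have := @partial_eq _ _ Om (fun y => h (s y)) (cst c) i x oO hc Ox.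
  by rewrite /partial derive_cst.
rewrite A2infty_drift big1// => i _; rewrite big1// => j _.
by rewrite drift_linear// d0 mul0r mulr0.
Qed.

(** By positivity of [A] either the derivative of [h] at [s] or the gradient of [s]
    vanishes at each point, so that [h (s x)] has zero gradient. *)
Lemma solution_contraction_const : solution -> contraction_const.
Proof.
move=> h4.
have d0 i x : Om x -> is_derive x (delta_mx ord0 i) (fun y => h (s y)) 0.
  move=> Ox; have d := is_derive_hs i Ox; apply: is_derive_eq d _.
  have /eqP := h4 x Ox; rewrite A2infty_linear// mulf_eq0 expf_eq0/=.
  by move=> /orP[/eqP ->|/eqP /posdef_eq0 ->]; rewrite ?mul0r ?mulr0.
have lc : forall x y, Om x -> Om y -> h (s x) = h (s y) := partials0_constant oO cO d0.
have [Om0|/set0P[x0 Ox0]] := eqVneq Om set0.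
  by exists 0 => x; rewrite Om0.
exists (s x0) => x Ox.
exact: (@level_constant (h (s x0)) (fun y Oy => lc y x0 Oy Ox0) x x0 Ox Ox0).
Qed.

Lemma constant_equivalences : [<-> contraction_const; level_const; solution].
Proof.
split; first exact: contraction_const_level.
by split; [exact: level_const_solution|exact: solution_contraction_const].
Qed.
End linear_argument.

(** * A perturbation that lowers a maximum *)

Section euclidean.
Variables (R : realType) (n : nat).
Implicit Types (x y z v : 'rV[R]_n) (G : 'M[R]_n).

Definition dotr x y : R := \sum_i x ord0 i * y ord0 i.
Definition nsq x : R := dotr x x.

Lemma nsq_ge0 x : 0 <= nsq x.
Proof. by apply: sumr_ge0 => i _; rewrite -expr2 sqr_ge0. Qed.

Lemma nsq_coord x i : x ord0 i ^+ 2 <= nsq x.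
Proof.
rewrite /nsq /dotr (bigD1 i)//= -expr2 lerDl.
by apply: sumr_ge0 => j _; rewrite -expr2 sqr_ge0.
Qed.

Lemma dotrC x y : dotr x y = dotr y x.
Proof. by apply: eq_bigr => i _; rewrite mulrC. Qed.

Lemma dotrDl x y z : dotr (x + y) z = dotr x z + dotr y z.
Proof. by rewrite -big_split; apply: eq_bigr => i _; rewrite mxE mulrDl. Qed.

Lemma dotrZl (a : R) x y : dotr (a *: x) y = a * dotr x y.
Proof. by rewrite mulr_sumr; apply: eq_bigr => i _; rewrite mxE mulrA. Qed.

Lemma dotrZr (a : R) x y : dotr x (a *: y) = a * dotr x y.
Proof. by rewrite dotrC dotrZl dotrC. Qed.

Lemma nsqZ (a : R) x : nsq (a *: x) = a ^+ 2 * nsq x.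
Proof. by rewrite /nsq dotrZl dotrC dotrZl mulrA expr2. Qed.

Lemma nsqB x y : nsq (x - y) = nsq x + nsq y - 2 * dotr x y.
Proof.
rewrite /nsq /dotr mulr_sumr -big_split -sumrB; apply: eq_bigr => i _ /=.
by rewrite !mxE; ring.
Qed.

Lemma norm_nsq_le x (r : R) : nsq x <= r -> `|x| <= r + 1.
Proof.
move=> xr; have r0 : 0 <= r := le_trans (nsq_ge0 x) xr.
rewrite [leLHS]/Num.norm /= mx_normrE; apply/bigmax_leP; split => [|[k i] _ /=].
  by rewrite addr_ge0.
rewrite (ord1 k); have := le_trans (nsq_coord x i) xr => h.
rewrite -(@ler_pXn2r _ 2) ?nnegrE ?addr_ge0// real_normK ?num_real//.
by rewrite (le_trans h)//; nra.
Qed.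

Lemma norm_nsq_lt x (r : R) : 0 < r -> nsq x < r ^+ 2 -> `|x| < r.
Proof.
move=> r0 xr; apply/normr_row_ltP => // i.
have := le_lt_trans (nsq_coord x i) xr.
by rewrite -(real_normK (num_real _)) ltr_pXn2r ?nnegrE// ltW.
Qed.

Lemma continuous_bigsum (I : Type) (r : seq I) (F : I -> 'rV[R]_n -> R) :
  (forall i, continuous (F i)) -> continuous (fun x => \sum_(i <- r) F i x).
Proof.
move=> cF x; elim: r => [|i r ih].
  by under eq_fun do rewrite big_nil; exact: cst_continuous.
by under eq_fun do rewrite big_cons; apply: continuousD => //; exact: cF.
Qed.

Lemma continuous_cmul (c : R) (f : 'rV[R]_n -> R) :
  continuous f -> continuous (fun x => c * f x).
Proof. by move=> cf x; apply: continuousM; [exact: cst_continuous|exact: cf]. Qed.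

Lemma dotr_continuous v : continuous (dotr v).
Proof.
apply: continuous_bigsum => i x; apply: continuousM; first exact: cst_continuous.
exact: coord_continuous.
Qed.

Lemma nsq_continuous : continuous nsq.
Proof. by apply: continuous_bigsum => i x; apply: continuousM; exact: coord_continuous. Qed.

(** The Hessian of [(r2 - |z|^2)^2]. *)
Definition bumpD2 (r2 : R) z : 'M[R]_n :=
  \matrix_(i, j) (8 * (z ord0 i * z ord0 j) - 4 * (r2 - nsq z) * (i == j)%:R).

Lemma bumpD2_sym r2 z : bumpD2 r2 z \is symmetricmx.
Proof. by apply/symmetricmxP => i j; rewrite !mxE mulrC eq_sym mulrC; ring. Qed.

Lemma bumpD2_continuous r2 i j : continuous (fun z => bumpD2 r2 z i j).
Proof.
have -> : (fun z => bumpD2 r2 z i j) =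
    (fun z => 8 * (z ord0 i * z ord0 j) + (-4 * (i == j)%:R) * (r2 + -1 * nsq z)).
  by apply/funext => z; rewrite mxE; ring.
have c1 : continuous (fun z : 'rV[R]_n => 8 * (z ord0 i * z ord0 j)).
  apply: (@continuous_cmul 8) => z; exact: (continuousM (@coord_continuous R 1 n ord0 i z) (@coord_continuous R 1 n ord0 j z)).
have c2 : continuous (fun z : 'rV[R]_n => (-4 * (i == j)%:R) * (r2 + -1 * nsq z)).
  apply: continuous_cmul => z.
  exact: (continuousD (@cst_continuous _ _ r2 z) (@continuous_cmul (-1) _ nsq_continuous z)).
by move=> z; exact: (continuousD (c1 z) (c2 z)).
Qed.

Lemma mxdot_bumpD2_continuous G r2 : continuous (fun z => mxdot G (bumpD2 r2 z)).
Proof.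
apply: continuous_bigsum => i; apply: continuous_bigsum => j z.
by apply: continuousM; [exact: cst_continuous|exact: bumpD2_continuous].
Qed.

Lemma nsq_le_compact (r : R) : compact [set z : 'rV[R]_n | nsq z <= r].
Proof.
apply: bounded_closed_compact.
  exists (r + 1); split; first exact: num_real.
  by move=> M rM z /= /norm_nsq_le zr; exact: le_trans zr (ltW rM).
rewrite (_ : [set _ | _] = nsq @^-1` [set t | t <= r])//.
apply: closed_comp; last exact: closed_le.
by move=> z _; exact: nsq_continuous.
Qed.

(** On the ball [|z|^2 <= |v|^2] the linear form [dotr v] is maximal only at
    [v]; a perturbation of the right sign at [v] lowers the maximum. *)
Lemma perturbed_maximum v (P : 'rV[R]_n -> R) : continuous P -> P v != 0 -> 0 < nsq v ->
  exists e d : R, 0 < d /\ forall z, nsq z <= nsq v -> dotr v z + e * P z <= nsq v - d.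
Proof.
move=> cP Pv0 v0.
wlog Pv : P cP Pv0 / 0 < P v.
  move=> wl; have [Pv|Pv|Pv] := ltgtP 0 (P v); first exact: wl.
    have [|||e [d [d0 h]]] := wl (fun z => - P z).
    - by move=> z; apply: continuousN; exact: cP.
    - by rewrite oppr_eq0.
    - by rewrite oppr_gt0.
    by exists (- e), d; split => // z zv; have := h z zv; rewrite mulrN mulNr.
  by rewrite -Pv eqxx in Pv0.
have P2 : 0 < P v / 2 by rewrite divr_gt0.
have [g g0 hg] := continuous_delta (cP v) P2.
have [K K0 hK] := compact_continuous_bounded (@nsq_le_compact (nsq v)) (fun x _ => cP x).
(* where the linear form is within [c] of its maximum, [z] is at distance less
   than [g] from [v] *)
pose c := g ^+ 2 / 2.
have c0 : 0 < c by rewrite divr_gt0// exprn_gt0.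
pose e := c / (2 * (K + 1)).
have K1 : 0 < K + 1 by rewrite ltr_wpDl.
have e0 : 0 < e by rewrite divr_gt0// mulr_gt0.
have eK : e * K <= c / 2.
  have -> : c / 2 = e * (K + 1) by rewrite /e; field; rewrite gt_eqF.
  by rewrite ler_pM2l// lerDl.
exists (- e), (Num.min (e * (P v / 2)) (c / 2)); split.
  by rewrite lt_min mulr_gt0//= divr_gt0.
move=> z zv; have := nsqB z v; rewrite (dotrC z) => E.
have vz : dotr v z <= nsq v by have := nsq_ge0 (z - v); lra.
have [far|near] := leP (dotr v z) (nsq v - c).
  have /ler_normlP[Kz _] := hK z zv.
  have : - e * P z <= e * K by rewrite mulNr -mulrN ler_pM2l.
  have : Num.min (e * (P v / 2)) (c / 2) <= c / 2 by rewrite ge_min lexx orbT.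
  by lra.
have zg : `|z - v| < g.
  apply: norm_nsq_lt => //; rewrite E.
  have c2 : c * 2 = g ^+ 2 by rewrite /c divfK ?pnatr_eq0.
  lra.
have := hg (z - v) zg; rewrite subrK => /ltr_normlP[Pz _].
have : e * (P v / 2) <= e * P z by rewrite ler_pM2l//; lra.
have : Num.min (e * (P v / 2)) (c / 2) <= e * (P v / 2) by rewrite ge_min lexx.
by rewrite mulNr; lra.
Qed.
End euclidean.

(** * First order expansion of the energy density *)

Section expansion.
Variables (R : realType) (n : nat).
Variables (H : 'M[R]_n -> R) (Om : set 'rV[R]_n) (u : 'rV[R]_n -> R).
Hypotheses (HC : C1_sym H) (oO : open Om) (uC : Ck 3 Om u).
Implicit Types (G M : 'M[R]_n) (y z : 'rV[R]_n).

Lemma mx_norm_leP M (c : R) : 0 <= c -> (forall i j, `|M i j| <= c) -> `|M| <= c.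
Proof.
move=> c0 h; rewrite [leLHS]/Num.norm /= mx_normrE; apply/bigmax_leP.
by split => // -[i j] _ /=.
Qed.

Lemma mxdot_bound G M (c : R) : (forall i j, `|M i j| <= c) ->
  `|mxdot G M| <= (\sum_i \sum_j `|G i j|) * c.
Proof.
move=> h; rewrite mulr_suml; apply: le_trans (ler_norm_sum _ _ _) _; apply: ler_sum => i _.
rewrite mulr_suml; apply: le_trans (ler_norm_sum _ _ _) _; apply: ler_sum => j _.
by rewrite normrM ler_wpM2l.
Qed.

(** The linear part of the Hessian of [u] around [x0]. *)
Definition hess_lin x0 y : 'M[R]_n := \matrix_(k, l) \sum_i third u x0 i k l * y ord0 i.

Definition driftv x0 : 'rV[R]_n := \row_i drift H u x0 i.

Let contract (G : 'I_n -> 'I_n -> R) (T : 'I_n -> 'I_n -> 'I_n -> R) (y : 'I_n -> R) :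
  \sum_k \sum_l G k l * (\sum_i T i k l * y i) =
  \sum_i (\sum_k \sum_l G k l * T i k l) * y i.
Proof.
transitivity (\sum_k \sum_l \sum_i G k l * T i k l * y i).
  by apply: eq_bigr => k _; apply: eq_bigr => l _; rewrite mulr_sumr; apply: eq_bigr => i _; rewrite mulrA.
under eq_bigr do rewrite exchange_big /=.
rewrite exchange_big /=; apply: eq_bigr => i _.
by rewrite mulr_suml; apply: eq_bigr => k _; rewrite mulr_suml.
Qed.

Lemma mxdot_hess_lin x0 y :
  mxdot (mxgrad H (hessian u x0)) (hess_lin x0 y) = dotr (driftv x0) y.
Proof.
have hE k l : hess_lin x0 y k l = \sum_i third u x0 i k l * y ord0 i by rewrite mxE.
have dE i : driftv x0 ord0 i = drift H u x0 i by rewrite mxE.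
rewrite /mxdot /dotr.
under eq_bigr do under eq_bigr do rewrite hE.
under [RHS]eq_bigr do rewrite dE.
exact: (contract (mxgrad H (hessian u x0)) (third u x0) (y ord0)).
Qed.

Lemma third_continuous x0 i k l : Om x0 -> {for x0, continuous (fun z => third u z i k l)}.
Proof.
move=> Ox; exact: (Ck_cont (Ck_partial l (Ck_partial k (Ck_partial i uC))) Ox).
Qed.

Let sub3E (M1 M2 M3 : 'M[R]_n) k l : (M1 - M2 - M3) k l = M1 k l - M2 k l - M3 k l.
Proof. by rewrite !mxE. Qed.

Let residualE x0 y k l : (hessian u (y + x0) - hessian u x0 - hess_lin x0 y) k l =
  hessian u (y + x0) k l - hessian u x0 k l - \sum_i third u x0 i k l * y ord0 i.
Proof. by rewrite sub3E; congr (_ - _); rewrite mxE. Qed.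

Lemma hessian_expansion x0 (eta : R) : Om x0 -> 0 < eta ->
  exists2 r : R, 0 < r & forall y, `|y| < r -> Om (y + x0) /\
    forall k l, `|(hessian u (y + x0) - hessian u x0 - hess_lin x0 y) k l| <= eta * `|y|.
Proof.
move=> Ox eta0; have [r r0 hr] := open_ball_sub oO Ox.
have /choice[rr hrr] : forall kl : 'I_n * 'I_n, exists rkl : R, 0 < rkl /\
    forall y, `|y| < rkl ->
    `|(hessian u (y + x0) - hessian u x0 - hess_lin x0 y) kl.1 kl.2| <= eta * `|y|.
  move=> [k l] /=.
  have [rkl r0' h] := @taylor1 R n Om (fun z => hessian u z k l) (fun i z => third u z i k l)
     x0 eta oO Ox (fun i y Oy => @is_derive_hessian R n Om u oO uC y i k l Oy)
     (fun i => @third_continuous x0 i k l Ox) eta0.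
  by exists rkl; split => // y /h; rewrite residualE.
exists (\big[Num.min/r]_kl rr kl).
  by apply: lt_bigmin => // kl _; have [] := hrr kl.
move=> y ym; split.
  by apply: hr; apply: lt_le_trans ym _; exact: bigmin_le_id.
move=> k l; have [_ h] := hrr (k, l); apply: h.
by apply: lt_le_trans ym _; exact: bigmin_le.
Qed.

Let regroup (M1 M2 M3 M4 : 'M[R]_n) : M1 + M4 = M3 + (M1 - M2 - M3 + M4) + M2.
Proof. by apply/matrixP => k l; rewrite !mxE; ring. Qed.

Let le_sum_term (F : 'I_n -> 'I_n -> R) k l : (forall k l, 0 <= F k l) ->
  F k l <= \sum_k \sum_l F k l.
Proof.
move=> F0; rewrite (bigD1 k)//= (bigD1 l)//= -addrA lerDl addr_ge0//; first exact: sumr_ge0.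
by apply: sumr_ge0 => ? _; exact: sumr_ge0.
Qed.

Lemma hess_lin_bound x0 y k l :
  `|hess_lin x0 y k l| <= (\sum_k \sum_l \sum_i `|third u x0 i k l|) * `|y|.
Proof.
rewrite mxE; apply: le_trans (ler_norm_sum _ _ _) _.
apply: (@le_trans _ _ ((\sum_i `|third u x0 i k l|) * `|y|)).
  rewrite mulr_suml; apply: ler_sum => i _.
  by rewrite normrM ler_wpM2l// normr_row_coord.
rewrite ler_wpM2r//.
by apply: (@le_sum_term (fun k l => \sum_i `|third u x0 i k l|)) => k' l'; exact: sumr_ge0.
Qed.

(** At distance [rho] from [x0] the Hessian of [u] changes by [rho] times a linear
    function, and a perturbation [rho *: B z] adds to it at the same order: both
    enter the expansion of [H] through its gradient at the Hessian of [u] at [x0].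
    The error is uniform for [z] in a bounded set. *)
Lemma perturbed_expansion x0 (B : 'rV[R]_n -> 'M[R]_n) (K Rad tau : R) :
  Om x0 -> 0 <= K -> 0 <= Rad -> 0 < tau ->
  (forall z, B z \is symmetricmx) ->
  (forall z, `|z| <= Rad -> `|B z| <= K) ->
  exists2 rho0 : R, 0 < rho0 & forall rho z, 0 < rho < rho0 -> `|z| <= Rad ->
    Om (rho *: z + x0) /\
    `|H (hessian u (rho *: z + x0) + rho *: B z) - H (hessian u x0)
      - rho * (dotr (driftv x0) z + mxdot (mxgrad H (hessian u x0)) (B z))| <= rho * tau.
Proof.
move=> Ox K0 Rad0 tau0 sB BK.
set X0 := hessian u x0; set G := mxgrad H X0.
pose T := \sum_k \sum_l \sum_i `|third u x0 i k l|.
pose g := \sum_i \sum_j `|G i j|.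
have T0 : 0 <= T by apply: sumr_ge0 => ? _; apply: sumr_ge0 => ? _; apply: sumr_ge0.
have g0 : 0 <= g by apply: sumr_ge0 => ? _; apply: sumr_ge0.
pose L := T * Rad + Rad + K + 1.
have L0 : 0 < L by rewrite /L ltr_wpDl// !addr_ge0// mulr_ge0.
have gR : 0 < 2 * (g * Rad + 1) by rewrite mulr_gt0// ltr_wpDl// mulr_ge0.
pose eta := Num.min 1 (tau / (2 * (g * Rad + 1))).
have eta0 : 0 < eta by rewrite lt_min ltr01 divr_gt0.
have eta1 : eta <= 1 by rewrite ge_min lexx.
have eta2 : g * (eta * Rad) <= tau / 2.
  have : eta * (2 * (g * Rad + 1)) <= tau by rewrite -ler_pdivlMr// ge_min lexx orbT.
  have : eta * (2 * (g * Rad + 1)) = 2 * (g * (eta * Rad)) + 2 * eta by ring.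
  by move=> ->; have := ltW eta0; lra.
have [r r0 hr] := hessian_expansion Ox eta0.
have tL : 0 < tau / (2 * L) by rewrite divr_gt0// mulr_gt0.
have sX0 : X0 \is symmetricmx := hessian_sym oO (CkW uC) Ox.
have [rH rH0 hH] := taylor_sym HC sX0 tL.
exists (Num.min (r / (Rad + 1)) (rH / L)).
  by rewrite lt_min !divr_gt0// ltr_wpDl.
move=> rho z /andP[rho0]; rewrite lt_min => /andP[rho1 rho2] zR.
set y := rho *: z.
have yR : `|y| <= rho * Rad by rewrite normrZ gtr0_norm// ler_pM2l.
have yr : `|y| < r.
  apply: le_lt_trans yR _; apply: (@le_lt_trans _ _ (rho * (Rad + 1))).
    by rewrite ler_pM2l// lerDl.
  by rewrite -ltr_pdivlMr// ltr_wpDl.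
have [Oy hE] := hr y yr; split => //.
pose E := hessian u (y + x0) - X0 - hess_lin x0 y.
have EB k l : `|E k l| <= rho * (eta * Rad).
  apply: le_trans (hE k l) _; rewrite mulrCA ler_pM2l//.
pose Y := hess_lin x0 y + (E + rho *: B z).
have YE : hessian u (y + x0) + rho *: B z = Y + X0.
  exact: regroup.
have sY : Y \is symmetricmx.
  have -> : Y = hessian u (y + x0) + rho *: B z + (-1) *: X0 by rewrite YE scaleN1r addrK.
  apply: symD; last exact: symZ.
  by apply: symD; [exact: hessian_sym oO (CkW uC) Oy|exact: symZ].
have YL : `|Y| <= rho * L.
  apply: le_trans (ler_normD _ _) _.
  have b1 : `|hess_lin x0 y| <= rho * (T * Rad).
    apply: mx_norm_leP => [|k l]; first by apply: mulr_ge0; [exact: ltW|exact: mulr_ge0].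
    by apply: le_trans (hess_lin_bound _ _ _ _) _; rewrite mulrCA ler_wpM2l.
  have b2 : `|E| <= rho * Rad.
    apply: mx_norm_leP => [|k l]; first by apply: mulr_ge0 => //; exact: ltW.
    by apply: le_trans (EB k l) _; rewrite ler_pM2l// ler_piMl.
  have b3 : `|rho *: B z| <= rho * K by rewrite normrZ gtr0_norm// ler_pM2l// BK.
  have -> : rho * L = rho * (T * Rad) + (rho * Rad + rho * K) + rho by rewrite /L; ring.
  have := ler_normD E (rho *: B z).
  by move: b1 b2 b3 rho0; lra.
have YrH : `|Y| < rH.
  by apply: le_lt_trans YL _; rewrite -ltr_pdivlMr.
have h1 := hH Y sY YrH.
rewrite YE.
have mG : mxdot G Y = dotr (driftv x0) y + (mxdot G E + rho * mxdot G (B z)).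
  by rewrite /Y !mxdotD mxdotZ mxdot_hess_lin.
have dy : dotr (driftv x0) y = rho * dotr (driftv x0) z by rewrite /y dotrC dotrZl dotrC.
have GE : `|mxdot G E| <= rho * (tau / 2).
  apply: le_trans (mxdot_bound _ EB) _; rewrite -/g mulrCA ler_pM2l//.
have h2 : tau / (2 * L) * `|Y| <= rho * (tau / 2).
  have -> : rho * (tau / 2) = tau / (2 * L) * (rho * L).
    by field; rewrite gt_eqF.
  by rewrite ler_pM2l.
have h3 := le_trans h1 h2.
move: h3 GE; rewrite mG dy.
move: (H (Y + X0)) (H X0) (dotr (driftv x0) z) (mxdot G E) (mxdot G (B z)) => a b c d f.
have -> : a - b - rho * (c + f) = (a - b - (rho * c + (d + rho * f))) + d by ring.
move=> h3 GE; apply: le_trans (ler_normD _ _) _.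
by rewrite [tau]splitr mulrDr lerD.
Qed.
End expansion.

(** * Absolute minimisers solve the equation *)

Section quartic.
Variables (R : realType) (n : nat) (x0 : 'rV[R]_n) (c s : R).

Let q (x : 'rV[R]_n) : R := c - nsq (x - x0).
(** A multiple of the square of the defining function [c - nsq (x - x0)] of a ball: it
    vanishes on the boundary of the ball together with its gradient. *)
Definition quartic (x : 'rV[R]_n) : R := s * (q x * q x).

Lemma Sk_id k : Sk k (@id R).
Proof.
case: k => [|k]; first by move=> t; exact: cvg_id.
by exists (fun=> 1); [move=> t; exact: is_derive_id|exact: Sk_cst].
Qed.

Let qC k : Ck k setT q.
Proof.
apply: (@CkD _ _ _ openT k (fun=> c) (fun x => - nsq (x - x0))); first exact: Ck_cst openT _ _.
apply: CkN; first exact: openT.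
apply: Ck_sum => [|i _]; first exact: openT.
have h : Ck k setT (fun x : 'rV[R]_n => (x - x0) ord0 i).
  have := @Ck_coord R n k _ i (Sk_shift (- x0 ord0 i) (Sk_id k)).
  by congr Ck; apply/funext => x; rewrite !mxE.
by apply: CkM => //; exact: openT.
Qed.

Lemma quartic_Ck k : Ck k setT quartic.
Proof.
by apply: CkM; [exact: openT|apply: Ck_cst; exact: openT|apply: CkM => //; exact: openT].
Qed.

Let dotr_delta (y : 'rV[R]_n) i : dotr y (delta_mx ord0 i) = y ord0 i.
Proof.
rewrite /dotr (bigD1 i)//= [delta_mx _ _ _ _]mxE !eqxx mulr1 big1 ?addr0// => k ki.
by rewrite [delta_mx _ _ _ _]mxE (negbTE ki) andbF mulr0.
Qed.

Let q_line i x (t : R) :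
  q (t *: delta_mx ord0 i + x) = q x + t * (- (2 * (x - x0) ord0 i) - t).
Proof.
rewrite /q.
have -> : t *: delta_mx ord0 i + x - x0 = (x - x0) - (- t) *: delta_mx ord0 i.
  by rewrite scaleNr opprK -addrA addrC.
move: (x - x0) => y.
rewrite nsqB nsqZ dotrZr {2}/nsq !dotr_delta [delta_mx _ _ _ _]mxE !eqxx /=.
ring.
Qed.

Let q_derive i x : is_derive x (delta_mx ord0 i) q (- (2 * (x - x0) ord0 i)).
Proof.
set b := (x - x0) ord0 i.
apply: is_derive_coord_line.
have -> : (fun t : R => q (t *: delta_mx ord0 i + x)) = (fun t => q x + t * (- (2 * b) - t)).
  by apply/funext => t; exact: q_line.
have d2 : is_derive (0 : R) 1 (fun t => - (2 * b) - t) (- 1).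
  by have := is_deriveB (is_derive_cst (- (2 * b)) (0 : R) 1) (is_derive_id (0 : R) 1); rewrite sub0r.
have := is_deriveD (is_derive_cst (q x) (0 : R) 1) (is_deriveM (is_derive_id (0 : R) 1) d2).
by rewrite add0r scale0r add0r subr0 [_ *: 1]mulr1.
Qed.

Let y_derive i j x : is_derive x (delta_mx ord0 j) (fun x : 'rV[R]_n => (x - x0) ord0 i) ((i == j)%:R).
Proof.
apply: is_derive_coord_line.
have -> : (fun t : R => (t *: delta_mx ord0 j + x - x0) ord0 i) = (fun t => (x - x0) ord0 i + t * (i == j)%:R).
  by apply/funext => t; rewrite !mxE eqxx /=; ring.
have := is_deriveD (is_derive_cst ((x - x0) ord0 i) (0 : R) 1)
  (is_deriveM (is_derive_id (0 : R) 1) (is_derive_cst ((i == j)%:R : R) (0 : R) 1)).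
by rewrite scaler0 !add0r [_ *: 1]mulr1.
Qed.

Lemma partial_quartic i x : partial i quartic x = - 4 * s * (q x * (x - x0) ord0 i).
Proof.
have [_ E] := is_deriveM (is_derive_cst s x (delta_mx ord0 i)) (is_deriveM (q_derive i x) (q_derive i x)).
rewrite /partial (E : 'D_(delta_mx ord0 i) quartic x = _) /GRing.scale/=.
ring.
Qed.

Lemma hessian_quartic x : hessian quartic x = s *: bumpD2 c (x - x0).
Proof.
apply/matrixP => i j; rewrite [LHS]mxE.
have -> : partial i quartic = (fun x => - 4 * s * (q x * (x - x0) ord0 i)).
  by apply/funext => y; exact: partial_quartic.
have [_ E] := is_deriveM (is_derive_cst (- 4 * s) x (delta_mx ord0 j)) (is_deriveM (q_derive j x) (y_derive i j x)).
rewrite /partial (E : 'D_(delta_mx ord0 j) (fun x => - 4 * s * (q x * (x - x0) ord0 i)) x = _) /GRing.scale/=.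
rewrite [RHS]mxE [X in _ = s * X]mxE /q.
move: ((x - x0) ord0 i) ((x - x0) ord0 j) (nsq (x - x0)) => a b d; ring.
Qed.

Lemma quartic_boundary x : nsq (x - x0) = c -> quartic x = 0.
Proof. by move=> E; rewrite /quartic /q E subrr !mul0r mulr0. Qed.

Lemma partial_quartic_boundary i x : nsq (x - x0) = c -> partial i quartic x = 0.
Proof. by move=> E; rewrite partial_quartic /q E subrr mul0r mulr0. Qed.

Lemma nsq_sub_continuous : continuous (fun x : 'rV[R]_n => nsq (x - x0)).
Proof.
have -> : (fun x : 'rV[R]_n => nsq (x - x0)) = (fun x => nsq x + (nsq x0 + -2 * dotr x0 x)).
  by apply/funext => x; rewrite nsqB dotrC; ring.
have c2 : continuous (fun x => nsq x0 + -2 * dotr x0 x).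
  move=> x; apply: (@continuousD _ _ _ (fun=> nsq x0) (fun x => -2 * dotr x0 x)); first exact: cst_continuous.
  exact: (@continuous_cmul R n (-2) _ (@dotr_continuous R n x0) x).
by move=> x; apply: (@continuousD _ _ _ (@nsq R n)); [exact: nsq_continuous|exact: c2].
Qed.

Definition eball : set 'rV[R]_n := [set x | nsq (x - x0) < c].

Lemma eball_open : open eball.
Proof.
rewrite (_ : eball = (fun x => nsq (x - x0)) @^-1` [set t | t < c])//.
by apply: open_comp; [move=> x _; exact: nsq_sub_continuous|exact: open_lt].
Qed.

Lemma closure_eball : closure eball `<=` [set x | nsq (x - x0) <= c].
Proof.
have cl : closed [set x | nsq (x - x0) <= c].
  rewrite (_ : [set _ | _] = (fun x => nsq (x - x0)) @^-1` [set t | t <= c])//.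
  by apply: closed_comp; [move=> x _; exact: nsq_sub_continuous|exact: closed_le].
rewrite [X in _ `<=` X](closure_id _).1//; apply: closureS => x; exact: ltW.
Qed.

Lemma compact_closure_eball : compact (closure eball).
Proof.
apply: bounded_closed_compact; last exact: closed_closure.
exists (c + 1 + `|x0|); split; first exact: num_real.
move=> M cM x /closure_eball /= /norm_nsq_le xc.
apply: le_trans (ltW cM); rewrite -[x in `|x|](subrK x0).
by apply: le_trans (ler_normD _ _) _; rewrite lerD2r.
Qed.

Lemma boundary_eball x : (closure eball `\` eball^°) x -> nsq (x - x0) = c.
Proof.
rewrite (interior_id _).1; last exact: eball_open.
move=> [/closure_eball /= xc /negP]; rewrite -leNgt => cx.
by apply/eqP; rewrite eq_le xc.
Qed.

Lemma quartic_jet : weak_jet eball quartic (grad quartic) (hessian quartic).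
Proof.
apply: (@Ck_weak_jet R n eball setT quartic eball_open openT _ (quartic_Ck 2)).
by split; [exact: compact_closure_eball|exact: subsetT].
Qed.

Lemma quartic_W2infty0 : W2infty0 eball quartic.
Proof.
split; first by exists (grad quartic), (hessian quartic); exact: quartic_jet.
  exists quartic; split.
  - by apply: continuous_subspaceT => x; exact: (Ck_cont (quartic_Ck 0)).
  - exact: nearW.
  - by move=> x /boundary_eball; exact: quartic_boundary.
move=> i; exists (partial i quartic); split.
- by apply: continuous_subspaceT => x; exact: (Ck_cont (Ck_partial i (quartic_Ck 1))).
- by apply: filterS (weak_gradient_ae eball_open quartic_jet) => x h Ox; rewrite h// mxE.
- by move=> x /boundary_eball; exact: partial_quartic_boundary.
Qed.
End quartic.

Section energy.
Variables (R : realType) (n : nat) (H : 'M[R]_n -> R).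
Local Notation mu := (leb R n).

(** An upper bound of the energy can be checked on any weak jet. *)
Lemma Einfty_leP O u p X (y : \bar R) : open O -> weak_jet O u p X -> (0 <= y)%E ->
  (Einfty H O u O <= y)%E <-> {ae mu, forall x, O x -> (`|H (X x)|%:E <= y)%E}.
Proof.
move=> oO uX y0; have wX := weak_hessian_ae oO uX; rewrite /Einfty Linfty_norm_leP//.
split=> h; apply: filterS2 wX h => x E h Ox.
  by have := h Ox; rewrite /= E.
by rewrite /= E// h.
Qed.
End energy.

Section necessity.
Variables (R : realType) (n : nat).

Lemma dotr_bound (x y : 'rV[R]_n) (c : R) : `|x| <= c -> `|y| <= c ->
  `|dotr x y| <= n%:R * c ^+ 2.
Proof.
move=> xc yc; apply: le_trans (ler_norm_sum _ _ _) _.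
rewrite mulr_natl -[n in c ^+ 2 *+ n]card_ord -sumr_const; apply: ler_sum => i _.
by rewrite normrM expr2 ler_pM// (le_trans (normr_row_coord _ _)).
Qed.

Lemma bumpD2_bound (r2 c : R) : 0 <= r2 -> 0 <= c ->
  exists2 K : R, 0 <= K & forall z : 'rV[R]_n, `|z| <= c -> `|bumpD2 r2 z| <= K.
Proof.
move=> r0 c0; pose K := 8 * (c * c) + 4 * (r2 + n%:R * c ^+ 2).
have K0 : 0 <= K by rewrite addr_ge0// mulr_ge0// ?addr_ge0// ?mulr_ge0// exprn_ge0.
exists K => // z zc; apply: mx_norm_leP => // i j; rewrite mxE.
apply: le_trans (ler_normB _ _) _; apply: lerD.
  rewrite normrM ger0_norm// ler_pM2l// normrM.
  by apply: ler_pM => //; apply: le_trans zc; exact: normr_row_coord.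
apply: (@le_trans _ _ (`|4 * (r2 - nsq z)|)).
  by rewrite normrM; case: (i == j); rewrite ?normr1 ?normr0 ?mulr1 ?mulr0.
rewrite normrM ger0_norm// ler_pM2l//; apply: le_trans (ler_normB _ _) _.
by rewrite ger0_norm// lerD2l; exact: dotr_bound.
Qed.

Lemma mxdot_bumpD2_self (G : 'M[R]_n) (v : 'rV[R]_n) :
  mxdot G (bumpD2 (nsq v) v) = 8 * \sum_i \sum_j G i j * (v ord0 i * v ord0 j).
Proof.
rewrite mulr_sumr; apply: eq_bigr => i _; rewrite mulr_sumr; apply: eq_bigr => j _.
by rewrite mxE subrr; ring.
Qed.

Lemma bumpD2_scale (r2 rho : R) (z : 'rV[R]_n) :
  bumpD2 (rho ^+ 2 * r2) (rho *: z) = rho ^+ 2 *: bumpD2 r2 z.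
Proof.
apply/matrixP => i j; rewrite !mxE nsqZ.
by move: (nsq z) (z ord0 i) (z ord0 j) ((i == j)%:R : R) => a b c d; ring.
Qed.

Let upper_real (h H0 g p rho r2 d e : R) : 0 < rho ->
  `|h - H0 - rho * (g + e * p)| <= rho * (d / 4) -> g + e * p <= r2 - d ->
  h <= H0 + rho * (r2 - d + d / 4).
Proof.
move=> rho0 /ler_normlP[_ h1] h2.
have : rho * (g + e * p) <= rho * (r2 - d) by rewrite ler_pM2l.
lra.
Qed.

Let fraction_real (d r2 : R) : 0 < d -> 0 < r2 -> d * r2 < d / 4 * (d + 8 * r2).
Proof.
move=> d0 r0; have h1 := mulr_gt0 d0 r0; have h2 := mulr_gt0 d0 d0.
have -> : d / 4 * (d + 8 * r2) = d * d / 4 + 2 * (d * r2) by field.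
lra.
Qed.

Let lower_real (h H0 g g' rho r2 d : R) : 0 < rho -> 0 < d -> g' = rho * g ->
  `|h - H0 - rho * (g + 0)| <= rho * (d / 4) -> rho * (r2 - d / 4) < g' ->
  h <= H0 + rho * (r2 - d + d / 4) -> False.
Proof.
move=> rho0 d0 -> /ler_normlP[h1 _] h2 h3.
have : rho * d > 0 by rewrite mulr_gt0.
lra.
Qed.

Variables (H : 'M[R]_n -> R) (Om : set 'rV[R]_n) (u : 'rV[R]_n -> R).
Hypotheses (HC : C1_sym H) (oO : open Om) (uC : Ck 3 Om u).
Hypothesis H_ge0 : forall X, X \is symmetricmx -> 0 <= H X.

Lemma A2infty_driftv x : A2infty H u x =
  \sum_i \sum_j mxgrad H (hessian u x) i j * (driftv H u x ord0 i * driftv H u x ord0 j).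
Proof.
have dE i : driftv H u x ord0 i = drift H u x i by rewrite mxE.
apply: etrans (A2infty_drift H u x) _.
by apply: eq_bigr => i _; apply: eq_bigr => j _; rewrite (dE i) (dE j).
Qed.

(** If the operator does not vanish at [x0], the drift [v] does not either. In the
    rescaled variable [z], to first order in [rho], the energy density is [H] at the
    Hessian of [u] at [x0] plus [rho * dotr v z], and its supremum over the ball
    [nsq z < nsq v] is approached at [z = v] only. The Hessian of the quartic changes
    the value there by a nonzero multiple of the operator, and [perturbed_maximum]
    makes the supremum strictly smaller. *)
Lemma AM2_A2infty : AM2 H Om u -> forall x, Om x -> A2infty H u x = 0.
Proof.
move=> [_ minu] x0 Ox0; apply/eqP; apply: contrapT => /negP Q0.
set X0 := hessian u x0; set G := mxgrad H X0; set v := driftv H u x0.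
pose r2 := nsq v.
pose P z := mxdot G (bumpD2 r2 z).
have Pv : P v = 8 * A2infty H u x0.
  by apply: etrans (mxdot_bumpD2_self G v) _; congr (8 * _); exact/esym/A2infty_driftv.
have v0 : 0 < r2.
  rewrite lt_neqAle nsq_ge0 andbT; apply: contra Q0 => /eqP r20.
  have vi i : v ord0 i = 0.
    by apply/eqP; rewrite -[_ == 0](expf_eq0 _ 2) eq_le sqr_ge0 andbT r20; exact: nsq_coord.
  apply/eqP; apply: etrans (A2infty_driftv x0) _.
  by apply: big1 => i _; apply: big1 => j _; rewrite -/v (vi i) mul0r mulr0.
have Pv0 : P v != 0 by rewrite Pv mulf_neq0// pnatr_eq0.
have [e [d [d0 hd]]] := perturbed_maximum (@mxdot_bumpD2_continuous R n G r2) Pv0 v0.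
pose Rad := r2 + 1.
have Rad0 : 0 <= Rad by rewrite addr_ge0// ltW.
have d4 : 0 < d / 4 by rewrite divr_gt0.
have [K0' K0'0 hK0] := bumpD2_bound (ltW v0) Rad0.
pose K := `|e| * K0'.
have K0 : 0 <= K by rewrite mulr_ge0.
have hK (z : 'rV[R]_n) : `|z| <= Rad -> `|e *: bumpD2 r2 z| <= K.
  by move=> zR'; rewrite normrZ; exact: (ler_wpM2l (normr_ge0 e) (hK0 z zR')).
have sym0 (z : 'rV[R]_n) : (0 : 'M[R]_n) \is symmetricmx by apply/symmetricmxP => i j; rewrite !mxE.
have bd0 (z : 'rV[R]_n) : `|z| <= Rad -> `|0 : 'M[R]_n| <= 0 by rewrite normr0.
have symb (z : 'rV[R]_n) : e *: bumpD2 r2 z \is symmetricmx by apply: symZ; exact: bumpD2_sym.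
have [rho1 rho10 h1] := @perturbed_expansion R n H Om u HC oO uC x0 (fun=> 0) 0 Rad (d / 4) Ox0 (lexx _) Rad0 d4 sym0 bd0.
have [rho2 rho20 h2] := @perturbed_expansion R n H Om u HC oO uC x0 (fun z => e *: bumpD2 r2 z) K Rad (d / 4) Ox0 K0 Rad0 d4 symb hK.
pose rho := Num.min rho1 rho2 / 2.
have m0 : 0 < Num.min rho1 rho2 by rewrite lt_min rho10.
have rho0 : 0 < rho by rewrite divr_gt0.
have rhom : rho < Num.min rho1 rho2 by rewrite /rho ltr_pdivrMr// ltr_pMr// ltr1n.
have [rhol1 rhol2] : 0 < rho < rho1 /\ 0 < rho < rho2.
  by move: rhom; rewrite lt_min rho0 => /andP[-> ->].
pose O := eball x0 (rho ^+ 2 * r2).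
(* scaled so that its Hessian at [x0 + rho z] is [rho e] times [bumpD2 r2 z] *)
pose phi := quartic x0 (rho ^+ 2 * r2) (e / rho).
pose zz x : 'rV[R]_n := rho^-1 *: (x - x0).
have zE x : x = rho *: zz x + x0 by rewrite scalerA divff ?gt_eqF// scale1r subrK.
have zO x : nsq (x - x0) <= rho ^+ 2 * r2 -> nsq (zz x) <= r2.
  by move=> h; rewrite nsqZ exprVn ler_pdivrMl ?exprn_gt0.
have zR x : nsq (x - x0) <= rho ^+ 2 * r2 -> `|zz x| <= Rad by move=> /zO; exact: norm_nsq_le.
have nsqzz x : rho ^+ 2 * nsq (zz x) = nsq (x - x0).
  by rewrite /zz nsqZ exprVn mulrA divff ?mul1r// gt_eqF// exprn_gt0.
have hphi x : hessian phi x = rho *: (e *: bumpD2 r2 (zz x)).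
  apply: etrans (hessian_quartic _ _ _ _) _; rewrite scalerA.
  have -> : x - x0 = rho *: zz x by rewrite {1}(zE x) addrK.
  by rewrite bumpD2_scale scalerA; congr (_ *: _); field; rewrite gt_eqF.
have Oz x : nsq (x - x0) <= rho ^+ 2 * r2 -> Om x.
  by move=> xO; have [] := h1 rho (zz x) rhol1 (zR x xO); rewrite -zE.
have cO : compactly_contained O Om.
  by split; [exact: compact_closure_eball|move=> x /closure_eball; exact: Oz].
have oOO : open O by exact: eball_open.
have ju : weak_jet O u (grad u) (hessian u) := Ck_weak_jet oOO oO cO (CkW uC).
have jphi : weak_jet O phi (grad phi) (hessian phi) := @quartic_jet R n x0 (rho ^+ 2 * r2) (e / rho).
have jsum := weak_jetD oOO ju jphi.
have := minu O oOO cO phi (@quartic_W2infty0 _ _ _ _ _).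
pose M := H X0 + rho * (r2 - d + d / 4).
have up x : O x -> H (hessian u x + hessian phi x) <= M.
  move=> Ox; have xO := ltW Ox.
  have [_] := h2 rho (zz x) rhol2 (zR x xO); rewrite -zE mxdotZ => hh.
  have hm := hd (zz x) (zO x xO).
  rewrite (hphi x); exact: upper_real rho0 hh hm.
have Hn x : O x -> 0 <= H (hessian u x + hessian phi x).
  move=> Ox; apply: H_ge0; apply: symD; first exact: hessian_sym oO (CkW uC) (Oz x (ltW Ox)).
  by rewrite hphi; apply: symZ.
have x0O : O x0 by rewrite /O /eball /= subrr -(scale0r (0 : 'rV[R]_n)) nsqZ expr0n mul0r mulr_gt0// exprn_gt0.
have M0 : 0 <= M := le_trans (Hn _ x0O) (up _ x0O).
have Eup : (Einfty H O (u \+ phi)%R O <= M%:E)%E.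
  apply/(Einfty_leP H oOO jsum); first by rewrite lee_fin.
  by apply: nearW => x Ox; rewrite lee_fin ger0_norm ?Hn// up.
move=> /le_trans /(_ Eup) /(Einfty_leP H oOO ju); rewrite lee_fin => /(_ M0) aeu.
(* on this nonempty open set the unperturbed density exceeds [M] *)
pose O' := O `&` [set x | rho * (r2 - d / 4) + dotr v x0 < dotr v x].
have oO' : open O'.
  apply: openI => //.
  rewrite (_ : [set x | _] = dotr v @^-1` [set t | rho * (r2 - d / 4) + dotr v x0 < t])//.
  apply: open_comp; last exact: open_gt.
  by move=> x _; exact: dotr_continuous.
have O'0 : O' !=set0.
  (* a point of the ball so close to its boundary point [x0 + rho v] that the
     linear form exceeds the given bound *)
  pose k := d / (d + 8 * r2).
  have k0 : 0 < k by rewrite divr_gt0// addr_gt0// mulr_gt0.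
  have k1 : k < 1 by rewrite ltr_pdivrMr ?mul1r ?ltrDl ?mulr_gt0// addr_gt0// mulr_gt0.
  have kr : k * r2 < d / 4.
    have -> : k * r2 = d * r2 / (d + 8 * r2) by rewrite /k mulrAC.
    rewrite ltr_pdivrMr ?addr_gt0// ?mulr_gt0//.
    exact: fraction_real.
  exists (x0 + (rho * (1 - k)) *: v); split.
    rewrite /O /eball /= addrAC subrr add0r nsqZ ltr_pM2r// exprMn gtr_pMr ?exprn_gt0//.
    by rewrite expr_lt1// ?subr_ge0 ?(ltW k1)// ltrBlDr ltrDl.
  rewrite /=.
  have -> : dotr v (x0 + (rho * (1 - k)) *: v) = rho * (r2 - k * r2) + dotr v x0.
    by rewrite dotrC dotrDl dotrZl (dotrC x0) addrC -mulrA mulrBl mul1r.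
  by rewrite ltrD2r ltr_pM2l// ltrD2l ltrN2.
have aeu' : {ae leb R n, forall x, O' x -> (`|H (hessian u x)|%:E <= M%:E)%E}.
  by apply: filterS aeu => x h [Ox _]; exact: h.
have [x [Ox xv]] := ae_open_witness oO' O'0 aeu'; rewrite lee_fin => /ler_normlP[_ Hx].
have xO := ltW Ox.
have [_] := h1 rho (zz x) rhol1 (zR x xO); rewrite -zE scaler0 addr0.
have -> : mxdot G 0 = 0.
  by rewrite -(scale0r (0 : 'M[R]_n)) mxdotZ mul0r.
move=> hlow; have dE : dotr v x = rho * dotr v (zz x) + dotr v x0.
  by rewrite {1}(zE x) dotrC dotrDl dotrZl !(dotrC v).
apply: (lower_real rho0 d0 (erefl _) hlow _ Hx).
by move: xv; rewrite /= dE ltrD2r.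
Qed.
End necessity.

(** * Increments of functions with a bounded weak derivative *)

Lemma continuous_shifted (R : realType) n (G : 'rV[R]_n -> R) (c : 'rV[R]_n) :
  continuous G -> continuous (fun x : 'rV[R]_n => G (x + c)).
Proof.
move=> cG x; apply: (@continuous_comp _ _ _ (fun x : 'rV[R]_n => x + c) G); last exact: cG.
by apply: (@continuousD _ _ _ id (cst c)); [exact: cvg_id|exact: cst_continuous].
Qed.

Section shifted_pair.
Variables (R : realType) (n : nat) (j : 'I_n) (a b : 'rV[R]_n) (h : R).
Hypotheses (ab : forall i, a ord0 i < b ord0 i) (h0 : 0 < h).
Local Notation e := (delta_mx ord0 j : 'rV[R]_n).
Implicit Type x : 'rV[R]_n.

Let S := step (a ord0 j) (b ord0 j).
Variable s : R -> R.
Hypothesis Ss : forall t : R, is_derive t 1 S (s t) /\ 0 <= s t.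
Hypothesis sC : forall k, Sk k s.

Definition tube (x : 'rV[R]_n) : R :=
  \prod_(i | i != j) plateau (a ord0 i) (b ord0 i) 0 (x ord0 i).
(** A bump on the box from [a] to [b]. In the direction [j] its profile is the derivative
    [s] of a step, so that the difference of the bump and its translate by [h]
    is the partial derivative of the test function [slab_test], see
    [partial_slab_test]. *)
Definition slab_bump (x : 'rV[R]_n) : R := s (x ord0 j) * tube x.
Definition slab_test (x : 'rV[R]_n) : R := (S (x ord0 j) - S (x ord0 j - h)) * tube x.

Let shift_coord (t : R) x i : (t *: e + x) ord0 i = (if i == j then t else 0) + x ord0 i.
Proof. by rewrite !mxE eqxx/=; case: (i == j); rewrite ?mulr1 ?mulr0. Qed.

Let tube_shift t x : tube (t *: e + x) = tube x.
Proof. by apply: eq_bigr => i ij; rewrite shift_coord (negbTE ij) add0r. Qed.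

Let tubeC k : Ck k setT tube.
Proof.
apply: Ck_prod => [|i _]; first exact: openT.
by apply: Ck_coord; exact: Sk_plateau.
Qed.

Let tube_ge0 x : 0 <= tube x.
Proof. by apply: prodr_ge0 => i _; exact: plateau_ge0. Qed.

Let s_out t : ~~ (a ord0 j <= t <= b ord0 j) -> s t = 0.
Proof.
move=> ht; have [[_ <-] _] := Ss t.
have dc (c : R) : is_derive t 1 (fun=> c) 0 by exact: is_derive_cst.
move: ht; rewrite negb_and -!ltNge => /orP[ta|bt].
  have [_ <-] := dc 0; apply: near_eq_derive.
  near=> u; apply: step_eq0; apply: ltW; near: u; exact: lt_nbhsl.
have [_ <-] := dc 1; apply: near_eq_derive.
near=> u; apply: step_eq1 => //; apply: ltW; near: u; exact: lt_nbhsr.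
Unshelve. all: by end_near. Qed.

Let tube_out x i : i != j -> ~~ (a ord0 i <= x ord0 i <= b ord0 i) -> tube x = 0.
Proof.
move=> ij hx; rewrite /tube (bigD1 i)//= plateau_out ?mul0r//.
by apply: contra hx => /andP[/ltW -> /ltW ->].
Qed.

Lemma slab_bump_ge0 x : 0 <= slab_bump x.
Proof. by apply: mulr_ge0 => //; have [] := Ss (x ord0 j). Qed.

Lemma slab_bump_out x : ~ cbox a b x -> slab_bump x = 0.
Proof.
move=> /existsNP[i /negP hi]; rewrite /slab_bump; have [E|ij] := eqVneq i j.
  by rewrite s_out ?mul0r// -E.
by rewrite (tube_out ij hi) mulr0.
Qed.

Lemma slab_bump_continuous : continuous slab_bump.
Proof.
have c : Ck 0 setT slab_bump.
  by apply: CkM; [exact: openT|apply: Ck_coord; exact: sC|exact: tubeC].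
by move=> x; exact: (Ck_cont c).
Qed.

Let S_mono t u : t <= u -> S t <= S u.
Proof.
move=> tu; have [d|v /= _ E] := @MVT_segment R S s t u tu (fun v _ => (Ss v).1).
  exact/continuous_subspaceT/(is_derive1_continuous (fun v => (Ss v).1)).
by rewrite -subr_ge0 E mulr_ge0 ?subr_ge0// (Ss v).2.
Qed.

Lemma slab_test_ge0 x : 0 <= slab_test x.
Proof. by apply: mulr_ge0 => //; rewrite subr_ge0 S_mono// gerBl ltW. Qed.

Lemma slab_test_out x : ~ cbox a (b + h *: e) x -> slab_test x = 0.
Proof.
move=> /existsNP[i /negP]; rewrite [X in ~~ (_ <= _ <= X)](_ : _ = (if i == j then h else 0) + b ord0 i); last first.
  by rewrite addrC shift_coord.
rewrite /slab_test.
have [->|ij hi] := eqVneq i j; last first.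
  by rewrite (tube_out ij) ?mulr0//; rewrite add0r in hi.
rewrite negb_and -!ltNge => /orP[xa|bx].
  by rewrite /S !step_eq0 ?subrr ?mul0r// ltW// (le_lt_trans _ xa)// gerBl ltW.
by rewrite /S !step_eq1 ?subrr ?mul0r//; move: (h0) bx; lra.
Qed.

Lemma slab_testC k : Ck k setT slab_test.
Proof.
have SC l : Sk l S by exact: Sk_step.
apply: CkM; [exact: openT| |exact: tubeC].
apply: (@Ck_coord _ _ _ (fun t => S t - S (t - h))).
have := SkD (SC k) (SkM (Sk_cst k (-1)) (Sk_shift (- h) (SC k))).
by congr Sk; apply/funext => t; rewrite mulN1r.
Qed.

Lemma slab_test_test O : cbox a (b + h *: e) `<=` O -> test_function O slab_test.
Proof.
move=> abO; split; first exact: slab_testC.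
apply: cbox_contained abO _ => x /= zx; apply: contrapT => /slab_test_out zx0.
by rewrite zx0 eqxx in zx.
Qed.

Lemma partial_slab_test x : partial j slab_test x = slab_bump x - slab_bump (x - h *: e).
Proof.
have -> : slab_bump (x - h *: e) = s (x ord0 j - h) * tube x.
  by rewrite /slab_bump addrC -scaleNr tube_shift shift_coord eqxx addrC.
suff [_ E] : is_derive x e slab_test ((s (x ord0 j) - s (x ord0 j - h)) * tube x).
  by rewrite /partial E mulrBl.
apply: is_derive_coord_line.
have -> : (fun t : R => slab_test (t *: e + x)) =
          (fun t => (S (t + x ord0 j) - S (t + (x ord0 j - h))) * tube x).
  by apply/funext => t; rewrite /slab_test tube_shift shift_coord eqxx addrA.
have dS c : is_derive (0 : R) 1 (fun t => S (t + c)) (s c).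
  have d := (Ss (0 + c)).1; rewrite add0r in d.
  have := @is_derive1_comp _ S (fun t => t + c) 0 (s c) 1.
  rewrite mulr1; apply; first by rewrite add0r.
  by have := is_deriveD (is_derive_id (0:R) 1) (is_derive_cst c (0:R) 1); rewrite addr0.
apply: (is_derive_eq (is_deriveM (is_deriveB (dS (x ord0 j)) (dS (x ord0 j - h))) (is_derive_cst (tube x) (0:R) 1))).
by rewrite scaler0 add0r /GRing.scale/= [LHS]mulrC.
Qed.

Lemma tame_mul_bump (G : 'rV[R]_n -> R) : continuous G -> tame (fun x => G x * slab_bump x).
Proof.
move=> cG; apply: (tame_continuous (S := cbox a b)); last first.
- by move=> x /slab_bump_out ->; rewrite mulr0.
- exact: cbox_compact.
- by move=> x; apply: continuousM; [exact: cG|exact: slab_bump_continuous].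
Qed.

(** A translation moves the difference from the bump to [G]. *)
Lemma slab_by_parts (G : 'rV[R]_n -> R) : continuous G ->
  Itg (fun x => G x * partial j slab_test x) = - Itg (fun x => (G (x + h *: e) - G x) * slab_bump x).
Proof.
move=> cG; have cGh : continuous (fun x => G (x + h *: e)).
  exact: continuous_shifted.
have t1 := tame_mul_bump cG; have t2 := tame_mul_bump cGh.
have t3 : tame (fun x => G x * slab_bump (x - h *: e)).
  by have := tame_translate (- (h *: e)) t2; congr tame; apply/funext => x; rewrite subrK.
have -> : (fun x => G x * partial j slab_test x) =
          (fun x => G x * slab_bump x - G x * slab_bump (x - h *: e)).
  by apply/funext => x; rewrite partial_slab_test mulrBr.
rewrite ItgB// -(Itg_translate (h *: e) t3).
have -> : (fun x => (G (x + h *: e) - G x) * slab_bump x) =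
          (fun x => G (x + h *: e) * slab_bump x - G x * slab_bump x).
  by apply/funext => x; rewrite mulrBl.
rewrite ItgB// opprB; congr (_ - Itg _).
by apply/funext => x; rewrite addrK.
Qed.

(** Apply the integration by parts formulas to the coordinate function, whose
    increment is [h] and whose derivative is [1]. *)
Lemma integral_slab_test : Itg slab_test = h * Itg slab_bump.
Proof.
have tw : test_function setT slab_test by apply: slab_test_test.
have := weak_partial_Ck1 j openT (@Ck_coord R n 1 id j (Sk_id R 1)) tw.
have -> : partial j (fun x : 'rV[R]_n => x ord0 j) = cst 1.
  apply/funext => x; rewrite /partial.
  suff [_ ->] : is_derive x e (fun x : 'rV[R]_n => x ord0 j) 1 by [].
  apply: is_derive_coord_line.
  under eq_fun do rewrite shift_coord eqxx.
  by have := is_deriveD (is_derive_id (0:R) 1) (is_derive_cst (x ord0 j) (0:R) 1); rewrite addr0.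
rewrite -/(Itg _) -/(Itg _).
rewrite (@slab_by_parts (fun x => x ord0 j)); last exact: coord_continuous.
move=> /oppr_inj; under [X in _ = Itg X]eq_fun do rewrite mul1r.
move=> <-; rewrite -ItgZ; last first.
  have : tame (fun x => 1 * slab_bump x).
    by apply: (@tame_mul_bump (fun=> 1)) => x; exact: cst_continuous.
  by congr tame; apply/funext => x; rewrite mul1r.
congr Itg; apply/funext => x; congr (_ * _).
by rewrite [x + _]addrC shift_coord eqxx addrK.
Qed.
End shifted_pair.

Section one_dimensional_lipschitz.
Variables (R : realType) (f : R -> R) (M : R).
Hypotheses (cf : continuous f) (M0 : 0 <= M).

Let right_lip t := exists2 d : R, 0 < d & forall h, 0 < h < d -> `|f (t + h) - f t| <= M * h.

Let compact_itv_closed (a b : R) (Z : set R) : closed Z -> compact ([set` `[a, b]] `&` Z).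
Proof. by move=> cZ; apply: compact_closedI => //; exact: segment_compact. Qed.

Let id_cont (A : set R) : {within A, continuous (@id R)}.
Proof. by apply: continuous_subspaceT => t; exact: cvg_id. Qed.

(** The set of points up to which the bound holds is closed, and its maximum can only
    be [b]. *)
Lemma lipschitz_right_closed a b : a <= b -> (forall t, a <= t < b -> right_lip t) ->
  `|f b - f a| <= M * (b - a).
Proof.
move=> ab lip.
pose Z := [set t | `|f t - f a| - M * (t - a) <= 0].
have cZ : closed Z.
  rewrite (_ : Z = (fun t => `|f t - f a| - M * (t - a)) @^-1` [set t | t <= 0])//.
  apply: closed_comp; last exact: closed_le.
  move=> t _; apply: cvgB; first by apply: cvg_norm; apply: cvgB; [exact: cf|exact: cvg_cst].
  by apply: cvgM; [exact: cvg_cst|apply: cvgB; [exact: cvg_id|exact: cvg_cst]].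
have Za : ([set` `[a, b]] `&` Z) a.
  by split; rewrite /Z /= ?in_itv/= ?lexx// !subrr normr0 mulr0 subr0.
have [c /set_mem [/=]] := compact_EVT_max (ex_intro _ a Za) (compact_itv_closed cZ) (@id_cont _).
rewrite in_itv/= => /andP[ac cb] Zc cmax.
have [bc|{}cb] := leP b c.
  by have E : c = b by [apply/eqP; rewrite eq_le cb]; rewrite -E -subr_le0.
have [d d0 hd] := lip c (introT andP (conj ac cb)).
pose h := Num.min (d / 2) (b - c).
have h0 : 0 < h by rewrite lt_min divr_gt0//= subr_gt0.
have hd2 : h < d.
  by rewrite gt_min; apply/orP; left; rewrite ltr_pdivrMr// ltr_pMr// ltr1n.
have hb : h <= b - c by rewrite ge_min lexx orbT.
suff : c + h <= c by rewrite leNgt ltrDl h0.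
apply: cmax; rewrite inE; split; rewrite /Z /= ?in_itv/=; first by move: (h0) hb ac; lra.
have h1 := hd h (introT andP (conj h0 hd2)).
have := ler_normD (f (c + h) - f c) (f c - f a); rewrite addrA subrK => h2.
move: Zc h1; rewrite /Z /= => Zc h1.
have -> : M * (c + h - a) = M * (c - a) + M * h by ring.
lra.
Qed.

(** If the bound failed from [a], it would fail from points slightly to the right of [a]
    as well. *)
Lemma lipschitz_right_open a b : a <= b -> (forall t, a < t < b -> right_lip t) ->
  `|f b - f a| <= M * (b - a).
Proof.
rewrite le_eqVlt => /orP[/eqP ->|ab lip]; first by rewrite !subrr normr0 mulr0.
rewrite leNgt; apply/negP => gt.
have cg : {for a, continuous (fun t => `|f b - f t| - M * (b - t))}.
  apply: cvgB; first by apply: cvg_norm; apply: cvgB; [exact: cvg_cst|exact: cf].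
  by apply: cvgM; [exact: cvg_cst|apply: cvgB; [exact: cvg_cst|exact: cvg_id]].
have ng : \forall t \near a, 0 < `|f b - f t| - M * (b - t).
  by apply: (cvgr_gt _ cg); rewrite subr_gt0.
have [d /= d0 hd] := ng.
pose t := a + Num.min (d / 2) ((b - a) / 2).
have t0 : 0 < Num.min (d / 2) ((b - a) / 2) by rewrite lt_min !divr_gt0// subr_gt0.
have tb : t < b.
  by rewrite -ltrBrDl gt_min; apply/orP; right; rewrite ltr_pdivrMr// ltr_pMr ?ltr1n// subr_gt0.
have : 0 < `|f b - f t| - M * (b - t).
  apply: hd; rewrite /= /t opprD addrA subrr sub0r normrN gtr0_norm// gt_min.
  by apply/orP; left; rewrite ltr_pdivrMr// ltr_pMr// ltr1n.
rewrite ltNge => /negP; apply; rewrite subr_le0; apply: lipschitz_right_closed; first exact: ltW.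
by move=> s /andP[ts sb]; apply: lip; rewrite sb (lt_le_trans _ ts)// ltrDl.
Qed.

(** Between the first and the last zero in the interval the increment is zero, and
    outside the local bound applies. *)
Lemma lipschitz_zero_set (Z : set R) a b : closed Z -> (forall t, Z t -> f t = 0) ->
  (forall t, ~ Z t -> right_lip t) -> a <= b -> `|f b - f a| <= M * (b - a).
Proof.
move=> cZ f0 lip ab; pose K := [set` `[a, b]] `&` Z.
have cK : compact K by exact: compact_itv_closed.
have [K0|/set0P K0] := eqVneq K set0.
  apply: lipschitz_right_open => // t /andP[at_ tb]; apply: lip => Zt.
  have : K t by split => //=; rewrite in_itv/= !ltW.
  by rewrite K0.
have [t2 /set_mem [/= + Z2] max2] := compact_EVT_max K0 cK (@id_cont _).
have [t1 /set_mem [/= + Z1] min1] := compact_EVT_min K0 cK (@id_cont _).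
rewrite !in_itv/= => /andP[a1 b1] /andP[a2 b2].
have l1 : `|f t1 - f a| <= M * (t1 - a).
  apply: lipschitz_right_closed => // t /andP[at_ tt1]; apply: lip => Zt.
  suff : t1 <= t by rewrite leNgt tt1.
  by apply: min1; rewrite inE; split => //=; rewrite in_itv/= at_ (le_trans (ltW tt1)).
have l2 : `|f b - f t2| <= M * (b - t2).
  apply: lipschitz_right_open => // t /andP[tt2 tb]; apply: lip => Zt.
  suff : t <= t2 by rewrite leNgt tt2.
  by apply: max2; rewrite inE; split => //=; rewrite in_itv/= (ltW tb) (le_trans a2)// ltW.
have l12 : t1 <= t2 by apply: max2; rewrite inE; split => //=; rewrite in_itv/= a1.
move: l1 l2; rewrite (f0 _ Z1) (f0 _ Z2) sub0r normrN subr0 => l1 l2.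
apply: le_trans (ler_normB _ _) _.
have : M * t1 <= M * t2 by rewrite ler_wpM2l.
by move: l1 l2; rewrite !mulrBr; lra.
Qed.
End one_dimensional_lipschitz.

Section increments.
Variables (R : realType) (n : nat) (j : 'I_n) (O : set 'rV[R]_n) (M : R).
Hypotheses (oO : open O).
Local Notation e := (delta_mx ord0 j : 'rV[R]_n).
Implicit Types (F X : 'rV[R]_n -> R) (x : 'rV[R]_n).

Lemma slab_bump_neq0 (a b : 'rV[R]_n) (s : R -> R) : (forall i, a ord0 i < b ord0 i) ->
  (forall t : R, is_derive t 1 (step (a ord0 j) (b ord0 j)) (s t) /\ 0 <= s t) ->
  exists x, slab_bump j a b s x != 0.
Proof.
move=> ab Ss.
have [|v _ E] := @MVT_segment R _ s _ _ (ltW (ab j)) (fun v _ => (Ss v).1).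
  exact/continuous_subspaceT/(is_derive1_continuous (fun v => (Ss v).1)).
have sv : s v != 0.
  apply/eqP => sv; move: E; rewrite sv mul0r step_eq1// step_eq0// subr0.
  by apply/eqP; rewrite oner_neq0.
exists (\row_i if i == j then v else (a ord0 i + b ord0 i) / 2).
rewrite mulf_neq0//; first by rewrite mxE eqxx.
apply/prodf_neq0 => i ij.
rewrite mxE (negbTE ij) /plateau /margin.
have := ab i => abi; rewrite step_eq1 ?step_eq0 ?subr0 ?oner_neq0//; lra.
Qed.

Lemma tame_mul_test F z : continuous F -> test_function O z -> tame (fun x => F x * z x).
Proof.
move=> cF tz; have [_ [cz _]] := tz.
apply: (tame_continuous _ cz).
  by move=> x; apply: continuousM; [exact: cF|exact: test_continuous tz x].
move=> x nx; rewrite (_ : z x = 0) ?mulr0//.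
by apply/eqP/negPn/negP => zx; apply: nx; exact: subset_closure.
Qed.

Lemma tame_test_mul X z : tame X -> test_function O z -> tame (fun x => X x * z x).
Proof.
move=> tX tz; have [N _ zN] := test_bounded tz.
exact: tameM tX (tame_measurable (test_tame tz)) zN.
Qed.

(** Otherwise the increment exceeds [M * h] on a small box; test with the bump of that
    box: integration by parts bounds the mean of the increment by that of [X] over
    the translates, hence by [M * h]. *)
Lemma increment_le_local F X x0 : continuous F -> tame X -> (forall x, `|X x| <= M) ->
  (forall z, test_function O z -> Itg (fun x => F x * partial j z x) = - Itg (fun x => X x * z x)) ->
  O x0 -> exists2 d : R, 0 < d & forall h, 0 < h < d -> F (x0 + h *: e) - F x0 <= M * h.
Proof.
move=> cF tX XM wF Ox0; have [r r0 hr] := open_ball_sub oO Ox0.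
exists (r / 2); first by rewrite divr_gt0.
move=> h /andP[h0 hr2]; rewrite leNgt; apply/negP => gt.
pose D x := F (x + h *: e) - F x - M * h.
have cD : continuous D.
  have cs := continuous_shifted (c := h *: e) cF.
  move=> x; apply: (@continuousB _ _ _ (fun x => F (x + h *: e) - F x) (fun=> M * h)).
    by apply: (@continuousB _ _ _ (fun x => F (x + h *: e))); [exact: cs|exact: cF].
  exact: cst_continuous.
have D0 : 0 < D x0 by rewrite subr_gt0.
have [g g0 hg] := continuous_delta (cD x0) D0.
pose rho := Num.min (g / 2) (r / 2).
have rho0 : 0 < rho by rewrite lt_min !divr_gt0.
have rhog : rho <= g / 2 by rewrite ge_min lexx.
have rhor : rho <= r / 2 by rewrite ge_min lexx orbT.
pose a := x0 - const_mx rho; pose b := x0 + const_mx rho.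
have aE i : a ord0 i = x0 ord0 i - rho by rewrite !mxE.
have bE i : b ord0 i = x0 ord0 i + rho by rewrite !mxE.
have ab i : a ord0 i < b ord0 i by rewrite aE bE; move: rho0; lra.
have bhE i : (b + h *: e) ord0 i = x0 ord0 i + rho + h * (i == j)%:R.
  by rewrite !mxE eqxx.
have boxO : cbox a (b + h *: e) `<=` O.
  move=> x xb; rewrite -(subrK x0 x); apply: hr; apply/normr_row_ltP => // i.
  have := xb i; rewrite aE bhE !mxE => /andP[h1 h2]; rewrite ltr_norml.
  by move: h1 h2 rhor rho0 h0 hr2; case: (i == j); rewrite ?mulr1 ?mulr0 => *; apply/andP; split; lra.
have boxD x : cbox a b x -> 0 < D x.
  move=> xb; have := hg (x - x0); rewrite subrK => /(_ _)/wrap[|/ltr_normlP[]]; last by lra.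
  apply/normr_row_ltP => // i; have := xb i; rewrite aE bE !mxE => /andP[h1 h2].
  by rewrite ltr_norml; apply/andP; split; lra.
have [s Ss sC] := step_derive (ab j).
have tw := slab_test_test ab h0 boxO.
pose z := slab_bump j a b s; pose w := slab_test j a b h.
have z0 x : 0 <= z x by exact: slab_bump_ge0.
have w0 x : 0 <= w x by exact: slab_test_ge0.
have Iw : Itg w = h * Itg z by exact: integral_slab_test.
have tz : tame z.
  have : tame (fun x => 1 * z x).
    by apply: (tame_mul_bump ab Ss sC (G := fun=> 1)) => x; exact: cst_continuous.
  by congr tame; apply/funext => x; rewrite mul1r.
have tww : tame w := test_tame tw.
have cG : continuous (fun x => F (x + h *: e) - F x).
  move=> x; apply: (@continuousB _ _ _ (fun x => F (x + h *: e))); last exact: cF.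
  exact: continuous_shifted.
have tG := tame_mul_bump ab Ss sC cG.
have tD : tame (fun x => D x * z x) := tame_mul_bump ab Ss sC cD.
have Dz0 x : 0 <= D x * z x.
  have [xb|nx] := pselect (cbox a b x); first by rewrite mulr_ge0// ltW// boxD.
  by rewrite /z (slab_bump_out ab Ss nx) mulr0.
have [Nz hNz] : exists Nz, forall x, `|w x| <= Nz by have [_ [Nz [_ [hNz _]]]] := tww; exists Nz.
have tXw : tame (fun x => X x * w x) := tameM tX (tame_measurable tww) hNz.
have ID0 : Itg (fun x => D x * z x) <= 0.
  have -> : (fun x => D x * z x) =
      (fun x => (F (x + h *: e) - F x) * z x - (M * h) * z x).
    by apply/funext => x; rewrite -mulrBl.
  rewrite ItgB//; last exact: tameZ.
  rewrite ItgZ// -mulrA -Iw -ItgZ// subr_le0.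
  have -> : Itg (fun x => (F (x + h *: e) - F x) * z x) = Itg (fun x => X x * w x).
    by apply: oppr_inj; rewrite -(slab_by_parts h ab Ss sC cF) (wF _ tw).
  apply: Itg_le => //; first exact: tameZ.
  by move=> x; apply: ler_wpM2r => //; apply: le_trans (XM x); exact: ler_norm.
have cDz : continuous (fun x => D x * z x).
  by move=> x; apply: continuousM; [exact: cD|exact: slab_bump_continuous].
have [x] := slab_bump_neq0 ab Ss.
have := Itg_eq0 tD Dz0 cDz ID0 x => /eqP; rewrite mulf_eq0 => /orP[/eqP Dx|->//].
have [xb|nx] := pselect (cbox a b x); first by have := boxD x xb; rewrite Dx ltxx.
by rewrite (slab_bump_out ab Ss nx) eqxx.
Qed.

Lemma increment_local F X x0 : continuous F -> tame X -> (forall x, `|X x| <= M) ->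
  (forall z, test_function O z -> Itg (fun x => F x * partial j z x) = - Itg (fun x => X x * z x)) ->
  O x0 -> exists2 d : R, 0 < d & forall h, 0 < h < d -> `|F (x0 + h *: e) - F x0| <= M * h.
Proof.
move=> cF tX XM wF Ox0.
have [d1 d10 h1] := increment_le_local cF tX XM wF Ox0.
have [|||||d2 d20 h2] := @increment_le_local (fun x => - F x) (fun x => - X x) x0.
- by move=> x; apply: continuousN; exact: cF.
- exact: tameN.
- by move=> x; rewrite normrN.
- move=> z tz.
  have -> : (fun x => - F x * partial j z x) = (fun x => -1 * (F x * partial j z x)).
    by apply/funext => x; rewrite mulN1r mulNr.
  have -> : (fun x => - X x * z x) = (fun x => -1 * (X x * z x)).
    by apply/funext => x; rewrite mulN1r mulNr.
  rewrite (ItgZ _ (tame_mul_test cF (test_partial j tz))) (ItgZ _ (tame_test_mul tX tz)) (wF _ tz).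
  by rewrite mulrN.
- exact: Ox0.
exists (Num.min d1 d2); first by rewrite lt_min d10.
move=> h /andP[h0]; rewrite lt_min => /andP[hd1 hd2].
have := h1 h (introT andP (conj h0 hd1)); have := h2 h (introT andP (conj h0 hd2)).
by move=> u1 u2; apply/ler_normlP; split; lra.
Qed.
End increments.

(** * Integrals of weak derivatives of functions vanishing on the boundary *)

Lemma ind_tame_open (R : realType) n (O : set 'rV[R]_n) :
  open O -> compact (closure O) -> tame (ind O).
Proof.
move=> oO cO; have [k Ok] := bounded_sub_cube (compact_bounded cO).
apply: (ind_tame (k := k)); first exact: open_measurable_row.
by apply: subset_trans Ok; exact: subset_closure.
Qed.

Section zero_extension.
Variables (R : realType) (n : nat) (j : 'I_n) (O : set 'rV[R]_n) (M : R).
Local Notation e := (delta_mx ord0 j : 'rV[R]_n).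
Variables (F X : 'rV[R]_n -> R).
Hypotheses (oO : open O) (cO : compact (closure O)).
Hypotheses (cF : continuous F) (F0 : forall x, ~ O x -> F x = 0).
Hypotheses (tX : tame X) (XM : forall x, `|X x| <= M) (X0 : forall x, ~ O x -> X x = 0).
Hypothesis wF : forall z, test_function O z ->
  Itg (fun x => F x * partial j z x) = - Itg (fun x => X x * z x).
Implicit Types x : 'rV[R]_n.

Let M0 : 0 <= M. Proof. exact: le_trans (XM 0). Qed.

Let tF : tame F.
Proof. by apply: (tame_continuous cF cO) => x nx; apply: F0 => Ox; apply: nx; exact: subset_closure. Qed.

(** The local bound propagates along lines, across the points at which the extension
    vanishes. *)
Lemma zero_extension_lipschitz x (h : R) : 0 <= h -> `|F (x + h *: e) - F x| <= M * h.
Proof.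
move=> h0; pose f t := F (x + t *: e).
have cl : continuous (fun t : R => x + t *: e).
  by move=> t; apply: cvgD; [exact: cvg_cst|apply: cvgZr_tmp].
have cf : continuous f.
  move=> t; rewrite /f; apply: continuous_comp; [exact: cl|exact: cF].
pose Z := (fun t : R => x + t *: e) @^-1` (~` O).
have cZ : closed Z.
  by apply: closed_comp; [move=> t _; exact: cl|exact: open_closedC].
have fZ t : Z t -> f t = 0 by exact: F0.
have lip t : ~ Z t -> exists2 d : R, 0 < d & forall h, 0 < h < d -> `|f (t + h) - f t| <= M * h.
  move=> /contrapT Ot; have [d d0 hd] := increment_local oO cF tX XM wF Ot.
  by exists d => // h' /hd; rewrite /f scalerDl addrA.
have := lipschitz_zero_set cf M0 cZ fZ lip h0.
by rewrite /f scale0r addr0 subr0.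
Qed.

Section cutoff.
Variable z : 'rV[R]_n -> R.
Hypotheses (tz : test_function O z) (z01 : forall x, 0 <= z x <= 1).

Let c x := 1 - z x.
Let tZ : tame z := test_tame tz.
Let mc : measurable_fun setT c.
Proof. by apply: measurable_funB => //; exact: tame_measurable tZ. Qed.
Let c0 x : 0 <= c x. Proof. by rewrite subr_ge0; have /andP[] := z01 x. Qed.
Let c1 x : `|c x| <= 1.
Proof. by rewrite ger0_norm// gerBl; have /andP[] := z01 x. Qed.

Let zC : Ck 1 setT z. Proof. by have [] := tz. Qed.

Let collar k x := ind O x * (1 - ind O (x - shrink R k *: e)).

Let tO : tame (ind O) := ind_tame_open oO cO.

Let collar_tame k : tame (collar k).
Proof.
apply: (tameM (N := 1)) => //.
  by apply: measurable_funB => //; exact: tame_measurable (tame_translate _ tO).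
by move=> x; exact: indC_norm.
Qed.

Let collar_cvg : Itg (collar k) @[k --> \oo] --> (0 : R).
Proof.
have I0 : Itg (fun _ : 'rV[R]_n => (0 : R)) = 0.
  by rewrite /Itg /Rintegral integral0_eq.
rewrite -I0; apply: (@Itg_dominated R n collar _ (ind O)) => //.
  by move=> k x; rewrite normrM (ger0_norm (ind_ge0 O x)) ler_piMr ?indC_norm ?ind_ge0.
move=> x; apply: cvg_near_cst.
have [Ox|nO] := pselect (O x); last by apply: nearW => k; rewrite /collar ind_out ?mul0r.
have [r r0 hr] := open_ball_sub oO Ox.
apply: filterS (near_shrink r0) => k hk.
rewrite /collar [ind O (x - _)]ind_in ?subrr ?mulr0// addrC -scaleNr; apply: hr.
by apply: le_lt_trans (normr_delta_le _ _) _; rewrite normrN (gtr0_norm (shrink_gt0 R k)).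
Qed.

Let quotient_bound k : `|Itg (fun x => F x * quotient j k z x)| <= M * (Itg (fun x => ind O x * c x) + Itg (collar k)).
Proof.
pose s := shrink R k *: e.
pose collar' x := ind O (x + s) * (1 - ind O x).
have tc' : tame collar'.
  by have := tame_translate s (collar_tame k); congr tame; apply/funext => x; rewrite /collar addrK.
have Ic' : Itg collar' = Itg (collar k).
  by rewrite -(Itg_translate s (collar_tame k)); congr Itg; apply/funext => x; rewrite /collar addrK.
have tq : tame (fun x => (F (x + s) - F x) * c x).
  by apply: (tameM (N := 1)) => //; apply: tameB => //; exact: tame_translate.
have tFc : tame (fun x => F x * c x) by apply: (tameM (N := 1)).
have tFs : tame (fun x => F x * c (x - s)).
  apply: (tameM (N := 1)) => //.
  by apply: (measurableT_comp mc); exact: measurable_translate.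
have tqk : tame (fun x => F x * quotient j k z x).
  by have [N _ pN] := test_bounded (test_partial j tz); exact: quotient_tame tF zC pN k.
have E : Itg (fun x => (F (x + s) - F x) * c x) = shrink R k * Itg (fun x => F x * quotient j k z x).
  have -> : (fun x => (F (x + s) - F x) * c x) = (fun x => F (x + s) * c x - F x * c x).
    by apply/funext => x; rewrite mulrBl.
  have tFs' : tame (fun x => F (x + s) * c x).
    by have := tame_translate s tFs; congr tame; apply/funext => x; rewrite addrK.
  rewrite ItgB// -ItgZ//.
  have -> : Itg (fun x => F (x + s) * c x) = Itg (fun x => F x * c (x - s)).
    by rewrite -(Itg_translate s tFs); congr Itg; apply/funext => x; rewrite addrK.
  rewrite -ItgB//; congr Itg; apply/funext => x.
  rewrite /quotient /c mulrCA [shrink R k * _]mulrC divfK; last by rewrite gt_eqF ?shrink_gt0.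
  by rewrite -/s; move: (F x) (z x) (z (x - s)) => *; ring.
have tOc : tame (fun x => ind O x * c x) by apply: (tameM (N := 1)).
rewrite -(ler_pM2l (shrink_gt0 R k)) -{1}(gtr0_norm (shrink_gt0 R k)) -normrM -E -Ic' mulrA [shrink R k * M]mulrC.
rewrite -ItgD// -ItgZ; last exact: tameD.
apply: Itg_norm_le => //; first by apply: tameZ; exact: tameD.
move=> x; rewrite normrM (ger0_norm (c0 x)).
have Fs := zero_extension_lipschitz x (ltW (shrink_gt0 R k)).
have Mh : 0 <= M * shrink R k by rewrite mulr_ge0// ltW ?shrink_gt0.
rewrite /collar'; have [Ox|nO] := pselect (O x).
  by rewrite (ind_in Ox) subrr mulr0 addr0 mul1r ler_wpM2r.
rewrite (ind_out nO) mul0r add0r subr0 mulr1 [c x]/c (test_out tz nO) subr0 mulr1.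
have [Os|nOs] := pselect (O (x + s)); first by rewrite (ind_in Os) mulr1.
by rewrite (F0 nO) (F0 nOs) subrr normr0 mulr_ge0// ind_out.
Qed.

(** The integral of [X * z] is a limit of integrals of [F] times difference quotients of
    [z], equivalently of [1 - z]. After a translation the quotients bear on [F], where
    they are at most [M]; they vanish far from [O], and the collar of points of [O]
    that a small translation moves out of [O] has a measure that tends to zero. *)
Lemma cutoff_estimate : `|Itg (fun x => X x * z x)| <= M * Itg (fun x => ind O x * (1 - z x)).
Proof.
rewrite -normrN -wF//.
have h1 : `|Itg (fun x => F x * quotient j k z x)| @[k --> \oo] --> `|Itg (fun x => F x * partial j z x)|.
  by have [N _ pN] := test_bounded (test_partial j tz); exact: cvg_norm (quotient_cvg tF zC pN).
have h2 : M * (Itg (fun x => ind O x * c x) + Itg (collar k)) @[k --> \oo] -->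
          M * Itg (fun x => ind O x * c x).
  rewrite -[X in _ --> M * X]addr0; apply: cvgM; first exact: cvg_cst.
  by apply: cvgD; [exact: cvg_cst|exact: collar_cvg].
by apply: ler_cvg_to h1 h2 _; apply: nearW => k; exact: quotient_bound.
Qed.
End cutoff.
End zero_extension.

Section exhaustion.
Variables (R : realType) (n : nat) (O : set 'rV[R]_n).
Hypothesis oO : open O.
Implicit Types (z : 'rV[R]_n -> R) (x : 'rV[R]_n).

Lemma test0 : test_function O (fun=> 0).
Proof.
split; first by move=> k; apply: Ck_cst; exact: openT.
rewrite (_ : [set x | _] = set0); last by apply/seteqP; split => // x /=; rewrite eqxx.
by rewrite /compactly_contained closure0; split => //; exact: compact0.
Qed.

Lemma test_join z1 z2 : test_function O z1 -> test_function O z2 ->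
  test_function O (fun x => 1 - (1 - z1 x) * (1 - z2 x)).
Proof.
move=> [C1 [c1 s1]] [C2 [c2 s2]]; split => [k|].
  have oT := @openT 'rV[R]_n.
  have CC z : Ck k setT z -> Ck k setT (fun x => 1 - z x).
    by move=> zC; apply: (CkD oT); [exact: Ck_cst|exact: CkN].
  by apply: (CC) => //; apply: (CkM oT); exact: CC.
have sub : closure [set x | 1 - (1 - z1 x) * (1 - z2 x) != 0] `<=`
           closure [set x | z1 x != 0] `|` closure [set x | z2 x != 0].
  rewrite -closureU; apply: closureS => x /= zx.
  have [/eqP z1x|] := boolP (z1 x == 0); last by left.
  have [/eqP z2x|] := boolP (z2 x == 0); last by right.
  by rewrite z1x z2x !subr0 mulr1 subrr eqxx in zx.
split; last by apply: subset_trans sub _ => x [/s1|/s2].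
by apply: (subclosed_compact _ (compactU c1 c2) sub); exact: closed_closure.
Qed.

Let bump (i : nat) : 'rV[R]_n -> R :=
  if unpickle i is Some (p, q, m) then
    if `[< cbox (rat_row R p) (rat_row R q) `<=` O /\
           forall i, rat_row R p ord0 i < rat_row R q ord0 i >]
    then rbump (rat_row R p) (rat_row R q) m else fun=> 0
  else fun=> 0.

Let bump_test i : test_function O (bump i).
Proof.
rewrite /bump; case: unpickle => [[[p q] m]|]; last exact: test0.
case: ifPn => [/asboolP[pqO pq]|_]; last exact: test0.
exact: rbump_test.
Qed.

Let bump01 i x : 0 <= bump i x <= 1.
Proof.
rewrite /bump; case: unpickle => [[[p q] m]|]; last by rewrite lexx ler01.
case: ifPn => [/asboolP[pqO pq]|_]; last by rewrite lexx ler01.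
apply/andP; split; first by apply: prodr_ge0 => k _; exact: plateau_ge0.
by apply: le_trans (rbump_norm pq m x); exact: ler_norm.
Qed.

(** The product over the first [k] bumps is zero at a point as soon as one of them is
    [1] there. The enumeration runs over rational boxes with closure in [O] and over
    the widths of the shoulders. *)
Definition exhaust (k : nat) x : R := 1 - \prod_(i < k) (1 - bump i x).

Lemma exhaust_test k : test_function O (exhaust k).
Proof.
elim: k => [|k ih].
  by rewrite (_ : exhaust 0 = fun=> 0); [exact: test0|apply/funext => x; rewrite /exhaust big_ord0 subrr].
have := test_join ih (bump_test k); congr test_function; apply/funext => x.
by rewrite /exhaust big_ord_recr/= subKr.
Qed.

Lemma exhaust01 k x : 0 <= exhaust k x <= 1.
Proof.
have h i : 0 <= 1 - bump i x <= 1.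
  by have /andP[b0 b1] := bump01 i x; rewrite subr_ge0 b1 gerBl.
rewrite /exhaust subr_ge0 gerBl; apply/andP; split; last by apply: prodr_ge0 => i _; have /andP[] := h i.
by apply: prodr_ile1 => i _; exact: h.
Qed.

Lemma exhaust_eventually1 x : O x -> \forall k \near \oo, exhaust k x = 1.
Proof.
move=> Ox; have : O x by [].
rewrite {1}(open_bigcup_rat_rbox oO) => -[[p q] /= pqO xpq].
have pq i : rat_row R p ord0 i < rat_row R q ord0 i.
  by have /andP[] := xpq i; exact: lt_trans.
have [m _ hm] := rbump_eventually1 xpq.
have b1 : bump (pickle (p, q, m)) x = 1.
  rewrite /bump pickleK asboolT; last first.
    split => //; apply: subset_trans pqO => v h i; have := h i; rewrite !mxE.
    exact.
  by apply: hm => /=.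
near=> k; rewrite /exhaust.
have pk : (pickle (p, q, m) < k)%N by near: k; exists (pickle (p, q, m)).+1.
by rewrite (bigD1 (Ordinal pk))//= b1 subrr mul0r subr0.
Unshelve. all: by end_near. Qed.
End exhaustion.

Section zero_trace.
Variables (R : realType) (n : nat).
Local Notation mu := (leb R n).

(** Apply [cutoff_estimate] to an exhaustion of [O] by test functions. *)
Lemma zero_extension_integral (j : 'I_n) O (M : R) (F X : 'rV[R]_n -> R) :
  open O -> compact (closure O) -> continuous F -> (forall x, ~ O x -> F x = 0) ->
  tame X -> (forall x, `|X x| <= M) -> (forall x, ~ O x -> X x = 0) ->
  (forall z, test_function O z ->
     Itg (fun x => F x * partial j z x) = - Itg (fun x => X x * z x)) ->
  Itg X = 0.
Proof.
move=> oO cO cF F0 tX XM X0 wF.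
have M0 : 0 <= M by exact: le_trans (XM 0).
pose gap k x := ind O x * (1 - exhaust O k x).
have tgap k : tame (gap k).
  apply: (tameM (N := 1) (ind_tame_open oO cO)).
    by apply: measurable_funB => //; exact: tame_measurable (test_tame (exhaust_test O k)).
  by move=> x; have /andP[h0 h1] := exhaust01 O k x; rewrite ger0_norm ?subr_ge0// gerBl.
have gap0 : Itg (gap k) @[k --> \oo] --> (0 : R).
  have I0 : Itg (fun _ : 'rV[R]_n => (0 : R)) = 0.
    by rewrite /Itg /Rintegral integral0_eq.
  rewrite -I0; apply: (@Itg_dominated R n gap _ (ind O)) => //; first exact: ind_tame_open.
    move=> k x; have /andP[h0 h1] := exhaust01 O k x.
    by rewrite normrM (ger0_norm (ind_ge0 O x)) ler_piMr ?ind_ge0// ger0_norm ?subr_ge0// gerBl.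
  move=> x; apply: cvg_near_cst.
  have [Ox|nO] := pselect (O x); last by apply: nearW => k; rewrite /gap ind_out ?mul0r.
  by apply: filterS (exhaust_eventually1 oO Ox) => k hk; rewrite /gap hk subrr mulr0.
have bound k : `|Itg X| <= 2 * M * Itg (gap k).
  have tz := exhaust_test O k.
  have h1 := cutoff_estimate oO cO cF F0 tX XM wF tz (exhaust01 O k).
  have tXz := tame_test_mul tX tz.
  have tXc : tame (fun x => X x * (1 - exhaust O k x)).
    by have := tameB tX tXz; congr tame; apply/funext => x; rewrite [RHS]mulrBr mulr1.
  have h2 : `|Itg (fun x => X x * (1 - exhaust O k x))| <= M * Itg (gap k).
    rewrite -ItgZ//; apply: Itg_norm_le => //; first exact: tameZ.
    move=> x; have /andP[e0 e1] := exhaust01 O k x; rewrite normrM /gap.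
    have [Ox|nO] := pselect (O x); last by rewrite (X0 x nO) ind_out// normr0 !mul0r mulr0.
    by rewrite (ind_in Ox) mul1r (@ger0_norm _ (1 - exhaust O k x)) ?subr_ge0// ler_wpM2r// subr_ge0.
  have -> : Itg X = Itg (fun x => X x * exhaust O k x) + Itg (fun x => X x * (1 - exhaust O k x)).
    by rewrite -ItgD//; congr Itg; apply/funext => x; rewrite -mulrDr addrC [X in _ * X]subrK mulr1.
  apply: le_trans (ler_normD _ _) _; move: h1 h2; rewrite /gap.
  have -> : 2 * M * Itg (gap k) = M * Itg (gap k) + M * Itg (gap k) by ring.
  exact: lerD.
apply/eqP; rewrite -normr_le0.
have lim : 2 * M * Itg (gap k) @[k --> \oo] --> 2 * M * 0.
  by apply: cvgM; [exact: cvg_cst|exact: gap0].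
rewrite mulr0 in lim.
by apply: ler_cvg_to (cvg_cst _) lim _; apply: nearW => k; exact: bound.
Qed.

(** Glue along the two closed sets [closure O] and the complement of [O]. *)
Lemma zero_boundary_continuous O (g : 'rV[R]_n -> R) : open O ->
  {within closure O, continuous g} -> (forall x, (closure O `\` O^°) x -> g x = 0) ->
  continuous (g \_ O).
Proof.
move=> oO cg g0; rewrite continuous_subspace_setT.
have -> : [set: 'rV[R]_n] = closure O `|` ~` O.
  apply/seteqP; split => // x _; have [Ox|nO] := pselect (O x); last by right.
  by left; exact: subset_closure.
apply: withinU_continuous; [exact: closed_closure|exact: open_closedC| |].
  have E : {in closure O, g =1 g \_ O}.
    move=> x; rewrite inE => cx; rewrite patchE; case: ifPn => //.
    by rewrite notin_setE => nO; apply: g0; split => // /interior_subset.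
  exact: subspace_eq_continuous E cg.
have E : {in ~` O, (fun=> 0) =1 g \_ O}.
  by move=> x; rewrite inE => nO; rewrite patchE memNset.
apply: (subspace_eq_continuous E).
by apply: continuous_subspaceT => x; exact: cst_continuous.
Qed.

(** For a smooth function this would be the fundamental theorem of calculus on lines;
    [O] is an arbitrary open set, so its boundary has no regularity to rely on. *)
Lemma zero_trace_integral (j : 'I_n) O f X : open O -> compact (closure O) ->
  zero_on_boundary O f -> Linfty O f -> Linfty O X -> weak_partial O j f X ->
  (\int[mu]_(x in O) X x)%R = 0.
Proof.
move=> oO cO [g [cg gf g0]] fL XL wX.
have mO := open_measurable_row oO.
have [X' [M [mX' X'M X'0 XX']]] := Linfty_trunc mO XL.
have cF := zero_boundary_continuous oO cg g0.
have F0 x : ~ O x -> (g \_ O) x = 0 by move=> nO; rewrite patchE memNset.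
have tX' : tame X'.
  split => //; have [k Ok] := bounded_sub_cube (compact_bounded cO).
  exists M, k; split => // x nx; apply: X'0 => Ox; apply: nx; apply: Ok; exact: subset_closure.
have tF : tame (g \_ O).
  by apply: (tame_continuous cF cO) => x nx; apply: F0 => Ox; apply: nx; exact: subset_closure.
have wF z : test_function O z ->
    Itg (fun x => (g \_ O) x * partial j z x) = - Itg (fun x => X' x * z x).
  move=> tz; have tz' := test_partial j tz.
  have FL : Linfty O (g \_ O).
    have [mF [N [_ [FN _]]]] := tF.
    by apply: (Linfty_bounded (M := N)) => //; exact: measurable_funTS.
  have X'L : Linfty O X'.
    by apply: (Linfty_bounded (M := M)) => //; exact: measurable_funTS.
  rewrite -(Itg_restrict (O := O)); last by move=> x nO; rewrite F0 ?mul0r.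
  rewrite -(Itg_restrict (O := O)); last by move=> x nO; rewrite X'0 ?mul0r.
  rewrite -(Linfty_integral_ae oO XL X'L XX' tz) -(wX _ tz).
  apply/esym/(Linfty_integral_ae oO fL FL _ tz'); apply: filterS gf => x h Ox.
  by rewrite -h// patchE mem_set.
have := zero_extension_integral oO cO cF F0 tX' X'M X'0 wF.
rewrite -(Itg_restrict X'0) => <-; congr fine; apply: ae_eq_integral => //.
- by apply/measurable_EFinP; exact: XL.1.
- by apply/measurable_EFinP; exact: measurable_funTS.
- by apply: filterS XX' => x h Ox; rewrite /= h.
Qed.
End zero_trace.

(** * Constant contractions give absolute minimisers *)

Section sufficiency.
Variables (R : realType) (n : nat).
Local Notation mu := (leb R n).

Lemma convex_between (S : set R) (a b c : R) : convex_set (S : set R^o) ->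
  S a -> S b -> a < c < b -> S c.
Proof.
move=> cS Sa Sb /andP[ac cb].
have ba : 0 < b - a by rewrite subr_gt0 (lt_trans ac).
pose k := (b - c) / (b - a).
have k0 : 0 <= k by rewrite divr_ge0 ?subr_ge0 ?ltW// (lt_trans ac).
have k1 : k <= 1 by rewrite ler_pdivrMr// mul1r lerD2l lerN2 ltW.
have E : k * a + (1 - k) * b = c by rewrite /k; field; rewrite gt_eqF.
rewrite -E; exact: set_mem (cS a b (Itv01 k0 k1) (mem_set Sa) (mem_set Sb)).
Qed.

Lemma integrable_Linfty O f : open O -> compact (closure O) -> Linfty O f ->
  mu.-integrable O (EFin \o f).
Proof.
move=> oO cO fL; have mO := open_measurable_row oO.
have [g [M [mg gM g0 fg]]] := Linfty_trunc mO fL.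
have ig : mu.-integrable O (EFin \o g).
  by apply: (integrable_bounded mO (compact_leb cO mO) (measurable_funTS mg)) => x _; exact: gM.
exact: (integrable_ae mO fL.1 ig fg).
Qed.

Lemma integral_mxdot0 O (A : 'M[R]_n) (X : 'rV[R]_n -> 'M[R]_n) : open O -> compact (closure O) ->
  (forall i j, Linfty O (fun x => X x i j)) ->
  (forall i j, (\int[mu]_(x in O) X x i j)%R = 0) ->
  mu.-integrable O (EFin \o (fun x => mxdot A (X x))) /\ (\int[mu]_(x in O) mxdot A (X x))%R = 0.
Proof.
move=> oO cO XL X0; have mO := open_measurable_row oO.
pose null (f : 'rV[R]_n -> R) := mu.-integrable O (EFin \o f) /\ (\int[mu]_(x in O) f x)%R = 0.
have null0 : null (fun=> 0).
  split; first exact: integrable0.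
  by rewrite /Rintegral integral0_eq.
have nullD f g : null f -> null g -> null (fun x => f x + g x).
  move=> [i1 e1] [i2 e2]; split; last by rewrite RintegralD// e1 e2 addr0.
  have := integrableD mO i1 i2; congr (_.-integrable _ _).
have nullZ c f : null f -> null (fun x => c * f x).
  move=> [i1 e1]; split; last by rewrite RintegralZl// e1 mulr0.
  have := integrableZl mO c i1; congr (_.-integrable _ _).
have null_sum (F : 'I_n -> 'rV[R]_n -> R) (r : seq 'I_n) :
    (forall i, null (F i)) -> null (fun x => \sum_(i <- r) F i x).
  move=> h; elim: r => [|i r ih]; first by under eq_fun do rewrite big_nil.
  by under eq_fun do rewrite big_cons; exact: nullD.
suff : null (fun x => mxdot A (X x)) by [].
apply: (null_sum (fun i x => \sum_j A i j * X x i j)) => i.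
apply: (null_sum (fun j x => A i j * X x i j)) => j; apply: (nullZ).
by split; [exact: integrable_Linfty|exact: X0].
Qed.

(** A nonnegative function with integral zero is null, and nonempty open sets are not. *)
Lemma ae_pos_integral O (f : 'rV[R]_n -> R) : open O -> O !=set0 ->
  mu.-integrable O (EFin \o f) -> (\int[mu]_(x in O) f x)%R = 0 ->
  {ae mu, forall x, O x -> 0 < f x} -> False.
Proof.
move=> oO O0 intf If fpos; have mO := open_measurable_row oO.
have E : (\int[mu]_(x in O) `|(EFin \o f) x| = 0)%E.
  rewrite (ae_eq_integral (EFin \o f))//.
  - by rewrite -(fineK (integrable_fin_num mO intf)); congr (_ %:E).
  - by apply: measurableT_comp => //; exact: measurable_int intf.
  - exact: measurable_int intf.
  - by apply: filterS fpos => x h Ox; rewrite gee0_abs// lee_fin ltW// h.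
have /(ae_eq_integral_abs mu mO (measurable_int _ intf)) ae0 := E.
have ae1 : {ae mu, forall x, O x -> f x = 0 /\ 0 < f x}.
  by apply: filterS2 ae0 fpos => x h1 h2 Ox; split; [have /= [] := h1 Ox|exact: h2].
by have [x _ [-> ]] := ae_open_witness oO O0 ae1; rewrite ltxx.
Qed.

Variables (H : 'M[R]_n -> R) (A : 'M[R]_n) (h : R -> R).
Hypotheses (lch : level_convex h) (h0 : forall t, 0 <= h t).
Hypothesis HE : forall X, X \is symmetricmx -> H X = h (mxdot A X).
Variables (Om : set 'rV[R]_n) (u : 'rV[R]_n -> R) (C : R).
Hypotheses (oO : open Om) (uC : Ck 3 Om u).
Hypothesis uE : forall x, Om x -> mxdot A (hessian u x) = C.

(** A competitor with a smaller energy would keep [C + mxdot A (X x)] in a sublevel set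
    of [h] that does not contain [C]; as this set is convex, it lies on one side of
    [C], so [mxdot A (X x)] has a constant sign, although its integral is zero. *)
Lemma constant_AM2 : W2infty Om u -> AM2 H Om u.
Proof.
move=> uW; split => // O oOO cO phi [[p [X' jphi']] _ gphi].
have [X jphi] : exists X, weak_jet O phi (weak_gradient O phi) X.
  by rewrite /weak_gradient; case: xgetP => [q -> //|/(_ p)[]]; exists X'.
have OOm : O `<=` Om by apply: subset_trans cO.2; exact: subset_closure.
have ju : weak_jet O u (grad u) (hessian u) := Ck_weak_jet oOO oO cO (CkW uC).
have jsum := weak_jetD oOO ju jphi.
have hs x : O x -> hessian u x \is symmetricmx.
  by move=> /OOm Ox; exact: hessian_sym oO (CkW uC) Ox.
have E0 (g : 'rV[R]_n -> R) : (0 <= Einfty H O g O)%E := Linfty_norm_ge0 _ _.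
have Eu : (Einfty H O u O <= (h C)%:E)%E.
  apply/(Einfty_leP H oOO ju); first by rewrite lee_fin.
  by apply: nearW => x Ox; rewrite HE ?hs// (uE (OOm _ Ox)) ger0_norm.
have [Oe|/set0P One] := eqVneq O set0.
  apply: le_trans (E0 _); apply/(Einfty_leP H oOO ju) => //.
  by apply: nearW => x; rewrite Oe.
apply: le_trans Eu _; rewrite leNgt; apply/negP => Elt.
have fin : Einfty H O (u \+ phi)%R O \is a fin_num.
  by rewrite ge0_fin_numE// (lt_trans Elt)// ltry.
pose t := fine (Einfty H O (u \+ phi)%R O).
have t0 : 0 <= t by exact: fine_ge0.
have tC : t < h C by rewrite -lte_fin fineK.
have aet : {ae mu, forall x, O x -> h (C + mxdot A (X x)) <= t}.
  have : (Einfty H O (u \+ phi)%R O <= t%:E)%E by rewrite fineK.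
  move=> /(Einfty_leP H oOO jsum); rewrite lee_fin => /(_ t0) ae1.
  apply: filterS2 ae1 (weak_jet_sym oOO jphi) => x h1 h2 Ox.
  have := h1 Ox; rewrite lee_fin HE; last by apply: symD; [exact: hs|exact: h2].
  by rewrite mxdotD (uE (OOm _ Ox)) ger0_norm.
have XL i j : Linfty O (fun x => X x i j) by have [_ [_ h1]] := jphi; have [] := h1 i j.
have X0 i j : (\int[mu]_(x in O) X x i j)%R = 0.
  have [_ [h1 h2]] := jphi; have [pL _] := h1 i; have [_ wX] := h2 i j.
  exact: zero_trace_integral oOO cO.1 (gphi i) pL (XL i j) wX.
have [intA IA] := integral_mxdot0 A oOO cO.1 XL X0.
have S1 s : h s <= t -> s != C.
  by move=> st; apply: contraTneq st => ->; rewrite -ltNge.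
have [[s0 [hs0 s0C]]|nex] := pselect (exists s, h s <= t /\ s < C).
  have [iN IN] : mu.-integrable O (EFin \o (fun x => -1 * mxdot A (X x))) /\
      (\int[mu]_(x in O) (-1 * mxdot A (X x)))%R = 0.
    have mO := open_measurable_row oOO; rewrite RintegralZl// IA mulr0; split => //.
    by have := integrableZl mO (-1) intA; congr (_.-integrable _ _).
  apply: (ae_pos_integral oOO One iN IN); apply: filterS aet => x hx Ox.
  have := S1 _ (hx Ox); rewrite mulN1r oppr_gt0 neq_lt => /orP[|gt]; first by rewrite gtrDl.
  have := convex_between (lch t0) hs0 (hx Ox) (introT andP (conj s0C gt)).
  by rewrite /= leNgt tC.
apply: (ae_pos_integral oOO One intA IA); apply: filterS aet => x hx Ox.
have := S1 _ (hx Ox); rewrite neq_lt => /orP[lt|]; last by rewrite ltrDl.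
by exfalso; apply: nex; exists (C + mxdot A (X x)); split; [exact: hx|].
Qed.
End sufficiency.

(** * Characterisation of absolute minimisers *)

Theorem theorem14 (R : realType) (n : nat) (n_gt0 : (0 < n)%N)
    (H : 'M[R]_n -> R) (Om : set 'rV[R]_n) (u : 'rV[R]_n -> R)
    (H_C1 : C1_sym H)
    (H_ge0 : forall X, X \is symmetricmx -> 0 <= H X)
    (Om_open : open Om) (u_C3 : Ck 3 Om u) :
  (AM2 H Om u -> forall x, Om x -> A2infty H u x = 0) /\
  (forall (A : 'M[R]_n) (h : R -> R),
     connected Om ->
     A \is symmetricmx -> posdef A ->
     C1 h -> level_convex h ->
     (forall t, exists a b, [set s | h s = t] `<=` [set a; b]) ->
     (forall X, X \is symmetricmx -> H X = h (mxdot A X)) ->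
     let P1 := AM2 H Om u in
     let P2 := exists C : R, forall x, Om x -> mxdot A (hessian u x) = C in
     let P3 := exists2 c : R, 0 <= c &
                 forall x, Om x -> h (mxdot A (hessian u x)) = c in
     let P4 := forall x, Om x -> A2infty H u x = 0 in
     [<-> P2; P3; P4] /\ (W2infty Om u -> [<-> P1; P2; P3; P4])).
Proof.
have partA : AM2 H Om u -> forall x, Om x -> A2infty H u x = 0.
  exact: AM2_A2infty.
split=> // A h cO symA posA hC lch two HE P1 P2 P3 P4.
have [P23 [P34 P42]] : [<-> P2; P3; P4] by exact: constant_equivalences.
split=> [|uW]; first by split.
have P21 : P2 -> P1.
  move=> [C uE]; apply: (constant_AM2 lch _ HE Om_open u_C3 uE uW).
  exact: (h_ge0 n_gt0 posA HE H_ge0).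
split; first by move=> /partA.
by split=> //; split=> // /P42.
Qed.
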